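(* For every positive integer $k$, there is a polynomial-time $(k+1)$-approximation algorithm for the $(1,k)$-Flexible Graph Connectivity problem: given any feasible instance, it outputs a feasible edge-set $F$ whose cost is at most $(k+1)$ times the minimum cost of a feasible edge-set.
   Context: Let $p\ge1$, $q\ge0$ be integers. An instance of the $(p,q)$-Flexible Graph Connectivity problem $(p,q)$-FGC consists of an undirected connected graph $G=(V,E)$ (multiedges allowed, no self-loops), a partition $E=\mathscr{S}\,\dot\cup\,\mathscr{U}$ into safe edges $\mathscr{S}$ and unsafe edges $\mathscr{U}$, and nonnegative costs $c:E\to\mathbb{R}_{\ge0}$. An edge-set $F\subseteq E$ (a sub-multiset of $E$) is feasible if for every $F'\subseteq\mathscr{U}$ with $|F'|\le q$, the subgraph $(V,F\setminus F')$ is $p$-edge connected. The cost is $c(F)=\sum_{e\in F}c_e$; the goal is a feasible $F$ of minimum cost. Here $p=1$, $q=k$. *)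

(* Defs.v *)
From mathcomp Require Import all_boot all_order all_algebra.
From mathcomp Require Import reals.

Set Implicit Arguments.
Unset Strict Implicit.
Unset Printing Implicit Defensive.

Import Order.TTheory GRing.Theory Num.Theory.
Local Open Scope ring_scope.

(* Edges are the elements of 'I_m, so parallel edges are distinct and a
   sub-multiset of the edge multiset is a {set 'I_m}. *)
Record multigraph (n m : nat) := Multigraph {
  src : 'I_m -> 'I_n;
  dst : 'I_m -> 'I_n;
  no_loop : forall e, src e != dst e
}.

Section Connectivity.
Variables (n m : nat) (G : multigraph n m).

Definition adj (F : {set 'I_m}) : rel 'I_n := fun x y =>
  [exists e in F, ((src G e == x) && (dst G e == y))
               || ((src G e == y) && (dst G e == x))].

Definition connected_by (F : {set 'I_m}) : Prop :=
  forall x y : 'I_n, connect (adj F) x y.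

Definition edge_connected (p : nat) (F : {set 'I_m}) : Prop :=
  forall D : {set 'I_m}, (#|D| < p)%N -> connected_by (F :\: D).

End Connectivity.

Record fgc_instance (R : realType) (n m : nat) := FGCInstance {
  graph :> multigraph n m;
  graph_connected : connected_by graph [set: 'I_m];
  safe : {set 'I_m};
  cost : 'I_m -> R;
  cost_ge0 : forall e, 0 <= cost e
}.

Section FGC.
Variables (R : realType) (n m : nat) (I : fgc_instance R n m).

Definition unsafe : {set 'I_m} := ~: safe I.

Definition fgc_feasible (p q : nat) (F : {set 'I_m}) : Prop :=
  forall F' : {set 'I_m}, F' \subset unsafe -> (#|F'| <= q)%N ->
    edge_connected I p (F :\: F').

Definition total_cost (F : {set 'I_m}) : R := \sum_(e in F) cost I e.

Definition fgc_optimal (p q : nat) (F : {set 'I_m}) : Prop :=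
  fgc_feasible p q F /\
  forall F' : {set 'I_m}, fgc_feasible p q F' -> total_cost F <= total_cost F'.

End FGC.

(* Computation model: a random access machine with structured control flow.
   The memory consists of arrays of natural numbers and arrays of real numbers;
   a program names finitely many arrays and indexes them dynamically.  The only
   arithmetic is addition, (truncated) subtraction and comparison, with no
   multiplication, no real constant other than 0 and no conversion between the
   two sorts.  Under unit cost, numbers therefore gain only O(1) bits per step,
   so on rational costs polynomially many steps are polynomial time in the bit
   model as well. *)
Inductive nexp :=
  | NConst of nat
  | NGet of nat & nexp          (* array name, index *)
  | NAdd of nexp & nexp
  | NSub of nexp & nexp.

Inductive rexp :=
  | RZero
  | RGet of nat & nexp
  | RAdd of rexp & rexp
  | RSub of rexp & rexp.

Inductive bexp :=
  | NLe of nexp & nexp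
  | RLe of rexp & rexp
  | BNot of bexp
  | BAnd of bexp & bexp.

Inductive cmd :=
  | Skip
  | NSet of nat & nexp & nexp   (* array name, index, value *)
  | RSet of nat & nexp & rexp
  | Seq of cmd & cmd
  | If of bexp & cmd & cmd
  | While of bexp & cmd.

Record store (R : realType) := Store {
  narr : nat -> nat -> nat;
  rarr : nat -> nat -> R
}.

Definition upd (T : Type) (f : nat -> nat -> T) (a i : nat) (v : T) :
    nat -> nat -> T :=
  fun b j => if (b == a) && (j == i) then v else f b j.

Section Semantics.
Variable R : realType.
Implicit Types s : store R.

Fixpoint neval s (e : nexp) : nat :=
  match e with
  | NConst c => c
  | NGet a i => narr s a (neval s i)
  | NAdd e1 e2 => (neval s e1 + neval s e2)%N
  | NSub e1 e2 => (neval s e1 - neval s e2)%N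
  end.

Fixpoint reval s (e : rexp) : R :=
  match e with
  | RZero => 0
  | RGet a i => rarr s a (neval s i)
  | RAdd e1 e2 => reval s e1 + reval s e2
  | RSub e1 e2 => reval s e1 - reval s e2
  end.

Fixpoint beval s (b : bexp) : bool :=
  match b with
  | NLe e1 e2 => (neval s e1 <= neval s e2)%N
  | RLe e1 e2 => reval s e1 <= reval s e2
  | BNot b1 => ~~ beval s b1
  | BAnd b1 b2 => beval s b1 && beval s b2
  end.

(* exec c s t s' : started in s, the program c halts in s' after t steps.
   Each assignment and each test is one step; expressions are part of the fixed
   program text, so evaluating one takes a bounded number of operations. *)
Inductive exec : cmd -> store R -> nat -> store R -> Prop :=
  | exec_skip s : exec Skip s 1%N s
  | exec_nset s a i e :
      exec (NSet a i e) s 1%N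
        (Store (upd (narr s) a (neval s i) (neval s e)) (rarr s))
  | exec_rset s a i e :
      exec (RSet a i e) s 1%N
        (Store (narr s) (upd (rarr s) a (neval s i) (reval s e)))
  | exec_seq c1 c2 s1 s2 s3 t1 t2 :
      exec c1 s1 t1 s2 -> exec c2 s2 t2 s3 ->
      exec (Seq c1 c2) s1 (t1 + t2)%N s3
  | exec_if b c1 c2 s t s' :
      exec (if beval s b then c1 else c2) s t s' ->
      exec (If b c1 c2) s t.+1 s'
  | exec_while_false b c s :
      ~~ beval s b -> exec (While b c) s 1%N s
  | exec_while_true b c s1 s2 s3 t1 t2 :
      beval s1 b -> exec c s1 t1 s2 -> exec (While b c) s2 t2 s3 ->
      exec (While b c) s1 (t1 + t2).+1%N s3.

End Semantics.

(* nth_ord d f i is f i for i < m, and d for i >= m. *)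
Definition nth_ord (T : Type) (m : nat) (d : T) (f : 'I_m -> T) (i : nat) : T :=
  if insub i is Some e then f e else d.

(* Input layout.  Integer array 0 holds n and m at indices 0 and 1; integer
   arrays 1, 2 and 3 hold, for each edge, its two ends and its safe/unsafe bit;
   real array 0 holds the edge costs.  Everything else is 0. *)
Definition input_store (R : realType) (n m : nat) (I : fgc_instance R n m) :
    store R :=
  Store
    (fun a i =>
       match a with
       | 0 => nth 0 [:: n; m] i
       | 1 => nth_ord 0%N (fun e => nat_of_ord (src I e)) i
       | 2 => nth_ord 0%N (fun e => nat_of_ord (dst I e)) i
       | 3 => nth_ord 0%N (fun e => nat_of_bool (e \in safe I)) i
       | _ => 0
       end%N)
    (fun a i => if a is 0%N then nth_ord 0 (cost I) i else 0).

(* The output edge set is the support of integer array 4. *)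
Definition output_set (R : realType) (m : nat) (s : store R) : {set 'I_m} :=
  [set e : 'I_m | narr s 4 e != 0%N].

(* Main.v *)
(* Bidirect every edge and take k+1 layers.  A choice of one spanning tree per
   layer in which every vertex but the root has indegree k+1 overall, and in which
   each orientation of an unsafe edge occurs in at most one layer, uses at least
   k+1 arcs entering every vertex set X that avoids the root: the heads in X give
   (k+1)|X| arcs and the trees put at most (k+1)(|X|-1) of them inside X.  Hence
   its edge set is feasible.  Conversely an optimal F, with k+1 copies of its safe
   edges, contains k+1 disjoint arborescences by Edmonds' theorem; each uses an
   edge at most once, so such a choice of cost at most (k+1)c(F) exists.

   A cheapest choice is a minimum common base of two families with the symmetric
   exchange property, found by weight splitting.  Keep bases B1 and B2, minimal for
   w-p and for p; on a shortest path of tight exchange arcs from B1\B2 to B2\B1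
   perform the first exchange only (the rest of the path survives because it has no
   shortcut); if there is no such path, lower p outside the set that reaches
   B2\B1.  Starting from disjoint bases with p = 0 on B2 and p = w elsewhere, this
   ends with B1 = B2 after polynomially many exchanges and potential changes.

   The program uses loops with bounds linear in n and m only, which makes its
   running time polynomial by construction. *)

Require Import Defs.
From mathcomp Require Import all_boot all_order all_algebra.
From mathcomp Require Import reals.
From mathcomp Require Import zify ring lra.

Set Implicit Arguments.
Unset Strict Implicit.
Unset Printing Implicit Defensive.

Import Order.TTheory GRing.Theory Num.Theory.
Local Open Scope ring_scope.

(** * Base families with the symmetric exchange property *)

(** A whole augmentation along a path would require controlling many simultaneous exchanges. This is
    avoided because the minimum-weight bases of a family with symmetric exchange again have
    symmetric exchange: tight arcs are then exchange arcs of that smaller family, and a statement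
    about two swaps is enough. One exchange makes the second element of the path the new source, or
    removes a source if that element is a sink.

    The starting potential is optimal only for disjoint bases. For this every element has a third,
    spare copy: the first base uses spare copies over a spanning tree, the second only ordinary
    ones. A spare copy has the ends and price of the forward copy, and for an unsafe edge also its
    class, so its presence in a final base is harmless.

    The constraint on unsafe edges is imposed for each orientation and not for each edge. Every
    class then lies at one head, which keeps the exchange property of the degree family; and since a
    vertex set determines the orientation in which an edge can enter it, the arcs entering the set
    through unsafe edges still come from distinct edges. *)

Section Exchange.
Variables (S : finType) (R : realDomainType).
Implicit Types (B : {set S}) (BB : {set S} -> Prop) (w : S -> R).

Definition swap B x y : {set S} := y |: (B :\ x).

Definition weight w B : R := \sum_(x in B) w x.

Definition sym_exchange BB := forall B B' x, BB B -> BB B' -> x \in B ->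
  x \notin B' ->
  exists y, [/\ y \in B', y \notin B, BB (swap B x y) & BB (swap B' y x)].

Definition min_base BB w B := BB B /\ forall B', BB B' -> weight w B <= weight w B'.

Lemma in_swap B x y z : (z \in swap B x y) = (z == y) || (z != x) && (z \in B).
Proof. by rewrite !inE. Qed.

Lemma weight_swap w B x y : x \in B -> y \notin B ->
  weight w (swap B x y) = weight w B - w x + w y.
Proof.
move=> xB yB; rewrite /weight /swap big_setU1 ?inE ?(negPf yB) ?andbF //=.
by rewrite (big_setD1 x xB) /= addrC [w x + _]addrC addrK.
Qed.

(** Symmetric exchange moves a competitor [B'] one element closer to [B]: the swap in [B] gives
    [w x <= w y], so the partner swap in [B'] does not raise its weight. *)
Lemma local_min BB w B : sym_exchange BB -> BB B ->
  (forall u v, u \in B -> v \notin B -> BB (swap B u v) -> w u <= w v) ->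
  min_base BB w B.
Proof.
move=> ex bB loc; split=> // B'; have [c] := ubnP #|B :\: B'|.
elim: c B' => // c IH B' lec bB'.
have [/eqP|[x]] := set_0Vmem (B :\: B').
  rewrite setD_eq0 => sBB'; suff -> : B' = B by [].
  apply/eqP; rewrite eqEsubset sBB' andbT; apply/subsetP=> x xB'.
  apply: contraT => xB; have [y [yB yB' _ _]] := ex _ _ _ bB' bB xB' xB.
  by rewrite (subsetP sBB') in yB'.
rewrite inE => /andP[xB' xB]; have [y [yB' yB b1 b2]] := ex _ _ _ bB bB' xB xB'.
have le1 := loc _ _ xB yB b1.
apply: (le_trans (IH _ _ b2)).
  rewrite ltnS in lec; apply: leq_trans lec; apply: proper_card.
  apply/properP; split.
    apply/subsetP=> z; rewrite !inE negb_or negb_and negbK.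
    move=> /andP[/andP[zx /orP[/eqP->|->]] zB]; last by rewrite zB.
    by rewrite zB in yB.
  by exists x; rewrite !inE ?xB ?xB' ?eqxx.
by rewrite weight_swap // -addrA gerDl addrC subr_le0.
Qed.

(** Exchange [s] out of [B - x + y] against [B - s + v]. Only [v] and [x] can come in: [v] gives the
    double swap, and [x] gives [B - s + y], which is excluded. On a path, the excluded swap is a
    shortcut. *)
Lemma swap_swap_base BB B s v x y : sym_exchange BB ->
  s \in B -> v \notin B -> x \in B -> y \notin B -> x != s -> y != v ->
  BB (swap B s v) -> BB (swap B x y) -> ~ BB (swap B s y) ->
  BB (swap (swap B s v) x y).
Proof.
move=> ex sB vB xB yB xs yv b1 b2 nb.
have vs : v != s by apply: contraNneq vB => ->.
have ys : y != s by apply: contraNneq yB => ->.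
have vx : v != x by apply: contraNneq vB => ->.
have yx : y != x by apply: contraNneq yB => ->.
have [|| z [zB' zB'' b3 _]] := ex _ _ s b2 b1.
- by rewrite in_swap sB (eq_sym s x) xs orbT.
- by rewrite in_swap eqxx (eq_sym s v) (negPf vs).
move: zB' zB'' b3; rewrite !in_swap => /orP[/eqP->|/andP[zs zB]].
  move=> _; congr BB; apply/setP=> t; rewrite !in_swap.
  have [->|tv] := eqVneq t v; first by rewrite vx orbT.
  by have [->|ty] := eqVneq t y; rewrite ?ys //= andbCA.
rewrite zB andbT negb_or negbK => /andP[zy /eqP->] b3; case: nb; move: b3; congr BB.
apply/setP=> t; rewrite !in_swap.
have [->|tx] := eqVneq t x; first by rewrite xs xB orbT.
by have [->|ty] := eqVneq t y; rewrite ?ys.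
Qed.

Lemma swap_min_base BB w B x y : min_base BB w B -> x \in B -> y \notin B ->
  w x = w y -> BB (swap B x y) -> min_base BB w (swap B x y).
Proof.
move=> [bB mB] xB yB e b; split=> // B' bB'; rewrite weight_swap // e addrNK.
exact: mB.
Qed.

Lemma min_base_swap BB w B x y : min_base BB w B -> x \in B -> y \notin B ->
  BB (swap B x y) -> w x <= w y.
Proof.
move=> [bB mB] xB yB b; have := mB _ b.
by rewrite weight_swap // -addrA lerDl addrC subr_ge0.
Qed.

Lemma min_base_swap_eq BB w B x y : min_base BB w B -> x \in B -> y \notin B ->
  min_base BB w (swap B x y) -> w x = w y.
Proof.
move=> mB xB yB mB'; apply: le_anti; rewrite (min_base_swap mB xB yB mB'.1) /=.
by have := mB'.2 _ mB.1; rewrite weight_swap // -addrA gerDl addrC subr_le0.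
Qed.

(** The two partner swaps bound the weight difference of [x] and [y] from both sides, so both
    preserve the weight. *)
Lemma min_base_exchange BB w : sym_exchange BB -> sym_exchange (min_base BB w).
Proof.
move=> ex B B' x mB mB' xB xB'; have [y [yB' yB b1 b2]] := ex _ _ _ mB.1 mB'.1 xB xB'.
have le1 := min_base_swap mB xB yB b1; have le2 := min_base_swap mB' yB' xB' b2.
have e : w x = w y by apply: le_anti; rewrite le1 le2.
exists y; split=> //; exact: swap_min_base.
Qed.

End Exchange.

(** * Weighted matroid intersection by single exchanges *)

Section Intersection.
Variables (S : finType) (R : realDomainType).
Variables (base1 base2 : pred {set S}) (w : S -> R).
Let BB1 B : Prop := base1 B.
Let BB2 B : Prop := base2 B.
Hypotheses (ex1 : sym_exchange BB1) (ex2 : sym_exchange BB2).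

Record mstate := MState { fstb : {set S}; sndb : {set S}; pot : S -> R }.
Implicit Types (st : mstate) (u v x y : S) (c : bool) (X : {set S}).

Definition sources st := fstb st :\: sndb st.
Definition sinks st := sndb st :\: fstb st.

(* An arc [u -> v] of kind [true] lets [v] replace [u] in the first base; one of
   kind [false] lets [u] replace [v] in the second base. *)
Definition arc st c u v := if c
  then [&& u \in fstb st, v \notin fstb st & base1 (swap (fstb st) u v)]
  else [&& u \notin sndb st, v \in sndb st & base2 (swap (sndb st) v u)].

(** The increase, caused by the swap, of the weight for which that base is kept minimal: [w - pot]
    for the first base, [pot] for the second. *)
Definition slack st c u v : R := if c
  then (w v - pot st v) - (w u - pot st u) else pot st u - pot st v.

Definition tight st c u v := arc st c u v && (slack st c u v == 0).

Definition expand st X :=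
  sinks st :|: [set x | [exists y in X, [exists c, tight st c x y]]].

(** Level 0 is empty and level 1 consists of the sinks, so level [i.+1] holds the elements at
    distance at most [i] from a sink. *)
Definition level st i := iter i (expand st) set0.
Definition coreach st := fixset (expand st).

Definition split_optimal st :=
  min_base BB1 (fun x => w x - pot st x) (fstb st) /\
  min_base BB2 (pot st) (sndb st).

Lemma expand_mono st : {homo expand st : X Y / X \subset Y}.
Proof.
move=> X Y sXY; apply: setUS; apply/subsetP=> x; rewrite !inE => /exists_inP[y yX h].
by apply/exists_inP; exists y => //; apply: (subsetP sXY).
Qed.

Lemma level_sub st i j : (i <= j)%N -> level st i \subset level st j.
Proof. exact: subset_iter (@expand_mono st) _ _. Qed.

Lemma level_coreach st i : level st i \subset coreach st.
Proof. exact: iter_sub_fix (@expand_mono st) _. Qed.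

Lemma levelS st i x c y : y \in level st i -> tight st c x y -> x \in level st i.+1.
Proof.
move=> yL t; rewrite /level iterS -/(level st i) /expand inE; apply/orP; right; rewrite inE.
by apply/exists_inP; exists y => //; apply/existsP; exists c.
Qed.

Lemma levelSP st i x : x \in level st i.+1 ->
  x \in sinks st \/ exists y c, y \in level st i /\ tight st c x y.
Proof.
rewrite /level iterS -/(level st i) inE => /orP[->|]; first by left.
by rewrite inE => /exists_inP[y yL /existsP[c t]]; right; exists y, c.
Qed.

Lemma coreachS st x c y : y \in coreach st -> tight st c x y -> x \in coreach st.
Proof.
move=> yL t; rewrite -[coreach st](fixsetK (@expand_mono st)) inE; apply/orP; right.
by rewrite inE; apply/exists_inP; exists y => //; apply/existsP; exists c.
Qed.

Lemma sinks_coreach st : sinks st \subset coreach st.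
Proof. by rewrite -[coreach st](fixsetK (@expand_mono st)) subsetUl. Qed.

Lemma slack_ge0 st c u v : split_optimal st -> arc st c u v -> 0 <= slack st c u v.
Proof.
move=> [m1 m2]; case: c => /and3P[? ? ?]; rewrite subr_ge0.
  exact: min_base_swap m1 _ _ _.
exact: min_base_swap m2 _ _ _.
Qed.

Definition exchange st c u v := if c
  then MState (swap (fstb st) u v) (sndb st) (pot st)
  else MState (fstb st) (swap (sndb st) v u) (pot st).

Definition potential_drop st d :=
  MState (fstb st) (sndb st) (fun x => if x \in coreach st then pot st x else pot st x - d).

Definition crossing st c u v :=
  [&& u \notin coreach st, v \in coreach st & arc st c u v].

(* Along a shortest tight path only the first exchange is carried out. *)
Variant mstep st : mstate -> Prop :=
  | StepExchange i c u v of [disjoint sources st & level st i] &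
      u \in sources st & v \in level st i & tight st c u v :
      mstep st (exchange st c u v)
  | StepDrop c u v of [disjoint sources st & coreach st] & crossing st c u v &
      (forall c' u' v', crossing st c' u' v' -> slack st c u v <= slack st c' u' v') :
      mstep st (potential_drop st (slack st c u v))
  | StepStuck of [disjoint sources st & coreach st] &
      (forall c u v, ~~ crossing st c u v) : mstep st st.

Lemma tight_min st c u v : split_optimal st -> tight st c u v ->
  if c then min_base BB1 (fun x => w x - pot st x) (swap (fstb st) u v)
  else min_base BB2 (pot st) (swap (sndb st) v u).
Proof.
move=> [m1 m2] /andP[]; case: c => /and3P[i1 i2 b] /=; rewrite subr_eq0 => /eqP e.
  exact: swap_min_base.
exact: swap_min_base.
Qed.

Lemma exchange_optimal st c u v : split_optimal st -> tight st c u v ->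
  split_optimal (exchange st c u v).
Proof. by move=> o t; have := tight_min o t; case: c {t} => m; case: o; split. Qed.

Section OneExchange.
Variables (st : mstate) (i : nat) (c : bool) (u v : S).
Hypotheses (opt : split_optimal st) (dis : [disjoint sources st & level st i]).
Hypotheses (uS : u \in sources st) (vL : v \in level st i) (tuv : tight st c u v).
Let st' := exchange st c u v.

Let uL : u \notin level st i.
Proof. by rewrite (disjointFr dis uS). Qed.

(** A tight arc from [u] into a level below [i] would put [u] into level [i]. This is the absence of
    shortcuts on a shortest path. *)
Let below x j : x \in level st j -> (j < i)%N -> x != v /\ forall d, ~~ tight st d u x.
Proof.
move=> xL ji; split.
  apply: contraNneq uL => e; apply: (subsetP (level_sub st ji)).
  by apply: levelS tuv; rewrite -e.
move=> d; apply: contra uL => t; apply: (subsetP (level_sub st ji)).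
exact: levelS t.
Qed.

Let opt1 : sym_exchange (min_base BB1 (fun x => w x - pot st x)).
Proof. exact: min_base_exchange. Qed.
Let opt2 : sym_exchange (min_base BB2 (pot st)).
Proof. exact: min_base_exchange. Qed.

(** Arcs of the other kind concern a base that is not changed. For arcs of the same kind the double
    swap is a minimum base, because the shortcut from [u] to [y] is not tight. *)
Lemma exchange_tight d x y j : (j < i)%N -> x \in level st j.+1 ->
  y \in level st j -> tight st d x y -> tight st' d x y.
Proof.
move=> ji xL yL t; have [yv nt] := below yL ji.
have xu : x != u.
  by apply: contraNneq uL => <-; apply: (subsetP (level_sub st ji)).
have m1 := tight_min opt tuv; have m2 := tight_min opt t.
move: (tuv) (t) m1 m2; rewrite /tight /st'; case: c; case: d {t} => //=.
- move=> /andP[/and3P[uB vB b1] e1] /andP[/and3P[xB yB b2] e2] m1 m2.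
  rewrite !in_swap xB xu (negPf yB) (negPf yv) andbF orbT /=.
  rewrite [_ == 0]e2 andbT.
  suff [] : min_base BB1 (fun x => w x - pot st x) (swap (swap (fstb st) u v) x y) by [].
  apply: swap_swap_base => // m3; have /negP[] := nt true.
  rewrite /tight /= uB yB (m3.1 : base1 _) subr_eq0.
  by rewrite (min_base_swap_eq opt.1 uB yB m3) eqxx.
- move=> /andP[/and3P[uB vB b1] e1] /andP[/and3P[xB yB b2] e2] m1 m2.
  rewrite !in_swap (negPf xB) (negPf xu) yB yv andbF orbT /=.
  rewrite [_ == 0]e2 andbT.
  suff [] : min_base BB2 (pot st) (swap (swap (sndb st) v u) y x) by [].
  (* In the second base arcs swap their head out and their tail in. With this order the single swap
     that must fail is [u] for [y], again the shortcut. *)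
  have -> : swap (swap (sndb st) v u) y x = swap (swap (sndb st) y x) v u.
    have yu : y != u by apply: contraNneq uB => <-.
    have xv : x != v by apply: contraNneq xB => ->.
    apply/setP=> z; rewrite !in_swap.
    have [->|zx] := eqVneq z x; first by rewrite (negPf xu) xv.
    have [->|zu] := eqVneq z u; last by rewrite /= andbCA.
    by rewrite eq_sym yu.
  apply: swap_swap_base => //; try by rewrite eq_sym.
  move=> m3; have /negP[] := nt false.
  rewrite /tight /= uB yB (m3.1 : base2 _) subr_eq0.
  by rewrite (min_base_swap_eq opt.2 yB uB m3) eqxx.
Qed.

(** After the exchange [u] lies in both bases or in neither. If [v] was a sink, the same holds for
    [v]; otherwise [v] ends in the first base only and takes over the role of [u]. *)
Lemma exchange_sources :
  if v \in sinks st then (#|sources st'| < #|sources st|)%N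
  else (#|sources st'| == #|sources st|) && (v \in sources st').
Proof.
move: uS tuv; rewrite /sources /sinks !inE /tight /st' => /andP[uB2 uB1].
have vu : v != u by apply: contraNneq uL => <-.
case: c => /=.
  move=> /andP[/and3P[_ vB1 _] _]; rewrite (negPf vB1) /=.
  have -> : swap (fstb st) u v :\: sndb st
    = if v \in sndb st then (fstb st :\: sndb st) :\ u
      else v |: ((fstb st :\: sndb st) :\ u).
    apply/setP=> z; case: ifP => vB2; rewrite !inE; have [->|zv] := eqVneq z v;
      rewrite ?vB2 ?(negPf vB1) //= ?andbF //; by rewrite andbCA.
  case: ifP => vB2; rewrite vB2.
    by rewrite [X in (_ < X)%N](cardsD1 u) in_setD uB1 uB2 leqnn.
  rewrite cardsU1 [X in _ == X](cardsD1 u) !inE uB1 uB2 (negPf vB1) eqxx vB2 /= andbF.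
  by rewrite ?in_swap eqxx.
move=> /andP[/and3P[_ vB2 _] _]; rewrite vB2 andbT.
have -> : fstb st :\: swap (sndb st) v u
    = if v \notin fstb st then (fstb st :\: sndb st) :\ u
      else v |: ((fstb st :\: sndb st) :\ u).
  apply/setP=> z; case: ifP => [/negPf vB1|/negbFE vB1]; rewrite !inE;
  have [->|zv] := eqVneq z v; rewrite ?vB2 ?vB1 //= ?andbF ?orbF ?(negPf vu) //;
  by have [->|] := eqVneq z u.
case: ifP => [vB1|/negbFE vB1]; rewrite ?vB1.
  by rewrite [X in (_ < X)%N](cardsD1 u) in_setD uB1 uB2 leqnn.
rewrite cardsU1 [X in _ == X](cardsD1 u) !inE uB1 uB2 vB1 vB2 eqxx /= andbF.
by rewrite ?in_swap eqxx (negPf vu) ?eqxx.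
Qed.

(** No sink is lost when [v] is not one, and the tight arcs between consecutive levels up to [i]
    survive by [exchange_tight]. So [v] stays as near to the sinks as before. *)
Lemma exchange_level j : v \notin sinks st -> (j <= i)%N ->
  level st j \subset level st' j.
Proof.
move=> vS; elim: j => [|j IH] ji; first exact: sub0set.
apply/subsetP=> x xL; have [xS|[y [d [yL t]]]] := levelSP xL.
  rewrite /level iterS inE; apply/orP; left.
  move: xS vS (uS) (tuv); rewrite /sinks /sources /st' !inE /tight.
  case: c => /= /andP[xB1 xB2] vS /andP[uB2 uB1] /andP[/and3P[? ? _] _].
    rewrite in_swap xB2 (negPf xB1) andbF orbF andbT; apply: contraNneq vS => <-.
    by rewrite xB1 xB2.
  rewrite in_swap xB1 xB2 andbT /=; apply/orP; right; apply: contraNneq vS => <-.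
  by rewrite xB1 xB2.
have t' := exchange_tight ji xL yL t; apply: levelS t'.
by apply: (subsetP (IH (ltnW ji))).
Qed.

End OneExchange.

Lemma exchange_in_coreach st i c u v : v \in level st i -> tight st c u v ->
  u \in coreach st.
Proof. by move=> vL t; apply: (subsetP (level_coreach st i.+1)); apply: levelS t. Qed.

Hypothesis base_card : forall B B', base1 B -> base2 B' -> #|B| = #|B'|.

(** Only arcs between the two sides of [coreach] change slack: those entering it lose [d], those
    leaving it gain [d]. As [d] is the least entering slack, all slacks stay nonnegative, and
    [local_min] applies. *)
Lemma drop_optimal st d c u v : split_optimal st -> crossing st c u v ->
  (forall c' u' v', crossing st c' u' v' -> slack st c u v <= slack st c' u' v') ->
  d = slack st c u v -> split_optimal (potential_drop st d).
Proof.
move=> opt cr mn ->.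
have d0 : 0 <= slack st c u v by apply: slack_ge0 opt _; case/and3P: cr.
move: (slack st c u v) mn d0 => d' mn d0.
have sl a x y : arc st a x y -> 0 <= slack (potential_drop st d') a x y.
  move=> ar; have := slack_ge0 opt ar; have := @mn a x y.
  rewrite /crossing ar /slack /=.
  case: (x \in coreach st); case: (y \in coreach st) => //= h1 h2;
    try have {}h1 := h1 isT; case: a {ar} h1 h2 => h1 h2; lra.
by split; apply: local_min => //; [case: opt => -[]| |case: opt => _ []|] => //= x y xB yB b;
  rewrite -subr_ge0; [apply: (sl true)|apply: (sl false)] => /=; rewrite ?xB ?yB.
Qed.

(** Arcs inside [coreach] keep their slack, so the old set survives; the crossing arc itself becomes
    tight and its tail joins. *)
Lemma drop_coreach st c u v : crossing st c u v ->
  (#|coreach st| < #|coreach (potential_drop st (slack st c u v))|)%N.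
Proof.
move=> cr; set st' := potential_drop _ _.
have sub : coreach st \subset coreach st'.
  rewrite {1}/coreach /fixset; elim: #|S| => [|j IH]; first exact: sub0set.
  apply/subsetP=> x xL; have [xS|[y [d [yL t]]]] := levelSP xL.
    exact: (subsetP (sinks_coreach st')).
  have yQ := subsetP (level_coreach st j) _ yL.
  have xQ := coreachS yQ t.
  have t' : tight st' d x y.
    by move: t; rewrite /tight /slack /arc /st' /= xQ yQ.
  apply: coreachS t'; exact: (subsetP IH).
apply: proper_card; apply/properP; split=> //.
case/and3P: cr => uQ vQ ar; exists u => //.
have t : tight st' c u v.
  rewrite /tight [arc _ _ _ _]ar /st' {st' sub} /slack /= vQ (negPf uQ).
  by apply/eqP; case: c {ar} => /=; ring.
by apply: coreachS t; apply: (subsetP sub).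
Qed.

(* If no arc crossed, the indicator functions of the two sides would make both
   bases optimal, so every common base would be too large. *)
Lemma crossing_exists st B : split_optimal st -> base1 B -> base2 B ->
  [disjoint sources st & coreach st] -> sources st != set0 ->
  exists c u v, crossing st c u v.
Proof.
move=> opt b1 b2 dis /set0Pn[x0 x0S].
have [/existsP[c /existsP[u /existsP[v cr]]]|no] :=
  boolP [exists c, exists u, exists v, crossing st c u v]; first by exists c, u, v.
have nc c u v : ~~ crossing st c u v.
  by move: no; apply: contra => cr; apply/existsP; exists c; apply/existsP;
     exists u; apply/existsP; exists v.
set Q := coreach st in dis.
pose w1 x : R := (x \notin Q)%:R; pose w2 x : R := (x \in Q)%:R.
have m1 : min_base BB1 w1 (fstb st).
  apply: local_min => //; first by case: opt => -[].
  move=> u v uB vB b; rewrite /w1 ler_nat; move: (nc true u v).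
  by rewrite /crossing /= uB vB (b : base1 _) -/Q; case: (u \in Q); case: (v \in Q).
have m2 : min_base BB2 w2 (sndb st).
  apply: local_min => //; first by case: opt => _ [].
  move=> u v uB vB b; rewrite /w2 ler_nat; move: (nc false v u).
  by rewrite /crossing /= uB vB (b : base2 _) -/Q; case: (u \in Q); case: (v \in Q).
have wE (P : pred S) (C : {set S}) :
    weight (fun x => (P x)%:R) C = #|[set x in C | P x]|%:R :> R.
  rewrite /weight -natr_sum; congr _%:R; rewrite -sum1_card big_mkcond /=.
  rewrite [RHS]big_mkcond /=; apply: eq_bigr => x _; rewrite inE.
  by case: (x \in C); case: (P x).
have := m1.2 _ (b1 : BB1 B); have := m2.2 _ (b2 : BB2 B).
rewrite /w1 /w2 (wE (fun x => x \notin Q)) (wE (fun x => x \notin Q)).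
rewrite (wE (fun x => x \in Q)) (wE (fun x => x \in Q)) !ler_nat => l2 l1.
have cB : #|B| = (#|[set x in B | x \in Q]| + #|[set x in B | x \notin Q]|)%N.
  rewrite -(cardsID Q B); congr (_ + _)%N; apply: eq_card => x; rewrite !inE //.
  by rewrite andbC.
have cE : #|B| = #|sndb st| by apply: base_card => //; case: opt => _ [].
have cB2 : #|sndb st| = (#|[set x in sndb st | x \in Q]| + #|[set x in sndb st | x \notin Q]|)%N.
  rewrite -(cardsID Q (sndb st)); congr (_ + _)%N; apply: eq_card => x; rewrite !inE //.
  by rewrite andbC.
(* All sinks lie in [Q], so outside [Q] the second base is contained in the first; the source [x0]
   makes the inclusion strict. *)
have lt : (#|[set x in sndb st | x \notin Q]| < #|[set x in fstb st | x \notin Q]|)%N.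
  apply: proper_card; apply/properP; split.
    apply/subsetP=> x; rewrite !inE => /andP[x2 xQ]; rewrite xQ andbT.
    apply: contraR xQ => x1; apply: (subsetP (sinks_coreach st)).
    by rewrite inE x1 x2.
  exists x0; rewrite !inE (disjointFr dis x0S) /= andbT.
    by move: x0S; rewrite inE => /andP[].
  by move: x0S; rewrite inE => /andP[/negPf->].
move: cB cE cB2 l1 l2 lt; lia.
Qed.

Let N := #|S|.

(** Levels increase, so when some source is reached this is the index of the first level that
    contains one. *)
Definition source_free st := (\sum_(i < N.+1) [disjoint sources st & level st i])%N.

(** A lexicographic measure. The second component is at most [2 * N + 1]: it exceeds [N] while the
    potential has to be lowered, and is at most [N] as soon as a source lies in [coreach], so
    changing from one regime to the other decreases it. *)
Definition progress st : nat :=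
  (#|sources st| * (2 * N + 3)
   + (if [disjoint sources st & coreach st] then N.+1 + (N - #|coreach st|)
      else source_free st))%N.

Lemma sum_ltn_ord a b : (b <= a)%N -> (\sum_(j < a) (j < b) = b)%N.
Proof.
move=> ba.
rewrite -[RHS](card_ord b) -sum1_card (big_ord_widen a (fun=> 1%N) ba).
by rewrite [RHS]big_mkcond; apply: eq_bigr => j _; case: ltnP.
Qed.

Lemma source_free_le st i x : (i <= N.+1)%N -> x \in sources st ->
  x \in level st i -> (source_free st <= i)%N.
Proof.
move=> iN xS xL; rewrite -(sum_ltn_ord iN); apply: leq_sum => j _.
case: ltnP => [_|ij]; first exact: leq_b1.
suff /negPf-> : ~~ [disjoint sources st & level st j] by [].
rewrite -setI_eq0; apply/set0Pn; exists x.
by rewrite inE xS (subsetP (level_sub st ij)).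
Qed.

Lemma source_free_ge st i : (i <= N)%N -> [disjoint sources st & level st i] ->
  (i < source_free st)%N.
Proof.
move=> iN dis; rewrite -(sum_ltn_ord (iN : i.+1 <= N.+1)%N); apply: leq_sum => j _.
rewrite ltnS; case: (leqP j i) => // ji.
by rewrite (disjointWr (level_sub st ji) dis).
Qed.

(** The two factors are the bounds of the two nested loops in [main_stm]. *)
Lemma progress_le st : (progress st < N.+1 * (2 * N + 3))%N.
Proof.
have le1 : (#|sources st| <= N)%N by exact: max_card.
have le2 : (source_free st <= N.+1)%N.
  apply: leq_trans (leq_sum _ _) _; first by move=> j _; exact: leq_b1.
  by rewrite sum1_card card_ord.
rewrite /progress; case: ifP => _.
  apply: leq_ltn_trans (_ : _ <= N * (2 * N + 3) + (N.+1 + N))%N _; last lia.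
  by rewrite leq_add ?leq_mul // leq_add2l leq_subr.
apply: leq_ltn_trans (_ : _ <= N * (2 * N + 3) + N.+1)%N _; last lia.
by rewrite leq_add ?leq_mul.
Qed.

(** The common base [B] excludes the stuck step. An exchange loses a source or brings one into an
    earlier level; a drop enlarges [coreach] or lets it meet the sources. *)
Lemma mstep_progress st st' B : split_optimal st -> base1 B -> base2 B ->
  sources st != set0 -> mstep st st' ->
  split_optimal st' /\ (progress st' < progress st)%N.
Proof.
move=> opt b1 b2 s0; case=> {st'} [i c u v dis uS vL t|c u v dis cr mn|dis nc].
- split; first exact: exchange_optimal.
  have uQ := exchange_in_coreach vL t.
  have ndis : [disjoint sources st & coreach st] = false.
    by apply/negP => /disjointFr/(_ uS); rewrite uQ.
  have iN : (i < N)%N.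
    rewrite ltnNge; apply/negP => Ni; have := disjointFr dis uS.
    by rewrite (subsetP (level_sub st Ni)).
  have ge := source_free_ge (ltnW iN) dis.
  rewrite /progress ndis; have := exchange_sources dis uS vL t.
  set st' := exchange st c u v; case: ifP => vS.
    move=> lt.
    have := leq_mul lt (leqnn (2 * N + 3)); rewrite mulSn.
    have le2 : (source_free st' <= N.+1)%N.
      apply: leq_trans (leq_sum _ _) _; first by move=> j _; exact: leq_b1.
      by rewrite sum1_card card_ord.
    move: (#|sources st'| * (2 * N + 3))%N (#|sources st| * (2 * N + 3))%N => a b.
    by clear -ge le2 iN; case: ifP => _; lia.
  case/andP=> /eqP-> vS'.
  have vL' : v \in level st' i.
    have sub := exchange_level opt dis uS t (negbT vS) (leqnn i).
    exact: (subsetP sub _ vL).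
  have -> : [disjoint sources st' & coreach st'] = false.
    apply/negP => /disjointFr/(_ vS').
    by rewrite (subsetP (level_coreach st' i)).
  rewrite ltn_add2l; apply: leq_ltn_trans ge.
  by apply: source_free_le vS' vL'; rewrite ltnW // ltnS ltnW.
- split; first exact: drop_optimal mn _.
  have lt := drop_coreach cr; set st' := potential_drop _ _ in lt *.
  have cN : (#|coreach st'| <= N)%N by exact: max_card.
  rewrite /progress dis ltn_add2l; case: ifP => [_|nd]; first lia.
  suff : (source_free st' <= N)%N by lia.
  move: nd => /negbT; rewrite -setI_eq0 => /set0Pn[x]; rewrite inE => /andP[xS xQ].
  exact: source_free_le xS xQ.
- have [c [u [v cr]]] := crossing_exists opt b1 b2 dis s0.
  by have := nc c u v; rewrite cr.
Qed.

(** Without sinks all levels are empty, so neither an exchange nor a drop is possible. Surplus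
    rounds of a loop with a fixed bound therefore do no harm. *)
Lemma mstep_done st st' : fstb st = sndb st -> mstep st st' ->
  fstb st' = sndb st' /\ (split_optimal st -> split_optimal st').
Proof.
move=> e.
have sk : sinks st = set0 by rewrite /sinks e setDv.
have so : sources st = set0 by rewrite /sources e setDv.
have lv i : level st i = set0.
  elim: i => // i IH; rewrite /level iterS -/(level st i) IH /expand sk set0U.
  apply/setP=> x; rewrite in_set0 in_set; apply/negbTE/negP => /exists_inP[y].
  by rewrite in_set0.
by case=> [i c u v dis|c u v _ /and3P[_]|//]; rewrite ?so ?inE // /coreach /fixset [iter _ _ _]lv inE.
Qed.

Lemma sources0_eq st : split_optimal st -> (sources st == set0) = (fstb st == sndb st).
Proof.
move=> [[b1 _] [b2 _]]; rewrite /sources setD_eq0 eqEcard.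
by rewrite (base_card b1 b2) leqnn andbT.
Qed.

(** The weight is the sum of [w - pot] and [pot], and the shared base minimises each summand over a
    family containing every common base. *)
Lemma split_optimal_common st B : split_optimal st -> fstb st = sndb st ->
  base1 B -> base2 B -> weight w (fstb st) <= weight w B.
Proof.
move=> [m1 m2] e b1 b2.
have sp C : weight w C = weight (fun x => w x - pot st x) C + weight (pot st) C.
  by rewrite /weight -big_split; apply: eq_bigr => x _; rewrite /= subrK.
by rewrite !sp lerD ?(m1.2 _ b1) // e (m2.2 _ b2).
Qed.

(** Both parts of the weight are nonnegative; [w - pot] vanishes off [B2], hence on [B1], and [pot]
    vanishes on [B2]. *)
Lemma split_optimal_init B1 B2 : base1 B1 -> base2 B2 -> [disjoint B1 & B2] ->
  (forall x, 0 <= w x) ->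
  split_optimal (MState B1 B2 (fun x => if x \in B2 then 0 else w x)).
Proof.
move=> b1 b2 dis w0; split; apply: local_min => //= u v uB vB _.
  by rewrite (disjointFr dis uB) subrr; case: ifP => _; rewrite ?subr0 ?subrr.
by rewrite uB (negPf vB).
Qed.

End Intersection.

(** * Spanning trees and the two base families *)

Section Joined.
Variables (V S : finType) (tl hd : S -> V).
Implicit Types (T : {set S}) (a b : V) (x : S).

Definition link T : rel V := fun a b =>
  [exists x in T, ((tl x == a) && (hd x == b)) || ((tl x == b) && (hd x == a))].

Definition joined T a b := connect (link T) a b.

Lemma joined_sym T a b : joined T a b = joined T b a.
Proof.
apply: sym_connect_sym => c d; apply/exists_inP/exists_inP => -[x xT h];
by exists x; rewrite // orbC.
Qed.

End Joined.

Lemma joined_map (V S S' : finType) (tl hd : S -> V) (tl' hd' : S' -> V)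
    (T : {set S}) (T' : {set S'}) :
  (forall x, x \in T -> joined tl' hd' T' (tl x) (hd x)) ->
  forall a b, joined tl hd T a b -> joined tl' hd' T' a b.
Proof.
move=> h a b; apply: connect_sub => c d /exists_inP[x xT].
case/orP=> /andP[/eqP<- /eqP<-]; first exact: h.
by rewrite -/(joined _ _ _ _ _) joined_sym; apply: h.
Qed.

Section Trees.
Variables (V S : finType) (tl hd : S -> V).
Implicit Types (T : {set S}) (X : {set V}) (a b : V) (x y : S).
Local Notation joined := (joined tl hd).

Definition spans T := [forall a, forall b, joined T a b].
Definition component T a := [set b | joined T a b].
Definition crosses X x := (tl x \in X) != (hd x \in X).

Lemma spansP T : reflect (forall a b, joined T a b) (spans T).
Proof. by apply: (iffP forallP) => h a; apply/forallP. Qed.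

Lemma joined0 T a : joined T a a.
Proof. exact: connect0. Qed.

Lemma joined_trans T b a c : joined T a b -> joined T b c -> joined T a c.
Proof. exact: connect_trans. Qed.

Lemma joined1 T x : x \in T -> joined T (tl x) (hd x).
Proof. by move=> xT; apply: connect1; apply/exists_inP; exists x; rewrite // !eqxx. Qed.

Lemma joinedS T T' a b : T \subset T' -> joined T a b -> joined T' a b.
Proof. by move=> sub; apply: joined_map => x xT; apply/joined1/(subsetP sub). Qed.

Lemma joined_closed T X a b : (forall x, x \in T -> ~~ crosses X x) ->
  joined T a b -> (a \in X) = (b \in X).
Proof.
move=> h; apply: closed_connect => c d /exists_inP[x xT].
by have := h x xT; rewrite negbK => /eqP e /orP[]/andP[/eqP<- /eqP<-].
Qed.

Lemma joined_crosses T X a b : joined T a b -> a \in X -> b \notin X ->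
  exists2 x, x \in T & crosses X x.
Proof.
move=> j aX bX; apply/exists_inP; apply: contraT => /exists_inPn h.
by move: bX; rewrite -(joined_closed h j) aX.
Qed.

Lemma component_closed T a x : x \in T -> ~~ crosses (component T a) x.
Proof.
move=> xT; rewrite negbK !inE; apply/eqP; apply/idP/idP => h; apply: joined_trans h _.
  exact: joined1.
by rewrite joined_sym; apply: joined1.
Qed.

(** Enlarge [X] by one vertex along a crossing edge of [T]. That edge was not inside [X] but is
    inside the larger set, so it pays for the new vertex. *)
Lemma spans_outside T X : spans T -> X != set0 ->
  (#|~: X| <= #|[set x in T | ~~ ((tl x \in X) && (hd x \in X))]|)%N.
Proof.
move=> /spansP sp; have [c] := ubnP #|~: X|; elim: c X => // c IH X lec X0.
have [->|[b]] := set_0Vmem (~: X); first by rewrite cards0.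
rewrite inE => bX; case/set0Pn: X0 => a aX.
have [x xT cr] := joined_crosses (sp a b) aX bX.
have [d [dX dx]] : exists d, d \notin X /\
   ((tl x \in X) && (hd x == d) || (hd x \in X) && (tl x == d)).
  move: cr; rewrite /crosses; case e1: (tl x \in X); case e2: (hd x \in X) => // _.
    by exists (hd x); rewrite e2 eqxx.
  by exists (tl x); rewrite e1 eqxx.
have cE : #|~: X| = #|~: (d |: X)|.+1.
  by rewrite setCU (cardsD1 d) inE dX add1n setDE setIC.
apply: leq_trans (_ : #|[set x in T | ~~ ((tl x \in d |: X) && (hd x \in d |: X))]|.+1 <= _)%N.
  rewrite cE ltnS; apply: IH; first by rewrite -ltnS -cE.
  by apply/set0Pn; exists d; rewrite !inE eqxx.
apply: proper_card; apply/properP; split.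
  apply/subsetP=> y; rewrite !inE => /andP[->] /=; apply: contra.
  by case/andP=> -> ->; rewrite !orbT.
exists x; rewrite !inE xT /=.
  by apply: contraL cr; rewrite /crosses => /andP[-> ->].
by case/orP: dx => /andP[-> ->]; rewrite ?orbT.
Qed.

Lemma spans_card T : spans T -> (#|V|.-1 <= #|T|)%N.
Proof.
move=> sp; case: (pickP V) => [a _|V0]; last by rewrite (eq_card0 V0).
have := @spans_outside T [set a] sp; rewrite cardsC1 => h.
apply: leq_trans (h _) _; first by apply/set0Pn; exists a; rewrite inE.
by apply: subset_leq_card; apply/subsetP=> x; rewrite inE => /andP[].
Qed.

Definition tree T := spans T && (#|T| == #|V|.-1).

Lemma tree_inside T X : tree T -> X != set0 ->
  (#|[set x in T | (tl x \in X) && (hd x \in X)]| < #|X|)%N.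
Proof.
move=> /andP[sp /eqP cT] X0; have := spans_outside sp X0.
have := cardsC X; have X1 : (0 < #|X|)%N by rewrite card_gt0.
have := cardsID [set x | (tl x \in X) && (hd x \in X)] T.
have -> : T :&: [set x | (tl x \in X) && (hd x \in X)]
   = [set x in T | (tl x \in X) && (hd x \in X)] by apply/setP=> x; rewrite !inE.
have -> : T :\: [set x | (tl x \in X) && (hd x \in X)]
   = [set x in T | ~~ ((tl x \in X) && (hd x \in X))].
  by apply/setP=> x; rewrite !inE andbC.
by move: cT; clear -X1; lia.
Qed.

Lemma tree_cut T x : tree T -> x \in T -> ~~ joined (T :\ x) (tl x) (hd x).
Proof.
move=> /andP[/spansP sp /eqP cT] xT; apply/negP => j.
have : spans (T :\ x).
  apply/spansP=> a b; apply: joined_map (sp a b) => y yT.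
  by have [->//|yx] := eqVneq y x; apply: joined1; rewrite !inE yx.
move=> /spans_card; rewrite -cT [X in (X <= _)%N](cardsD1 x) xT.
by rewrite ltnn.
Qed.

Lemma tree_sides T x a : spans T -> x \in T ->
  joined (T :\ x) (tl x) a || joined (T :\ x) (hd x) a.
Proof.
move=> /spansP sp xT.
pose X := component (T :\ x) (tl x) :|: component (T :\ x) (hd x).
suff : a \in X by rewrite !inE.
rewrite -(@joined_closed T X (tl x) a _ (sp _ _)) ?inE ?joined0 // => y yT.
have [->|yx] := eqVneq y x; first by rewrite negbK !inE !joined0 orbT.
have yT' : y \in T :\ x by rewrite !inE yx.
have := component_closed (tl x) yT'; have := component_closed (hd x) yT'.
by rewrite !negbK => /eqP e1 /eqP e2; rewrite !in_setU e1 e2.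
Qed.

(** Without [x] there are two components, and [y] has to reconnect them. One graph search for [x]
    thus answers the question for all [y]. *)
Lemma tree_swap T x y : tree T -> x \in T -> y \notin T ->
  tree (swap T x y) = crosses (component (T :\ x) (tl x)) y.
Proof.
move=> tT xT yT; set X := component _ _; case/andP: (tT) => sp /eqP cT.
have hX : hd x \notin X by rewrite inE tree_cut.
have tX : tl x \in X by rewrite inE joined0.
apply/idP/idP.
  move=> /andP[/spansP sp' _]; have [z] := joined_crosses (sp' (tl x) (hd x)) tX hX.
  rewrite in_swap => /orP[/eqP->//|/andP[zx zT]] cr.
  by have := @component_closed (T :\ x) (tl x) z; rewrite -/X cr !inE zx zT => /(_ isT).
move=> cr; rewrite /tree.
have -> : #|swap T x y| = #|V|.-1.
  by rewrite cardsU1 !inE (negPf yT) andbF -cT (cardsD1 x T) xT.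
rewrite eqxx andbT; apply/spansP => a b; move/spansP: (sp) => sp'.
apply: joined_map (sp' a b) => z zT; have [->|zx] := eqVneq z x; last first.
  by apply: joined1; rewrite in_swap zx zT orbT.
have sub : T :\ x \subset swap T x y by apply: subsetUr.
have jy : joined (swap T x y) (tl y) (hd y) by apply: joined1; rewrite in_swap eqxx.
have side c : c \notin X -> joined (swap T x y) c (hd x).
  rewrite inE => h; have := tree_sides c sp xT; rewrite -/(joined _ _ _) (negPf h) /=.
  by rewrite joined_sym; apply: joinedS.
have inX c : c \in X -> joined (swap T x y) (tl x) c.
  by rewrite inE; apply: joinedS.
move: cr; rewrite /crosses; case: (boolP (tl y \in X)); case: (boolP (hd y \in X)) => // h1 h2 _.
  apply: joined_trans (inX _ h2) _; apply: joined_trans jy _; exact: side.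
apply: joined_trans (inX _ h1) _; rewrite joined_sym in jy.
apply: joined_trans jy _; exact: side.
Qed.

(** A minimal subset [Y] of [T] joining the ends of [x] stands for the tree path. Some [y] in it
    crosses [X], and by minimality [y] separates the ends of [x] within [Y], so [x] can replace
    it. *)
Lemma crosses_swap T X x : spans T -> tl x \in X -> hd x \notin X ->
  exists y, [/\ y \in T, crosses X y & spans (swap T y x)].
Proof.
move=> sp tX hX; move/spansP: (sp) => sp'.
pose P (Y : {set S}) := (Y \subset T) && joined Y (tl x) (hd x).
have [|Y minY sYT] := @minset_exists _ P T; first by rewrite /P subxx sp'.
case/minsetP: minY => /andP[_ jY] mY.
have [y yY cr] := joined_crosses jY tX hX.
have yT := subsetP sYT _ yY; exists y; split=> //.
have nj : ~~ joined (Y :\ y) (tl x) (hd x).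
  apply/negP => j; have := mY (Y :\ y); rewrite /P j andbT.
  rewrite (subset_trans (subsetDl _ _) sYT) subsetDl => /(_ isT isT) e.
  by move: yY; rewrite -e !inE eqxx.
have only a b : joined Y a b -> ~~ joined (Y :\ y) a b ->
    crosses (component (Y :\ y) a) y.
  move=> j nj'; have [||z zY crz] := @joined_crosses Y (component (Y :\ y) a) a b j.
  - by rewrite inE joined0.
  - by rewrite inE.
  have [e|zy] := eqVneq z y; first by move: crz; rewrite e.
  by have := @component_closed (Y :\ y) a z; rewrite crz !inE zy zY => /(_ isT).
have c1 := only _ _ jY nj.
have c2 : crosses (component (Y :\ y) (hd x)) y.
  by apply: only (tl x) _ _; rewrite joined_sym.
have sub : Y :\ y \subset swap T y x.
  by apply/subsetP=> z; rewrite in_swap !inE => /andP[-> /(subsetP sYT)->]; rewrite orbT.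
have jx : joined (swap T y x) (tl x) (hd x) by apply: joined1; rewrite in_swap eqxx.
apply/spansP => a b; apply: joined_map (sp' a b) => z zT.
have [->|zy] := eqVneq z y; last by apply: joined1; rewrite in_swap zy zT orbT.
have dis c : joined (Y :\ y) (tl x) c -> ~~ joined (Y :\ y) (hd x) c.
  move=> j; apply: contra nj => j'; apply: joined_trans j _; by rewrite joined_sym.
have J c d : joined (Y :\ y) (tl x) c -> joined (Y :\ y) (hd x) d ->
    joined (swap T y x) c d.
  move=> /(joinedS sub) j1 /(joinedS sub) j2; rewrite joined_sym in j1.
  by apply: joined_trans j1 _; apply: joined_trans jx j2.
move: c1 c2; rewrite /crosses !inE.
case: (boolP (joined _ (tl x) (tl y))) => j1; case: (boolP (joined _ (tl x) (hd y))) => // j2 _.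
  rewrite (negPf (dis _ j1)); case: (boolP (joined _ _ _)) => // j3 _; exact: J.
rewrite (negPf (dis _ j2)); case: (boolP (joined _ _ _)) => // j3 _.
by rewrite joined_sym; apply: J.
Qed.

(** The fundamental cut of [x] in [T] contains another edge of the cycle that [x] closes in [T']. *)
Lemma tree_exchange T T' x : tree T -> tree T' -> x \in T -> x \notin T' ->
  exists y, [/\ y \in T', y \notin T, tree (swap T x y) & tree (swap T' y x)].
Proof.
move=> tT tT' xT xT'; case/andP: (tT') => sp' /eqP cT'.
pose X := component (T :\ x) (tl x).
have [||y [yT' cr spy]] := @crosses_swap T' X x sp'.
- by rewrite inE joined0.
- by rewrite inE tree_cut.
have yT : y \notin T.
  apply/negP => yT; have := @component_closed (T :\ x) (tl x) y.
  by rewrite -/X cr !inE yT andbT; case: eqVneq yT' xT' => [->->|_ _ _ /(_ isT)].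
exists y; split=> //; first by rewrite tree_swap.
by rewrite /tree spy cardsU1 !inE (negPf xT') andbF -cT' (cardsD1 y T') yT' eqxx.
Qed.

End Trees.

(** * The layered tree family and the indegree family *)

Section Bases.
Variables (V S L : finType) (tl hd : S -> V) (ly : S -> L).
Implicit Types (B : {set S}) (x y : S) (l : L).

Definition layer B l := [set x in B | ly x == l].
Definition forest_base B := [forall l, tree tl hd (layer B l)].

Lemma layer_swap B x y l : x \in B -> y \notin B -> ly x = ly y ->
  layer (swap B x y) l = if l == ly x then swap (layer B l) x y else layer B l.
Proof.
move=> xB yB e; apply/setP=> z; rewrite !inE.
case: (eqVneq l) => [->|lx]; rewrite !inE.
  by have [->|zy] := eqVneq z y; rewrite /= ?e ?eqxx // andbA.
have [->|zy] := eqVneq z y; first by rewrite (negPf yB) -e [ly x == l]eq_sym (negPf lx) andbF.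
by have [->|zx] := eqVneq z x; rewrite //= [ly x == l]eq_sym (negPf lx) andbF.
Qed.

Lemma forest_base_exchange : sym_exchange (fun B => forest_base B).
Proof.
move=> B B' x /forallP b /forallP b' xB xB'.
have [||y []] := tree_exchange (b (ly x)) (b' (ly x)) (x := x).
- by rewrite inE xB eqxx.
- by rewrite inE (negPf xB').
rewrite !inE => /andP[yB' /eqP e]; rewrite e eqxx andbT => yB t t'.
exists y; split=> //; apply/forallP=> l; rewrite layer_swap //.
  by case: eqP => [->|_].
by rewrite e; case: eqP => [->|_].
Qed.

(** A swap between different layers would leave the layer of [x] with one edge too few; within a
    layer [tree_swap] decides. *)
Lemma forest_base_swap B x y : forest_base B -> x \in B -> y \notin B ->
  forest_base (swap B x y) = (ly x == ly y) &&
    crosses tl hd (component tl hd (layer B (ly x) :\ x) (tl x)) y.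
Proof.
move=> /forallP b xB yB.
have xl : x \in layer B (ly x) by rewrite inE xB eqxx.
have yl : y \notin layer B (ly x) by rewrite inE (negPf yB).
case: eqVneq => [e|ne] /=.
  rewrite -tree_swap //; apply/forallP/idP => [/(_ (ly x))|t l].
    by rewrite layer_swap // eqxx.
  by rewrite layer_swap //; case: eqP => [->|_].
apply/negbTE/negP => /forallP/(_ (ly x)) /andP[_ /eqP].
have /andP[_ /eqP <-] := b (ly x).
have -> : layer (swap B x y) (ly x) = layer B (ly x) :\ x.
  apply/setP=> z; rewrite !inE andbA; have [->|//] := eqVneq z y.
  by rewrite [ly y == _]eq_sym (negPf ne) (negPf yB) !andbF.
by rewrite [in RHS](cardsD1 x) xl => /eqP; rewrite -[X in X == _]add0n eqn_add2r.
Qed.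

Lemma forest_base_card B : forest_base B -> #|B| = (#|L| * #|V|.-1)%N.
Proof.
move=> /forallP b; rewrite -sum1_card (partition_big ly xpredT) //=.
rewrite -sum_nat_const; apply: eq_bigr => l _; have /andP[_ /eqP <-] := b l.
by rewrite -sum1_card; apply: eq_bigl => x; rewrite inE.
Qed.

Variables (r : V) (q : nat) (same : rel S).
Hypotheses (same_equiv : equivalence_rel same).
Hypothesis (same_hd : forall x y, same x y -> hd x = hd y).

Definition into B v := [set x in B | hd x == v].
(** Since [same_hd] puts each class at one head, this is a direct sum over the heads of truncated
    partition matroids. *)
Definition degree_base B :=
  [forall v, #|into B v| == (if v == r then 0 else q)%N] &&
  [forall x in B, forall y in B, same x y ==> (x == y)].

Let same_refl x : same x x.
Proof. by case: (same_equiv x x x). Qed.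
Let same_sym x y : same x y = same y x.
Proof.
by apply/idP/idP => h; [have [_ /(_ h)] := same_equiv x y x|have [_ /(_ h)] := same_equiv y x y];
   rewrite same_refl => <-.
Qed.
Let same_trans x y z : same x y -> same y z -> same x z.
Proof. by move=> h1 h2; case: (same_equiv x y z) => _ /(_ h1)->. Qed.

Lemma degree_baseP B : reflect
  ((forall v, #|into B v| = if v == r then 0 else q)%N /\
   forall x y, x \in B -> y \in B -> same x y -> x = y) (degree_base B).
Proof.
apply: (iffP andP) => -[h1 h2]; split.
- by move=> v; apply/eqP; apply: (forallP h1).
- move=> x y xB yB s; have /forall_inP/(_ y yB) := forall_inP h2 x xB.
  by rewrite s => /eqP.
- by apply/forallP => v; apply/eqP.
- by apply/forall_inP => x xB; apply/forall_inP => y yB; apply/implyP => s; apply/eqP; apply: h2.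
Qed.

Lemma degree_base_card B : degree_base B -> #|B| = (q * #|V|.-1)%N.
Proof.
case/degree_baseP=> h _; rewrite -sum1_card (partition_big hd xpredT) //= (bigD1 r) //=.
rewrite [X in (X + _)%N](_ : _ = 0%N); last first.
  transitivity #|into B r|; last by rewrite h eqxx.
  by rewrite -sum1_card; apply: eq_bigl => x; rewrite inE.
rewrite add0n (eq_bigr (fun=> q)) => [|v vr].
  by rewrite sum_nat_const mulnC; congr (_ * _)%N; rewrite -(cardC1 r); apply: eq_card.
transitivity #|into B v|; last by rewrite h (negPf vr).
by rewrite -sum1_card; apply: eq_bigl => x; rewrite inE.
Qed.

Lemma into_swap B x y v : x \in B -> y \notin B -> hd x = hd y ->
  #|into (swap B x y) v| = #|into B v|.
Proof.
move=> xB yB e; have [vx|vx] := eqVneq v (hd x); last first.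
  congr #|pred_of_set _|; apply/setP=> z; rewrite !inE.
  have [->|zy] := eqVneq z y; first by rewrite (negPf yB) -e [hd x == v]eq_sym (negPf vx) andbF.
  by have [->|zx] := eqVneq z x; rewrite //= [hd x == v]eq_sym (negPf vx) andbF.
have -> : into (swap B x y) v = y |: (into B v :\ x).
  apply/setP=> z; rewrite !inE; have [->|zy] := eqVneq z y; last by rewrite andbA.
  by rewrite -e vx eqxx.
rewrite cardsU1 !inE (negPf yB) andbF (cardsD1 x (into B v)) inE xB vx eqxx.
by [].
Qed.

Lemma degree_base_swap_free B x y : degree_base B -> x \in B -> y \notin B ->
  hd x = hd y -> (forall z, z \in B -> z != x -> ~~ same y z) ->
  degree_base (swap B x y).
Proof.
move=> /degree_baseP[h u] xB yB e free; apply/degree_baseP; split.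
  by move=> v; rewrite into_swap.
move=> a b; rewrite !in_swap => /orP[/eqP->|/andP[ax aB]] /orP[/eqP->|/andP[bx bB]] //.
- by rewrite (negPf (free _ bB bx)).
- by rewrite same_sym (negPf (free _ aB ax)).
- exact: u.
Qed.

(** A member of the class of [x] in [B'] is a partner. If there is none, any [y] of [B'] at the same
    head whose class misses [B] is one. If that also failed, the elements of [B'] at this head would
    inject into those of [B] other than [x], although both indegrees agree. *)
Lemma degree_base_exchange : sym_exchange (fun B => degree_base B).
Proof.
move=> B B' x b b' xB xB'.
have [h u] := degree_baseP _ b; have [h' u'] := degree_baseP _ b'.
have [/exists_inP[y yB' s]|/exists_inPn no] := boolP [exists y in B', same x y].
  have yB : y \notin B.
    by apply: contra xB' => yB; rewrite (u x y xB yB s).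
  exists y; split=> //; apply: degree_base_swap_free => //; try exact: same_hd.
  - move=> z zB zx; apply: contra zx => s'; apply/eqP; apply: u => //.
    by rewrite same_sym; apply: same_trans s s'.
  - by apply/esym/same_hd.
  - move=> z zB zx; apply: contra zx => s'; apply/eqP; apply: u' => //.
    by rewrite same_sym; apply: same_trans s'; rewrite same_sym.
have [/exists_inP[y yB' ny]|/exists_inPn all] :=
  boolP [exists y in into B' (hd x), [forall z in B, ~~ same y z]].
  move/forall_inP: ny => ny.
  move: yB'; rewrite inE => /andP[yB' /eqP hy].
  have yB : y \notin B by apply/negP => /ny; rewrite same_refl.
  exists y; split=> //; apply: degree_base_swap_free => // z zB _.
    exact: ny.
  exact: no.
pose f y := odflt y [pick z in B | same y z].
have fP y : y \in into B' (hd x) -> f y \in B /\ same y (f y).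
  move=> yB'; have := all y yB'; rewrite negb_forall_in => /exists_inP[z zB].
  rewrite negbK => s; rewrite /f; case: pickP => [t /andP[]//|/(_ z)].
  by rewrite zB s.
have inj : {in into B' (hd x) &, injective f}.
  move=> y1 y2 i1 i2 e; have [_ s1] := fP _ i1; have [_ s2] := fP _ i2.
  move: i1 i2; rewrite !inE => /andP[i1 _] /andP[i2 _]; apply: u' => //.
  by apply: same_trans s1 _; rewrite e same_sym.
have : f @: into B' (hd x) \subset into B (hd x) :\ x.
  apply/subsetP=> _ /imsetP[y yB' ->]; have [fB s] := fP _ yB'.
  move: (yB'); rewrite !inE fB /= => /andP[yB'' /eqP <-].
  rewrite -(same_hd s) eqxx andbT; apply: contraL s => /eqP->.
  by rewrite same_sym no.
move/subset_leq_card; rewrite card_in_imset // h' -h (cardsD1 x (into B _)).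
by rewrite inE xB eqxx ltnn.
Qed.

Lemma degree_base_swap B x y : degree_base B -> x \in B -> y \notin B ->
  degree_base (swap B x y) =
    same y x || (hd y == hd x) && [forall z in B, ~~ same y z].
Proof.
move=> b xB yB; have [h u] := degree_baseP _ b; apply/idP/idP.
  case/degree_baseP=> h' u'; have [//|ns /=] := boolP (same y x).
  have e : hd y = hd x.
    have le : (#|into B (hd x)| <= #|into (swap B x y) (hd x)|)%N by rewrite h h'.
    apply: contraTeq le => ne; rewrite -ltnNge.
    apply: proper_card; apply/properP; split.
      apply/subsetP=> z; rewrite !inE => /andP[/orP[/eqP->|/andP[_ ->//]]].
      by rewrite (negPf ne).
    exists x; rewrite !inE ?xB ?eqxx //= orbF andbT.
    by apply: contraNneq yB => <-.
  rewrite e eqxx; apply/forall_inP => z zB; apply: contra ns => s.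
  have [<-//|zx] := eqVneq z x; have ey : y = z.
    by apply: u' s; rewrite in_swap ?eqxx // zx zB orbT.
  by rewrite ey zB in yB.
case/orP=> [s|/andP[/eqP e /forall_inP free]].
  apply: degree_base_swap_free => //; first by apply/esym/same_hd.
  move=> z zB zx; apply: contra zx => s'; apply/eqP; apply: u => //.
  by apply: same_trans s; rewrite same_sym.
by apply: degree_base_swap_free => // z zB _; apply: free.
Qed.

End Bases.

(** * Edmonds' disjoint arborescences *)

Section Arborescences.
Local Open Scope nat_scope.
Variables (V S : finType) (tl hd : S -> V) (r : V).
Implicit Types (D T : {set S}) (U X Y : {set V}).

Definition enters X x := (tl x \notin X) && (hd x \in X).
Definition indeg D X := #|[set x in D | enters X x]|.
Definition rooted_connected k D := forall X, r \notin X -> X != set0 -> k <= indeg D X.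

Lemma indegE D X : indeg D X = \sum_(x in D) enters X x.
Proof.
rewrite /indeg -sum1_card big_mkcond [RHS]big_mkcond; apply: eq_bigr => x _.
by rewrite inE; case: (x \in D); case: enters.
Qed.

Lemma indeg_submod D X Y :
  indeg D (X :&: Y) + indeg D (X :|: Y) <= indeg D X + indeg D Y.
Proof.
rewrite !indegE -!big_split; apply: leq_sum => x _; rewrite /enters !inE /=.
by case: (tl x \in X); case: (tl x \in Y); case: (hd x \in X); case: (hd x \in Y).
Qed.

Lemma indeg_setU1 D T X x : x \in D -> x \notin T ->
  indeg (D :\: T) X = enters X x + indeg (D :\: (x |: T)) X.
Proof.
move=> xD xT; rewrite !indegE (big_setD1 x) ?inE ?xD ?xT //=; congr addn.
by apply: eq_bigl => y; rewrite !inE negb_or andbA.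
Qed.

(** The invariant of Lovász's proof of Edmonds' theorem: a partial arborescence on [U] whose removal
    is still affordable. *)
Record branching k D U T : Prop := Branching {
  branching_root : r \in U;
  branching_sub : T \subset D;
  branching_in : forall x, x \in T -> (tl x \in U) && (hd x \in U);
  branching_joined : forall v, v \in U -> joined tl hd T r v;
  branching_into : forall v, #|into hd T v| = (v \in U) && (v != r);
  branching_rest : rooted_connected k (D :\: T) }.

(** Choose [X] minimal among the tight sets not inside [U]. An arc from the part of [X] in [U] to
    the part outside can be added: if it entered a tight set [Y], then by submodularity [X :&: Y]
    would be a smaller choice, as the tail lies in [X] but not in [Y]. *)
Lemma branching_extend k D U T : rooted_connected k.+1 D -> branching k D U T ->
  U != setT -> exists x, hd x \notin U /\ branching k D (hd x |: U) (x |: T).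
Proof.
move=> cD [rU sT inT jT dT rest] UT.
pose tightset X := (r \notin X) && (indeg (D :\: T) X == k).
pose cand (X : {set V}) := ~~ (X \subset U) && ((X == setT) || tightset X).
have candT : cand setT by rewrite /cand subTset UT eqxx.
have [X minX _] := @minset_exists _ cand setT candT.
case/minsetP: minX => /andP[nXU hX] mX.
have r_notin : r \notin X :\: U by rewrite inE rU.
have X0 : X :\: U != set0 by rewrite setD_eq0.
have dXU : indeg (D :\: T) (X :\: U) = indeg D (X :\: U).
  rewrite /indeg; apply: eq_card => x; rewrite !inE; case: (boolP (x \in T)) => //= xT.
  by have /andP[_ h] := inT x xT; rewrite /enters !inE h andbF andbF.
have gt : indeg (D :\: T) (X :\: U) > (if X == setT then 0 else k).
  rewrite dXU; apply: leq_trans (cD _ r_notin X0).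
  by case: ifP.
(* More arcs enter [X :\: U] than [X], so one of them starts in [X], and thus in [U]. *)
have [x xDT /andP[xe xn]] : exists2 x, x \in D :\: T & enters (X :\: U) x && ~~ enters X x.
  apply/exists_inP; apply: contraLR gt => /exists_inPn h; rewrite -leqNgt.
  case: ifP hX => [/eqP eXT _|_ /= /andP[_ /eqP <-]].
    rewrite leqn0 cards_eq0; apply/eqP/setP => x; rewrite inE [RHS]inE.
    apply/negbTE/negP => /andP[x1 x2]; have := h x x1.
    by rewrite x2 {1}/enters eXT inE.
  apply: subset_leq_card; apply/subsetP=> x; rewrite [in X in X -> _]inE => /andP[x1 x2].
  by rewrite inE x1; have := h x x1; rewrite x2 negbK.
move: xe xn; rewrite /enters !inE negb_and negbK => /andP[h1 /andP[hU hX']].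
rewrite hX' andbT negbK => tX; rewrite tX orbF in h1.
move: xDT; rewrite inE => /andP[xT xD].
have hr : hd x != r by apply: contraNneq hU => ->.
exists x; split=> //; split.
- by rewrite inE rU orbT.
- by rewrite subUset sub1set xD.
- move=> y; rewrite !inE => /orP[/eqP->|/inT/andP[-> ->]]; last by rewrite !orbT.
  by rewrite h1 eqxx orbT.
- have sub : T \subset x |: T by apply: subsetUr.
  move=> v; rewrite inE => /orP[|/jT]; last exact: joinedS.
  rewrite inE => /eqP->; apply: joined_trans (joinedS sub (jT _ h1)) _.
  by apply: joined1; rewrite !inE eqxx.
- move=> v; have -> : into hd (x |: T) v = if hd x == v then x |: into hd T v else into hd T v.
    apply/setP=> y; case: ifP => e; rewrite !inE; have [->|//] := eqVneq y x;
    by rewrite e //= (negPf xT).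
  case: eqVneq => [<-|ne].
    by rewrite cardsU1 dT !inE (negPf xT) (negPf hU) eqxx hr.
  by rewrite dT !inE [v == hd x]eq_sym (negPf ne).
- move=> Y rY Y0; have := rest Y rY Y0; rewrite (@indeg_setU1 D T Y x) //.
  case: (boolP (enters Y x)) => // /andP[tY hY] /=; rewrite add1n leq_eqVlt.
  case/orP=> // /eqP eY; exfalso.
  have tightY : tightset Y by rewrite /tightset rY (@indeg_setU1 D T Y x) // /enters tY hY /= add1n -eY.
  suff cXY : cand (X :&: Y).
    have := mX _ cXY (subsetIl _ _) => e; move: tX; rewrite -e inE.
    by rewrite (negPf tY) andbF.
  rewrite /cand; apply/andP; split.
    by apply/subsetPn; exists (hd x); rewrite // inE hX' hY.
  apply/orP; right; case/orP: hX => [/eqP->|/andP[rX /eqP eX]]; first by rewrite setTI.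
  rewrite /tightset inE (negPf rX) /= eqn_leq; apply/andP; split; last first.
    apply: rest; first by rewrite inE (negPf rX).
    by apply/set0Pn; exists (hd x); rewrite inE hX' hY.
  have := indeg_submod (D :\: T) X Y; have := rest (X :|: Y).
  rewrite inE negb_or rX rY => /(_ isT); have -> : X :|: Y != set0.
    by apply/set0Pn; exists (hd x); rewrite inE hX'.
  move=> /(_ isT); case/andP: tightY => _ /eqP eY'; rewrite eX eY'; clear; lia.
Qed.

Definition arborescence T := spans tl hd T /\ forall v, #|into hd T v| = (v != r) :> nat.

Lemma arborescence_exists k D : rooted_connected k.+1 D ->
  exists T, [/\ T \subset D, arborescence T & rooted_connected k (D :\: T)].
Proof.
move=> cD.
suff [T b] : exists T, branching k D setT T.
  case: b => _ sT _ jT dT rest; exists T; split=> //; split.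
    apply/spansP => a b; apply: joined_trans (jT b (in_setT _)).
    by rewrite joined_sym; apply: jT.
  by move=> v; rewrite dT inE.
have b0 : branching k D [set r] set0.
  split.
  - by rewrite inE.
  - exact: sub0set.
  - by move=> x; rewrite in_set0.
  - by move=> v; rewrite inE => /eqP->; apply: joined0.
  - move=> v; rewrite inE andbN; apply/eqP; rewrite cards_eq0; apply/eqP/setP => x.
    by rewrite !inE.
  - by move=> X rX X0; rewrite setD0; apply: leq_trans (cD X rX X0).
have [c] := ubnP #|~: [set r]|; move: [set r] set0 b0; elim: c => // c IH U T b lec.
have [e|nU] := eqVneq U setT; first by exists T; rewrite -e.
have [x [xU b']] := branching_extend cD b nU.
rewrite ltnS in lec; apply: (IH _ _ b'); apply: leq_trans lec; apply: proper_card.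
rewrite properC setUC; apply/properP; split; first exact: subsetUl.
by exists (hd x); rewrite ?inE ?eqxx ?orbT.
Qed.

Theorem disjoint_arborescences k D : rooted_connected k D ->
  exists T : 'I_k -> {set S}, (forall i, T i \subset D /\ arborescence (T i)) /\
    forall i j x, x \in T i -> x \in T j -> i = j.
Proof.
elim: k D => [|k IH] D cD.
  by exists (fun=> set0); split=> [[]|[]].
have [T0 [sT0 aT0 /IH[T [hT dT]]]] := arborescence_exists cD.
exists (fun i => if unlift ord0 i is Some j then T j else T0); split=> [i|i j x].
  case: unliftP => [j _|_] //; have [sT aT] := hT j; split=> //.
  exact: subset_trans sT (subsetDl _ _).
have nT l : x \in T l -> x \notin T0.
  by have [sT _] := hT l => /(subsetP sT); rewrite inE => /andP[].
case: unliftP => [i' ->|->]; case: unliftP => [j' ->|->] // h1 h2.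
- by congr lift; apply: dT h1 h2.
- by have := nT _ h1; rewrite h2.
- by have := nT _ h2; rewrite h1.
Qed.

Lemma arborescence_tree T : arborescence T -> tree tl hd T.
Proof.
case=> sp dT; rewrite /tree sp -sum1_card (partition_big hd xpredT) //= (bigD1 r) //=.
have e v : \sum_(x in T | hd x == v) 1 = (v != r).
  by rewrite -dT -sum1_card; apply: eq_bigl => x; rewrite inE.
rewrite e eqxx add0n (eq_bigr (fun=> 1)) => [|v vr]; last by rewrite e vr.
by rewrite sum1_card -(cardC1 r); apply/eqP/eq_card.
Qed.

End Arborescences.

(** * Reduction of (1,k)-FGC *)

Section Elements.
Local Open Scope nat_scope.
Variables (q m : nat).
Hypothesis q_gt0 : 0 < q.

(** Mixed-radix code of edge, layer and kind; kind 0 is forward, 1 reversed and 2 the spare forward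
    copy. *)
Definition ecode (e l d : nat) := 3 * q * e + (3 * l + d).
Definition edge_of x := x %/ (3 * q).
Definition layer_of x := x %% (3 * q) %/ 3.
Definition kind_of x := x %% 3.

Let q3 : 0 < 3 * q. Proof. by rewrite muln_gt0. Qed.

Lemma ecode_rem l d : l < q -> d < 3 -> 3 * l + d < 3 * q.
Proof. by clear; lia. Qed.

Lemma edge_ecode e l d : l < q -> d < 3 -> edge_of (ecode e l d) = e.
Proof.
move=> lq d3; rewrite /edge_of /ecode mulnC divnMDl // divn_small ?addn0 //.
exact: ecode_rem.
Qed.

Lemma layer_ecode e l d : l < q -> d < 3 -> layer_of (ecode e l d) = l.
Proof.
move=> lq d3; rewrite /layer_of /ecode mulnC modnMDl modn_small ?ecode_rem //.
by rewrite mulnC divnMDl // divn_small // addn0.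
Qed.

Lemma kind_ecode e l d : d < 3 -> kind_of (ecode e l d) = d.
Proof.
move=> d3; rewrite /kind_of /ecode -mulnA mulnC modnMDl mulnC modnMDl.
exact: modn_small.
Qed.

Lemma ecodeK x : ecode (edge_of x) (layer_of x) (kind_of x) = x.
Proof.
rewrite /ecode /edge_of /layer_of /kind_of [RHS](divn_eq x (3 * q)) mulnC; congr addn.
rewrite [RHS](divn_eq _ 3) mulnC; congr addn.
by rewrite modn_dvdm // dvdn_mulr.
Qed.

Lemma layer_of_lt x : layer_of x < q.
Proof. by rewrite ltn_divLR // [q * 3]mulnC ltn_mod. Qed.

Lemma kind_of_lt x : kind_of x < 3.
Proof. by rewrite ltn_mod. Qed.

Lemma edge_of_lt x : x < 3 * q * m -> edge_of x < m.
Proof. by move=> lt; rewrite ltn_divLR // [m * _]mulnC. Qed.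

Lemma ecode_lt e l d : e < m -> l < q -> d < 3 -> ecode e l d < 3 * q * m.
Proof.
move=> em lq d3; apply: leq_trans (_ : 3 * q * e.+1 <= _); last by rewrite leq_mul.
by rewrite /ecode mulnS addnC ltn_add2r ecode_rem.
Qed.

End Elements.

Section Reduction.
Variables (R : realType) (n m k : nat) (I : fgc_instance R n.+1 m).
Definition elt := 'I_(3 * k.+1 * m).
Implicit Types (x y : elt) (F : {set 'I_m}) (B T : {set elt}) (X : {set 'I_n.+1}).

Definition edge x : 'I_m := Ordinal (@edge_of_lt k.+1 m isT x (ltn_ord x)).
Definition lay x : 'I_k.+1 := Ordinal (@layer_of_lt k.+1 isT x).
Definition elt_rev x := kind_of x == 1%N.
Definition spare x := kind_of x == 2%N.
Definition elt_head x := if elt_rev x then src I (edge x) else dst I (edge x).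
Definition elt_tail x := if elt_rev x then dst I (edge x) else src I (edge x).
Definition price x : R := cost I (edge x).

Lemma bool_lt3 (d : bool) : (d < 3)%N.
Proof. by case: d. Qed.

Definition elt_of (e : 'I_m) (l : 'I_k.+1) (d : bool) : elt :=
  Ordinal (@ecode_lt k.+1 m e l d (ltn_ord e) (ltn_ord l) (bool_lt3 d)).

Lemma edge_elt e l d : edge (elt_of e l d) = e.
Proof. by apply: val_inj; rewrite /= edge_ecode ?bool_lt3. Qed.

Lemma lay_elt e l d : lay (elt_of e l d) = l.
Proof. by apply: val_inj; rewrite /= layer_ecode ?bool_lt3. Qed.

Lemma rev_elt e l d : elt_rev (elt_of e l d) = d.
Proof. by rewrite /elt_rev /= kind_ecode ?bool_lt3 //; case: d. Qed.

Lemma spare_elt e l d : spare (elt_of e l d) = false.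
Proof. by rewrite /spare /= kind_ecode ?bool_lt3 //; case: d. Qed.

Lemma eltK x : ~~ spare x -> elt_of (edge x) (lay x) (elt_rev x) = x.
Proof.
move=> sx; apply: val_inj; rewrite /= -[RHS](@ecodeK k.+1 x); congr ecode.
move: sx (kind_of_lt x); rewrite /spare /elt_rev.
by case: (kind_of x) => [|[|[|]]].
Qed.

(** Elements of a safe edge form singleton classes, so such an edge may serve in every layer. *)
Definition same_class : rel elt := fun x y =>
  (x == y) || [&& edge x \notin safe I, edge x == edge y & elt_rev x == elt_rev y].

Lemma same_equiv : equivalence_rel same_class.
Proof.
move=> x y z; rewrite /same_class eqxx; split=> // /orP[/eqP->//|/and3P[ns /eqP e1 /eqP e2]].
rewrite e1 e2 in ns *; rewrite ns /=.
case: (boolP ((edge y == edge z) && (elt_rev y == elt_rev z))); rewrite ?orbT ?orbF // => h.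
transitivity false; last symmetry; apply/negbTE; apply: contra h => /eqP <-; rewrite ?e1 ?e2 !eqxx //.
Qed.

Lemma same_head x y : same_class x y -> elt_head x = elt_head y.
Proof. by rewrite /elt_head => /orP[/eqP->//|/and3P[_ /eqP-> /eqP->]]. Qed.

Definition base1 B := forest_base elt_tail elt_head lay B.
Definition base2 B := degree_base elt_head ord0 k.+1 same_class B.

Lemma bases_card B B' : base1 B -> base2 B' -> #|B| = #|B'|.
Proof.
by move=> b1 b2; rewrite (forest_base_card b1) (degree_base_card b2) !card_ord.
Qed.

(** The digraph to which Edmonds' theorem is applied. The layer is a mere copy number here: each
    direction of a safe edge has [k.+1] copies, of an unsafe edge one. *)
Definition avail F := [set x : elt |
  [&& ~~ spare x, edge x \in F & (edge x \in safe I) || (lay x == ord0)]].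

(** If a safe edge of [F] crosses [X], its [k.+1] copies suffice. Otherwise all crossing edges are
    unsafe, and [k] or fewer could be deleted, cutting [X] off from the root. *)
Lemma avail_connected F : fgc_feasible I 1 k F ->
  rooted_connected elt_tail elt_head ord0 k.+1 (avail F).
Proof.
move=> feas X rX /set0Pn[v vX].
pose cross e := (src I e \in X) != (dst I e \in X).
(* A crossing edge is reversed exactly when its source end is in [X], so that this copy enters
   [X]. *)
pose el e l := elt_of e l (src I e \in X).
have elin e l : e \in F -> cross e -> (e \in safe I) || (l == ord0) ->
    el e l \in [set x in avail F | enters elt_tail elt_head X x].
  rewrite /cross => eF cr sl; rewrite !inE spare_elt edge_elt lay_elt eF sl /=.
  rewrite /enters /elt_head /elt_tail rev_elt edge_elt.
  by move: cr; case e1: (src I e \in X) => /=; case e2: (dst I e \in X) => //=; rewrite ?e1.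
have [/exists_inP[e eF /andP[sf cr]]|/exists_inPn nsf] :=
  boolP [exists e in F, (e \in safe I) && cross e].
  rewrite -[X in (X <= _)%N]card_ord -(card_imset _ (_ : injective (el e))); last first.
    by move=> l l' /(congr1 lay); rewrite !lay_elt.
  apply: subset_leq_card; apply/subsetP=> _ /imsetP[l _ ->].
  by apply: elin; rewrite ?sf.
pose F' := [set e in F | cross e].
have [le|gt] := leqP #|F'| k.
  have := feas F' _ le set0; rewrite cards0 setD0 => /(_ _ isT ord0 v) h.
  have {h} j : connect (adj I (F :\: F')) ord0 v.
    apply: h; apply/subsetP=> e; rewrite !inE => /andP[eF cr].
    by have := nsf e eF; rewrite cr andbT.
  have [||e] := @joined_crosses _ _ (src I) (dst I) (F :\: F') (~: X) ord0 v j.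
  - by rewrite inE.
  - by rewrite inE negbK.
  rewrite !inE /crosses !inE => /andP[ne eF]; rewrite eF /= in ne.
  by move: ne; rewrite /cross; case: (src I e \in X); case: (dst I e \in X).
apply: leq_trans gt _; rewrite -(card_in_imset (_ : {in F' &, injective (el^~ ord0)})).
  apply: subset_leq_card; apply/subsetP=> _ /imsetP[e eF' ->].
  have /andP[eF cr] : (e \in F) && cross e by rewrite inE in eF'.
  by apply: elin; rewrite ?eqxx ?orbT.
by move=> e e' _ _ /(congr1 edge); rewrite !edge_elt.
Qed.

Lemma arborescence_head T x y : arborescence elt_tail elt_head ord0 T -> x \in T -> y \in T ->
  elt_head x = elt_head y -> x = y.
Proof.
case=> _ dT xT yT e; have /card_le1_eqP : (#|into elt_head T (elt_head x)| <= 1)%N.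
  by rewrite dT leq_b1.
by apply; rewrite inE ?xT ?yT ?e eqxx.
Qed.

(** Copies with the same direction share a head, where the indegree is at most one; copies with
    opposite directions would close a cycle. *)
Lemma arborescence_edge T : arborescence elt_tail elt_head ord0 T -> {in T &, injective edge}.
Proof.
move=> aT x y xT yT e; have [er|er] := eqVneq (elt_rev x) (elt_rev y).
  by apply: (arborescence_head aT) => //; rewrite /elt_head er e.
have xy : x != y by apply: contraNneq er => ->.
have := tree_cut (arborescence_tree aT) xT; rewrite joined_sym.
suff -> : joined elt_tail elt_head (T :\ x) (elt_head x) (elt_tail x) by [].
have -> : elt_head x = elt_tail y by rewrite /elt_head /elt_tail e; case: (elt_rev x) er; case: (elt_rev y).
have -> : elt_tail x = elt_head y by rewrite /elt_head /elt_tail e; case: (elt_rev x) er; case: (elt_rev y).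
by apply: joined1; rewrite !inE eq_sym xy.
Qed.

(** The map [g] moves the arborescence with index [l] into layer [l], forgetting the copy numbers of
    [avail]. Two elements of one unsafe class come from the same available element, so disjointness
    forces equal layers. *)
Lemma common_base_exists F : fgc_feasible I 1 k F ->
  exists B, [/\ base1 B, base2 B & weight price B <= k.+1%:R * total_cost I F].
Proof.
move=> /avail_connected/disjoint_arborescences[T [hT dT]].
pose g l x := elt_of (edge x) l (elt_rev x).
have gh l x : elt_head (g l x) = elt_head x by rewrite /elt_head /g edge_elt rev_elt.
have gt l x : elt_tail (g l x) = elt_tail x by rewrite /elt_tail /g edge_elt rev_elt.
pose B := [set y : elt | y \in g (lay y) @: T (lay y)].
have layB l : layer lay B l = g l @: T l.
  apply/setP=> y; rewrite !inE; apply/andP/idP => [[h /eqP <-]//|h].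
  have e : lay y = l by case/imsetP: h => x _ ->; rewrite lay_elt.
  by rewrite e eqxx.
have ginj l : {in T l &, injective (g l)}.
  move=> x y xT yT e; have [_ aT] := hT l; apply: (arborescence_edge aT) => //.
  by have := congr1 edge e; rewrite !edge_elt.
have sumB (f : elt -> nat) : (\sum_(x in B) f x = \sum_l \sum_(x in T l) f (g l x))%N.
  rewrite (partition_big lay xpredT) //=; apply: eq_bigr => l _.
  rewrite -(big_imset f (ginj l)) -layB; apply: eq_bigl => x.
  by rewrite [RHS]inE.
exists B; split.
- apply/forallP=> l; rewrite layB; have [_ aT] := hT l.
  have /andP[/spansP sp /eqP cT] := arborescence_tree aT.
  rewrite /tree card_in_imset ?cT ?eqxx ?andbT; last exact: ginj.
  apply/spansP=> a b; apply: joined_map (sp a b) => x xT.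
  by rewrite -(gt l) -(gh l); apply: joined1; apply: imset_f.
- apply/degree_baseP; split.
    move=> v; have -> : #|into elt_head B v| = (\sum_(x in B) (elt_head x == v))%N.
      rewrite -sum1_card big_mkcond [RHS]big_mkcond; apply: eq_bigr => x _.
      by rewrite inE; case: (x \in B); case: eqP.
    rewrite sumB (eq_bigr (fun=> (v != ord0 : nat))) => [|l _].
      by rewrite sum_nat_const card_ord; case: eqP; rewrite ?muln0 ?muln1.
    have [_ [_ <-]] := hT l; rewrite -sum1_card big_mkcond [RHS]big_mkcond.
    by apply: eq_bigr => x _; rewrite inE gh; case: (x \in T l); case: eqP.
  move=> y y'; rewrite !inE => /imsetP[x xT ey] /imsetP[x' xT' ey'].
  case/orP=> [/eqP//|/and3P[us /eqP e1 /eqP e2]].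
  have ee : edge x = edge x' by move: e1; rewrite ey ey' !edge_elt.
  have er : elt_rev x = elt_rev x' by move: e2; rewrite ey ey' !rev_elt.
  have us' : edge x \notin safe I by move: us; rewrite ey edge_elt.
  have exx : x = x'.
    have [/subsetP s1 _] := hT (lay y); have [/subsetP s2 _] := hT (lay y').
    have := s1 _ xT; have := s2 _ xT'; rewrite !inE -ee (negPf us') /=.
    move=> /and3P[sp' _ /eqP l'] /and3P[sp _ /eqP l].
    by rewrite -(eltK sp) -(eltK sp') ee er l l'.
  rewrite ey ey' /g -exx; congr elt_of; apply: dT xT _; by rewrite exx.
- rewrite /weight (partition_big lay xpredT) //=.
  have -> : k.+1%:R * total_cost I F = \sum_(l : 'I_k.+1) total_cost I F.
    by rewrite sumr_const card_ord mulr_natl.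
  apply: ler_sum => l _; have [sT aT] := hT l.
  have -> : \sum_(x in B | lay x == l) price x = \sum_(x in g l @: T l) price x.
    by rewrite -layB; apply: eq_bigl => x; rewrite [RHS]inE.
  rewrite big_imset /=; last exact: ginj.
  rewrite (eq_bigr (fun x => cost I (edge x))); last by move=> x _; rewrite /price edge_elt.
  rewrite -(big_imset _ (arborescence_edge aT)) /=.
  rewrite /total_cost [X in _ <= X](big_setID (edge @: T l)) /=.
  rewrite (setIidPr _) ?lerDl ?sumr_ge0 //; first by move=> e _; apply: cost_ge0.
  by apply/subsetP=> _ /imsetP[x /(subsetP sT) xT ->]; move: xT; rewrite inE => /and3P[].
Qed.

Lemma common_base_indeg B X : base1 B -> base2 B -> ord0 \notin X -> X != set0 ->
  (k < indeg elt_tail elt_head B X)%N.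
Proof.
move=> /forallP b1 /degree_baseP[b2 _] rX X0.
have X1 : (0 < #|X|)%N by rewrite card_gt0.
have hX : (\sum_(x in B) (elt_head x \in X) = k.+1 * #|X|)%N.
  transitivity (\sum_(v in X) #|into elt_head B v|)%N.
    rewrite (eq_bigr (fun x => \sum_(v in X) (elt_head x == v))%N) => [|x _]; last first.
      rewrite -big_mkcondr sum1_card.
      case: (boolP (elt_head x \in X)) => h; last first.
        apply/esym/eq_card0 => v; rewrite !inE; apply/negbTE; apply: contra h.
        by case/andP=> vX /eqP->.
      transitivity #|pred1 (elt_head x)|; first by rewrite card1.
      apply: eq_card => v; rewrite !inE eq_sym.
      by rewrite unfold_in /=; case: eqVneq => [<-|]; rewrite ?h ?andbF.
    rewrite exchange_big; apply: eq_bigr => v _; rewrite -sum1_card big_mkcond.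
    by rewrite [RHS]big_mkcond; apply: eq_bigr => x _; rewrite inE; case: (x \in B); case: eqP.
  rewrite (eq_bigr (fun=> k.+1)) ?sum_nat_const 1?mulnC // => v vX.
  by rewrite b2; case: eqP vX rX => // -> ->.
have ins : (\sum_(x in B) ((elt_tail x \in X) && (elt_head x \in X)) <= k.+1 * #|X|.-1)%N.
  have <- : (\sum_(l < k.+1) #|X|.-1 = k.+1 * #|X|.-1)%N by rewrite sum_nat_const card_ord.
  rewrite (partition_big lay xpredT) //=.
  apply: leq_sum => l _; have := tree_inside (b1 l) X0.
  move=> lt; rewrite -ltnS (ltn_predK X1); move: lt; congr (is_true (_ < _)%N).
  rewrite -sum1_card big_mkcond [RHS]big_mkcond; apply: eq_bigr => x _.
  by rewrite !inE; case: (x \in B); case: (lay x == l) => //=; case: (_ \in _); case: (_ \in _).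
have : (indeg elt_tail elt_head B X + \sum_(x in B) ((elt_tail x \in X) && (elt_head x \in X))
        = k.+1 * #|X|)%N.
  rewrite -hX indegE -big_split; apply: eq_bigr => x _; rewrite /enters.
  by case: (elt_tail x \in X); case: (elt_head x \in X).
have -> : (k.+1 * #|X| = k.+1 + k.+1 * #|X|.-1)%N by rewrite -mulnS (ltn_predK X1).
by move: ins (indeg _ _ _ _); move: (\sum_(_ in _) _)%N (k.+1 * _)%N; clear; lia.
Qed.

(** Let [C] be what the root still reaches. Arcs of [B] entering its complement all lie over [F'].
    Two of them over one edge have the same direction and, the edge being unsafe, the same class, so
    they coincide. Thus [k.+1] entering arcs need more than [k] deleted edges. *)
Lemma common_base_feasible B : base1 B -> base2 B -> fgc_feasible I 1 k (edge @: B).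
Proof.
move=> b1 b2 F' uF' leF' D; rewrite ltnS leqn0 cards_eq0 => /eqP->; rewrite setD0.
set A := _ :\: _.
have all v : joined (src I) (dst I) A ord0 v.
  apply: contraT => nj; pose C := component (src I) (dst I) A ord0.
  have := @common_base_indeg B (~: C) b1 b2; rewrite ltnNge.
  rewrite !inE joined0 => /(_ isT); have -> : ~: C != set0.
    by apply/set0Pn; exists v; rewrite !inE.
  move=> /(_ isT) /negP[]; apply: leq_trans leF'.
  have inF' x : x \in B -> enters elt_tail elt_head (~: C) x -> edge x \in F'.
    move=> xB en; apply: contraT => nF'.
    have eA : edge x \in A by rewrite !inE nF' imset_f.
    have := component_closed (src I) (dst I) ord0 eA; rewrite -/C /crosses.
    move: en; rewrite /enters /elt_tail /elt_head !(in_setC) negbK.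
    case: (elt_rev x); by case: (src I _ \in C); case: (dst I _ \in C).
  rewrite /indeg -(card_in_imset (f := edge)).
    apply: subset_leq_card; apply/subsetP=> _ /imsetP[x xP ->].
    by move: xP; rewrite inE => /andP[]; apply: inF'.
  move=> x y; rewrite inE => /andP[xB ex]; rewrite inE => /andP[yB ey] e.
  have [_ u] := degree_baseP _ _ _ _ _ b2; apply: u => //.
  have us : edge x \notin safe I.
    by have := subsetP uF' _ (inF' _ xB ex); rewrite inE.
  rewrite /same_class us e eqxx /=; apply/orP; right.
  move: ex ey; rewrite /enters /elt_tail /elt_head e.
  by case: (elt_rev x); case: (elt_rev y) => //; case: (src I _ \in _); case: (dst I _ \in _).
by move=> a b; apply: joined_trans (all b); rewrite joined_sym.
Qed.

Lemma edge_cost B : total_cost I (edge @: B) <= weight price B.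
Proof.
rewrite /weight (partition_big_imset edge) /=; apply: ler_sum => _ /imsetP[x xB ->].
rewrite (bigD1 x) /= ?xB ?eqxx // {1}/price lerDl sumr_ge0 // => y _; exact: cost_ge0.
Qed.

End Reduction.

(** * Loop programs *)

(* [SFor a c0 c1 c2 p] runs [p] with cell 0 of array [a] counting up to
   [c0 + c1 * n + c2 * m]. *)
Inductive stm :=
  | SSkip
  | SN of nat & nexp & nexp
  | SR of nat & nexp & rexp
  | SSeq of stm & stm
  | SIf of bexp & stm & stm
  | SFor of nat & nat & nat & nat & stm.

Definition nmul (c : nat) (e : nexp) : nexp := iter c (NAdd e) (NConst 0).

Definition bound_exp c0 c1 c2 : nexp :=
  NAdd (NConst c0) (NAdd (nmul c1 (NGet 0 (NConst 0))) (nmul c2 (NGet 0 (NConst 1)))).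

Definition cell a := NGet a (NConst 0).

Fixpoint compile (p : stm) : cmd :=
  match p with
  | SSkip => Skip
  | SN a i e => NSet a i e
  | SR a i e => RSet a i e
  | SSeq p1 p2 => Seq (compile p1) (compile p2)
  | SIf b p1 p2 => If b (compile p1) (compile p2)
  | SFor a c0 c1 c2 p =>
      Seq (NSet a (NConst 0) (NConst 0))
        (While (BNot (NLe (bound_exp c0 c1 c2) (cell a)))
           (Seq (compile p) (NSet a (NConst 0) (NAdd (cell a) (NConst 1)))))
  end.

(** A syntactic test that integer array [b] is never written, so that frame conditions are settled
    by computation. *)
Fixpoint nkeep (b : nat) (p : stm) : bool :=
  match p with
  | SSkip | SR _ _ _ => true
  | SN a _ _ => b != a
  | SSeq p1 p2 | SIf _ p1 p2 => nkeep b p1 && nkeep b p2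
  | SFor a _ _ _ p => (b != a) && nkeep b p
  end.

Fixpoint rkeep (b : nat) (p : stm) : bool :=
  match p with
  | SSkip | SN _ _ _ => true
  | SR a _ _ => b != a
  | SSeq p1 p2 | SIf _ p1 p2 => rkeep b p1 && rkeep b p2
  | SFor _ _ _ _ p => rkeep b p
  end.

(** A loop body may touch neither its counter nor array 0, which holds [n] and [m]; hence the bound
    tested by the [While] is constant. *)
Fixpoint wf (p : stm) : bool :=
  match p with
  | SSeq p1 p2 | SIf _ p1 p2 => wf p1 && wf p2
  | SFor a _ _ _ p => [&& a != 0%N, nkeep a p, nkeep 0 p & wf p]
  | _ => true
  end.

Section Denotation.
Variable R : realType.
Implicit Types (s : store R) (p : stm).

Definition setn s a i v := Store (upd (narr s) a i v) (rarr s).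
Definition setr s a i (v : R) := Store (narr s) (upd (rarr s) a i v).

Definition loop_bound s c0 c1 c2 := (c0 + (c1 * narr s 0 0 + c2 * narr s 0 1))%N.

Fixpoint den p s : store R :=
  match p with
  | SSkip => s
  | SN a i e => setn s a (neval s i) (neval s e)
  | SR a i e => setr s a (neval s i) (reval s e)
  | SSeq p1 p2 => den p2 (den p1 s)
  | SIf b p1 p2 => if beval s b then den p1 s else den p2 s
  | SFor a c0 c1 c2 p =>
      iteri (loop_bound s c0 c1 c2)
        (fun i s' => setn (den p s') a 0 i.+1) (setn s a 0 0)
  end.

Lemma neval_nmul s c e : neval s (nmul c e) = (c * neval s e)%N.
Proof. by elim: c => //= c ->; rewrite mulSn. Qed.

Lemma neval_bound s c0 c1 c2 : neval s (bound_exp c0 c1 c2) = loop_bound s c0 c1 c2.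
Proof. by rewrite /= !neval_nmul. Qed.

Lemma beval_loop s a c0 c1 c2 :
  beval s (BNot (NLe (bound_exp c0 c1 c2) (cell a))) =
  (narr s a 0 < loop_bound s c0 c1 c2)%N.
Proof. by rewrite -neval_bound ltnNge. Qed.

Lemma den_nkeep b p s i : nkeep b p -> narr (den p s) b i = narr s b i.
Proof.
elim: p s => //= [a j e|p1 IH1 p2 IH2|c p1 IH1 p2 IH2|a c0 c1 c2 p IH] s.
- by rewrite /upd => /negPf->.
- by case/andP=> k1 k2; rewrite IH2 ?IH1.
- by case/andP=> k1 k2; case: ifP => _; rewrite ?IH2 ?IH1.
- case/andP=> /negPf ba k; elim: loop_bound => [|l IHl] /=; rewrite /upd ba //=.
  by rewrite IH.
Qed.

Lemma den_rkeep b p s i : rkeep b p -> rarr (den p s) b i = rarr s b i.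
Proof.
elim: p s => //= [a j e|p1 IH1 p2 IH2|c p1 IH1 p2 IH2|a c0 c1 c2 p IH] s.
- by rewrite /upd => /negPf->.
- by case/andP=> k1 k2; rewrite IH2 ?IH1.
- by case/andP=> k1 k2; case: ifP => _; rewrite ?IH2 ?IH1.
- by move=> k; elim: loop_bound => [|l IHl] //=; rewrite IH.
Qed.

Definition frame p s s' :=
  (forall b i, nkeep b p -> narr s' b i = narr s b i) /\
  (forall b i, rkeep b p -> rarr s' b i = rarr s b i).

(** The invariant must ignore the counter cell, which the loop itself overwrites. The frame
    hypothesis spares it from listing the arrays that never change. *)
Lemma for_rule (P : nat -> store R -> Prop) a c0 c1 c2 p s :
  (forall i s' v, P i s' -> P i (setn s' a 0 v)) ->
  P 0%N s ->
  (forall i s', (i < loop_bound s c0 c1 c2)%N -> narr s' a 0 = i ->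
     frame (SFor a c0 c1 c2 p) s s' -> P i s' -> P i.+1 (den p s')) ->
  P (loop_bound s c0 c1 c2) (den (SFor a c0 c1 c2 p) s).
Proof.
move=> Pa P0 PS /=.
pose g i s' := setn (den p s') a 0 i.+1.
suff H l : (l <= loop_bound s c0 c1 c2)%N ->
    let s' := iteri l g (setn s a 0 0) in
    [/\ narr s' a 0 = l, frame (SFor a c0 c1 c2 p) s s' & P l s'].
  by case: (H _ (leqnn _)).
elim: l => [|l IH] le /=.
  split; [by rewrite /upd !eqxx| |exact: Pa].
  by split=> b i //= /andP[/negPf ba _]; rewrite /upd ba.
have [] := IH (ltnW le); move: (iteri l g _) => s' e f Ps.
split; first by rewrite /upd !eqxx.
  split=> b i /=.
    by case/andP=> ba k; rewrite /upd (negPf ba) /= den_nkeep // f.1 //= ba.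
  by move=> k; rewrite den_rkeep // f.2.
by apply: Pa; apply: PS.
Qed.

End Denotation.

Definition size_of (R : realType) (s : store R) : nat := (narr s 0 0 + narr s 0 1).+1.

Lemma leq_poly C d C' d' x : (0 < x)%N -> (C <= C')%N -> (d <= d')%N ->
  (C * x ^ d <= C' * x ^ d')%N.
Proof. by move=> x0 Cle dle; rewrite leq_mul // leq_pexp2l. Qed.

(** A loop multiplies the time by a linear bound and so raises the exponent by one. The bound is
    uniform because [size_of] reads only array 0. *)
Lemma compile_exec p : wf p -> nkeep 0 p -> exists C d, forall (R : realType) (s : store R),
  exists t, exec (compile p) s t (den p s) /\ (t <= C * size_of s ^ d)%N.
Proof.
have one (R : realType) (s : store R) : (1 <= 1 * size_of s ^ 0)%N by [].
have den_size (R : realType) (s : store R) p' : nkeep 0 p' -> size_of (den p' s) = size_of s.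
  by move=> h; rewrite /size_of !den_nkeep.
elim: p => [|a i e|a i e|p1 IH1 p2 IH2|c p1 IH1 p2 IH2|a c0 c1 c2 p IH] /=.
- by exists 1%N, 0%N => R s; exists 1%N; split; [constructor|].
- by exists 1%N, 0%N => R s; exists 1%N; split; [constructor|].
- by exists 1%N, 0%N => R s; exists 1%N; split; [constructor|].
- case/andP=> w1 w2 /andP[k1 k2].
  have [C1 [d1 H1]] := IH1 w1 k1; have [C2 [d2 H2]] := IH2 w2 k2.
  exists (C1 + C2)%N, (d1 + d2)%N => R s.
  have [t1 [e1 l1]] := H1 R s; have [t2 [e2 l2]] := H2 R (den p1 s).
  exists (t1 + t2)%N; split; first by apply: exec_seq e1 e2.
  rewrite den_size // in l2; rewrite mulnDl leq_add //.
    by apply: leq_trans l1 _; rewrite leq_poly ?leq_addr.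
  by apply: leq_trans l2 _; rewrite leq_poly ?leq_addl.
- case/andP=> w1 w2 /andP[k1 k2].
  have [C1 [d1 H1]] := IH1 w1 k1; have [C2 [d2 H2]] := IH2 w2 k2.
  exists (C1 + C2).+1%N, (d1 + d2)%N => R s.
  have [t1 [e1 l1]] := H1 R s; have [t2 [e2 l2]] := H2 R s.
  have sz : (0 < size_of s ^ (d1 + d2))%N by rewrite expn_gt0.
  exists (if beval s c then t1 else t2).+1; split.
    by apply: exec_if; case: ifP.
  rewrite mulSn -add1n leq_add //; case: ifP => _.
    by apply: leq_trans l1 _; rewrite leq_poly ?leq_addr.
  by apply: leq_trans l2 _; rewrite leq_poly ?leq_addl.
case/and4P=> a0 ka k0 w /andP[_ _]; have [C [d H]] := IH w k0.
exists (2 + (c0 + c1 + c2) * (C + 2))%N, d.+1 => R s.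
set N := loop_bound s c0 c1 c2; set T := (C * size_of s ^ d)%N.
pose g i (s' : store R) := setn (den p s') a 0 i.+1.
pose st i := iteri i g (setn s a 0 0).
have st0 i j : narr (st i) 0 j = narr s 0 j.
  elim: i => [|i IHi]; rewrite /= /upd eq_sym (negPf a0) //= den_nkeep //.
have stN i : loop_bound (st i) c0 c1 c2 = N by rewrite /loop_bound !st0.
have stc i : narr (st i) a 0 = i by case: i => [|i]; rewrite /= /upd !eqxx.
set W := While _ _.
(* Induction on the number [j] of remaining rounds. A round costs the body, one increment and one
   test; the leading 1 is the final test. *)
have wh j : (j <= N)%N -> exists t, exec W (st (N - j)%N) t (st N) /\ (t <= 1 + j * (T + 2))%N.
  elim: j => [|j IHj] jN.
    rewrite subn0; exists 1%N; split=> //; apply: exec_while_false.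
    by rewrite beval_loop stN stc ltnn.
  have [t [e l]] := IHj (ltnW jN).
  have eS : (N - j = (N - j.+1).+1)%N by lia.
  have [tp [ep lp]] := H R (st (N - j.+1)%N).
  exists (tp + 1 + t).+1; split; last first.
    have : (tp <= T)%N by move: lp; rewrite /size_of !st0.
    move: l; clear; lia.
  apply: (@exec_while_true R _ _ _ (st (N - j)%N)) e.
    by rewrite beval_loop stN stc; move: jN; clear; lia.
  apply: exec_seq ep _; rewrite eS [st _.+1]/= /g /setn.
  have -> : (N - j.+1).+1 = neval (den p (st (N - j.+1)%N)) (NAdd (cell a) (NConst 1)).
    by rewrite /= den_nkeep // stc addn1.
  exact: exec_nset.
have [t [e l]] := wh _ (leqnn N); rewrite subnn in e.
exists (1 + t)%N; split; first by apply: exec_seq e; exact: exec_nset.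
have NS : (N <= (c0 + c1 + c2) * size_of s)%N.
  by rewrite /N /loop_bound /size_of; clear; nia.
have S1 : (1 <= size_of s ^ d)%N by rewrite expn_gt0.
have TS : (T + 2 <= (C + 2) * size_of s ^ d)%N.
  by rewrite /T mulnDl leq_add2l leq_pmulr.
have NT : (N * (T + 2) <= (c0 + c1 + c2) * (C + 2) * size_of s ^ d.+1)%N.
  by apply: leq_trans (leq_mul NS TS) _; rewrite expnS; apply: eq_leq; ring.
have S2 : (1 <= size_of s ^ d.+1)%N by rewrite expn_gt0.
by rewrite mulnDl; move: l NT S2; clear; lia.
Qed.

(** * The program *)

Definition seqs := foldr SSeq SSkip.
Definition beq e1 e2 := BAnd (NLe e1 e2) (NLe e2 e1).
Definition bor b1 b2 := BNot (BAnd (BNot b1) (BNot b2)).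
Definition btrue := NLe (NConst 0) (NConst 0).
Definition isz e := NLe e (NConst 0).

Lemma den_cons (R : realType) p l (s : store R) :
  den (seqs (p :: l)) s = den (seqs l) (den p s).
Proof. by []. Qed.

Lemma den_seq (R : realType) p1 p2 (s : store R) : den (SSeq p1 p2) s = den p2 (den p1 s).
Proof. by []. Qed.

Lemma den_if (R : realType) b p1 p2 (s : store R) :
  den (SIf b p1 p2) s = if beval s b then den p1 s else den p2 s.
Proof. by []. Qed.

Lemma den_nil (R : realType) (s : store R) : den (seqs [::]) s = s.
Proof. by []. Qed.

Lemma beval_beq (R : realType) (s : store R) e1 e2 :
  beval s (beq e1 e2) = (neval s e1 == neval s e2).
Proof. by rewrite /= eqn_leq. Qed.

Lemma beval_bor (R : realType) (s : store R) b1 b2 :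
  beval s (bor b1 b2) = beval s b1 || beval s b2.
Proof. by rewrite /= negb_and !negbK. Qed.

Lemma beval_and (R : realType) (s : store R) b1 b2 :
  beval s (BAnd b1 b2) = beval s b1 && beval s b2.
Proof. by []. Qed.

Lemma beval_isz (R : realType) (s : store R) e : beval s (isz e) = (neval s e == 0)%N.
Proof. by rewrite /= leqn0. Qed.

(** An edge is accepted when exactly one end is marked, so the recorded edges never close a
    cycle. *)
Definition grow_body cond ea eb :=
  SIf (BAnd cond (beq (NAdd (NGet 13 ea) (NGet 13 eb)) (NConst 1)))
    (seqs [:: SN 14 (cell 42) (NConst 1); SN 13 ea (NConst 1); SN 13 eb (NConst 1)])
    SSkip.

(* Array 13 marks the vertices joined to [start] by the edges satisfying [cond],
   array 14 the edges through which they were first reached. *)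
Definition grow c0 c1 c2 cond ea eb start := seqs [::
  SFor 40 0 1 0 (SN 13 (cell 40) (NConst 0));
  SN 13 start (NConst 1);
  SFor 41 0 1 0 (SFor 42 c0 c1 c2 (grow_body cond ea eb))].

Definition grow_aux := [:: 13; 14; 40; 41; 42]%N.

Definition agree (R : realType) (aux : seq nat) (s s' : store R) :=
  (forall b i, b \notin aux -> narr s' b i = narr s b i) /\
  (forall b i, rarr s' b i = rarr s b i).

Lemma agree_refl (R : realType) aux (s : store R) : agree aux s s.
Proof. by []. Qed.

Lemma agree_setn (R : realType) aux (s s' : store R) a i v :
  a \in aux -> agree aux s s' -> agree aux s (setn s' a i v).
Proof.
move=> aA [h1 h2]; split=> // b j bA; rewrite /= /upd.
by case: eqVneq => [e|_] /=; [rewrite e aA in bA | apply: h1].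
Qed.

Lemma agree_den (R : realType) aux p (s : store R) :
  (forall b, b \notin aux -> nkeep b p) -> (forall b, rkeep b p) -> agree aux s (den p s).
Proof. by move=> k1 k2; split=> b i => [/k1/den_nkeep|]; rewrite ?den_rkeep. Qed.

Lemma agree_trans (R : realType) aux aux' (s s' s'' : store R) : {subset aux' <= aux} ->
  agree aux s s' -> agree aux' s' s'' -> agree aux s s''.
Proof.
move=> sub [h1 h2] [h3 h4]; split=> b i; last by rewrite h4 h2.
by move=> bA; rewrite h3 ?h1 //; apply: contra bA; apply: sub.
Qed.

(** * Correctness of the graph search *)

Section Grow.
Variables (R : realType) (n M : nat) (ta tb : 'I_M -> 'I_n) (C : {set 'I_M}) (st : 'I_n).
Variables (c0 c1 c2 : nat) (cond : bexp) (ea eb start : nexp) (s : store R).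
Hypothesis hn : narr s 0 0 = n.
Hypothesis hM : loop_bound s c0 c1 c2 = M.
Hypothesis hstart : forall s', agree [:: 13; 40]%N s s' -> neval s' start = st.
Hypothesis hbody : forall s' (y : 'I_M), agree grow_aux s s' -> narr s' 42 0 = y ->
  [/\ neval s' ea = ta y, neval s' eb = tb y & beval s' cond = (y \in C)].

Let F (X : {set 'I_n}) : {set 'I_n} := st |: [set v | [exists y in C,
  ((ta y == v) && (tb y \in X)) || ((tb y == v) && (ta y \in X))]].

Let F_mono : {homo F : X Y / X \subset Y}.
Proof.
move=> X Y sXY; apply: setUS; apply/subsetP=> v; rewrite !inE => /exists_inP[y yC h].
apply/exists_inP; exists y => //.
by case/orP: h => /andP[-> /(subsetP sXY)->]; rewrite ?orbT.
Qed.

Let lev i := iter i F set0.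

(** The last clause is conditional because array 14 is never cleared: only the first search, which
    builds the spanning tree, reads it. *)
Definition grown (U : {set 'I_n}) (T : {set 'I_M}) (s' : store R) :=
  [/\ forall v : 'I_n, narr s' 13 v = (v \in U),
      T \subset C /\ forall y, y \in T -> (ta y \in U) && (tb y \in U),
      forall v, v \in U -> joined ta tb T st v, #|T|.+1 = #|U|
    & (forall y : 'I_M, narr s 14 y = 0%N) -> forall y : 'I_M, narr s' 14 y = (y \in T)].

Local Notation body := (grow_body cond ea eb).

Lemma grow_step U T s' (y : 'I_M) : agree grow_aux s s' -> narr s' 42 0 = y ->
  grown U T s' ->
  exists U' T', [/\ grown U' T' (den body s'), U \subset U' &
    y \in C -> (ta y \in U) || (tb y \in U) -> (ta y \in U') && (tb y \in U')].
Proof.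
move=> ag ey gr; have [eea eeb ec] := hbody ag ey.
have [gU [TC TU] gJ gc gT] := gr.
rewrite [den _ _]/= ec -[(_ <= 1)%N && _]eqn_leq eea eeb !gU.
case: ifP => [/andP[yC /eqP cr]|no]; last first.
  exists U, T; split=> // yC; move: no; rewrite yC /=.
  by case: (ta y \in U); case: (tb y \in U).
set s1 := setn s' 14 (narr s' 42 0) 1; set s2 := setn s1 13 (neval s1 ea) 1.
have a1 : agree grow_aux s s1 by apply: agree_setn ag.
have a2 : agree grow_aux s s2 by apply: agree_setn a1.
have [e1 _ _] := hbody a1 ey; have [_ e2 _] := hbody a2 ey.
rewrite e2.
have yT : y \notin T by apply/negP => /TU /andP[h1 h2]; move: cr; rewrite h1 h2.
exists (ta y |: (tb y |: U)), (y |: T); split; last by rewrite !inE !eqxx orbT.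
  split.
  - by move=> v; rewrite /= /upd /= e1 !inE -!val_eqE /= gU; do 2 case: eqP => //= _.
  - split; first by rewrite subUset sub1set yC.
    move=> z; rewrite !inE => /orP[/eqP->|/TU/andP[-> ->]]; first by rewrite !eqxx orbT.
    by rewrite !orbT.
  - have sub : T \subset y |: T by apply: subsetUr.
    have j : joined ta tb (y |: T) (ta y) (tb y) by apply: joined1; rewrite !inE eqxx.
    have [jt jt'] : joined ta tb (y |: T) st (ta y) /\ joined ta tb (y |: T) st (tb y).
      move: cr; case h1: (ta y \in U); case h2: (tb y \in U) => // _.
        have h := joinedS sub (gJ _ h1); split=> //; exact: joined_trans h j.
      have h := joinedS sub (gJ _ h2); split=> //; rewrite joined_sym in j.
      exact: joined_trans h j.
    by move=> v; rewrite !inE => /or3P[/eqP->|/eqP->|/gJ] //; apply: joinedS.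
  - rewrite !cardsU1 yT !inE -gc.
    have ne : ta y != tb y by apply: contraPneq cr => ->; case: (_ \in U).
    by rewrite (negPf ne) /=; move: cr; case: (ta y \in U); case: (tb y \in U).
  - move=> T0 z; rewrite /= /upd /= ey val_eqE !inE gT //.
    by case: eqP.
by apply/subsetP=> v vU; rewrite !inE vU !orbT.
Qed.

Lemma grow_aux_keep b : b \notin grow_aux -> nkeep b (grow c0 c1 c2 cond ea eb start).
Proof.
rewrite !inE !negb_or => /and5P[h13 h14 h40 h41 h42] /=.
by rewrite h13 h14 h40 h41 h42.
Qed.

Lemma grow_agree : agree grow_aux s (den (grow c0 c1 c2 cond ea eb start) s).
Proof. by apply: agree_den => [b|b]; [apply: grow_aux_keep|]. Qed.

(** A mark may be used in the scan that sets it, so only an inclusion of [lev i] in the marked set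
    is tracked. After [n] rounds [lev] is the fixpoint; conversely, marked vertices are always
    joined to [st]. *)
Lemma growP (s' := den (grow c0 c1 c2 cond ea eb start) s) :
  exists2 T, grown (component ta tb C st) T s' & T \subset C.
Proof.
pose U0 := [set st].
set s1 := den (SFor 40 0 1 0 (SN 13 (cell 40) (NConst 0))) s.
have n1 v : (v < n)%N -> narr s1 13 v = 0%N.
  have lb : loop_bound s 0 1 0 = n by rewrite /loop_bound hn mul1n addn0.
  pose P i (t : store R) := forall v, (v < i)%N -> narr t 13 v = 0%N.
  have := @for_rule R P 40 0 1 0 (SN 13 (cell 40) (NConst 0)) s; rewrite lb; apply=> //.
  move=> i t _ ei _ Pi w; rewrite ltnS leq_eqVlt /= /upd /= ei.
  by case: eqP => //= _ /Pi.
have a1 : agree [:: 13; 40]%N s s1.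
  by apply: agree_den => // b; rewrite !inE negb_or /= => /andP[-> ->].
pose s2 := setn s1 13 (neval s1 start) 1.
have a2 : agree grow_aux s s2.
  apply: agree_setn => //; apply: agree_trans a1 => //.
  by move=> b; rewrite !inE => /orP[]->; rewrite ?orbT.
have g2 : grown U0 set0 s2.
  split.
  - move=> v; rewrite /= /upd /= hstart // val_eqE !inE; case: eqP => // _.
    exact: n1.
  - by split=> [|y]; rewrite ?sub0set ?inE.
  - by move=> v; rewrite inE => /eqP->; apply: joined0.
  - by rewrite cards0 cards1.
  - by move=> T0 y; rewrite in_set0 [LHS](a1.1 14%N y isT) T0.
pose loop2 := SFor 42 c0 c1 c2 body.
have round i s3 U T : agree grow_aux s s3 -> grown U T s3 -> lev i \subset U ->
    st \in U ->
    exists U' T', [/\ grown U' T' (den loop2 s3), U \subset U' & lev i.+1 \subset U'].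
  move=> a3 g3 sub stU.
  pose P j (t : store R) := agree grow_aux s t /\ exists U' T', [/\ grown U' T' t, U \subset U' &
    forall y : 'I_M, (y < j)%N -> y \in C -> (ta y \in lev i) || (tb y \in lev i) ->
      (ta y \in U') && (tb y \in U')].
  have lb : loop_bound s3 c0 c1 c2 = M by rewrite -hM /loop_bound !a3.1.
  have : P M (den loop2 s3).
    have := @for_rule R P 42 c0 c1 c2 body s3; rewrite lb; apply.
    - move=> j t v [ag [U' [T' h]]]; split; first exact: agree_setn ag.
      by exists U', T'.
    - by split=> //; exists U, T; split.
    - move=> j t jM ej _ [ag [U' [T' [gr sU h]]]].
      have [U'' [T'' [gr' sU' h']]] := grow_step (y := Ordinal jM) ag ej gr.
      split.
        apply: agree_trans ag (@agree_den _ grow_aux _ _ _ _) => // b; rewrite !inE !negb_or.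
        by case/and5P=> /= -> ->.
      exists U'', T''; split=> //; first exact: subset_trans sU'.
      move=> y; rewrite ltnS leq_eqVlt => /orP[/eqP ejy|lt] yC lv.
        have ey : y = Ordinal jM by apply: val_inj.
        rewrite ey in yC lv *; apply: h' => //.
        by case/orP: lv => /(subsetP sub)/(subsetP sU)->; rewrite ?orbT.
      by have /andP[/(subsetP sU')-> /(subsetP sU')->] := h y lt yC lv.
  case=> _ [U' [T' [gr sU h]]]; exists U', T'; split=> //.
  apply/subsetP=> v; rewrite /lev iterS -/(lev i) !inE => /orP[/eqP->|].
    exact: (subsetP sU).
  by case/exists_inP=> y yC /orP[]/andP[/eqP<- yl]; have := h y (ltn_ord y) yC;
    rewrite yl ?orbT => /(_ isT)/andP[].
pose P i (t : store R) := agree grow_aux s t /\ exists U T, [/\ grown U T t, st \in U &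
  lev i \subset U].
have lb : loop_bound s2 0 1 0 = n by rewrite /loop_bound !a2.1 // hn mul1n addn0.
have : P n s'.
  have := @for_rule R P 41 0 1 0 loop2 s2; rewrite lb; apply.
  - move=> j t v [ag [U' [T' h]]]; split; first exact: agree_setn ag.
    by exists U', T'.
  - by split=> //; exists U0, set0; rewrite inE sub0set.
  - move=> j t _ _ _ [ag [U [T [gr sU lU]]]].
    have [U' [T' [gr' sU' lU']]] := round j t U T ag gr lU sU.
    split.
      apply: agree_trans ag (@agree_den _ grow_aux _ _ _ _) => // b; rewrite !inE !negb_or.
      by case/and5P=> /= -> -> _ _ ->.
    by exists U', T'; split=> //; apply: (subsetP sU').
case=> _ [U [T [gr sU lU]]]; exists T; last by case: gr => _ [].
suff -> : component ta tb C st = U by [].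
have [_ [TC _] jU _ _] := gr.
apply/eqP; rewrite eqEsubset; apply/andP; split; last first.
  by apply/subsetP=> v /jU j; rewrite inE; apply: joinedS j.
have fE : lev n = fixset F by rewrite /fixset card_ord.
apply: subset_trans lU; rewrite fE; apply/subsetP=> v; rewrite inE => j.
have stF : st \in fixset F by rewrite -(fixsetK F_mono) !inE eqxx.
rewrite -(@joined_closed _ _ ta tb C (fixset F) st v _ j) // => y yC.
rewrite negbK; apply/eqP; apply/idP/idP => h; rewrite -(fixsetK F_mono) !inE;
apply/orP; right; apply/exists_inP; exists y; by rewrite // h eqxx ?orbT.
Qed.

End Grow.

Section Program.
Variable k : nat.

Definition for_elt a p := SFor a 0 0 (3 * k.+1) p.

(* Arrays 5 to 10 tabulate, for every element, its edge, its direction bit, its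
   layer, its spare bit, its head and its tail. *)
Definition row d :=
  let x := NAdd (nmul (3 * k.+1) (cell 30)) (NAdd (nmul 3 (cell 31)) (NConst d)) in
  seqs [:: SN 5 x (cell 30); SN 6 x (NConst (d == 1%N)); SN 7 x (cell 31);
    SN 8 x (NConst (d == 2)); SN 9 x (NGet (if d == 1%N then 1 else 2) (cell 30));
    SN 10 x (NGet (if d == 1%N then 2 else 1) (cell 30))].

Definition tables :=
  SFor 30 0 0 1 (SFor 31 k.+1 0 0 (seqs [:: row 0; row 1; row 2])).

(* Arrays 11 and 12 hold the two bases and real array 1 the potential. *)
Definition init1_mark :=
  for_elt 43 (SIf (BAnd (beq (NGet 8 (cell 43)) (NConst 1))
                        (beq (NGet 14 (NGet 5 (cell 43))) (NConst 1)))
                  (SN 11 (cell 43) (NConst 1)) SSkip).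

Definition init1 := SSeq
  (grow 0 0 1 btrue (NGet 1 (cell 42)) (NGet 2 (cell 42)) (NConst 0)) init1_mark.

(** Greedy choice with indegrees counted in array 15. Confining unsafe edges to layer 0 leaves one
    candidate per class, so only the indegrees need checking. *)
Definition init2 :=
  let x := cell 43 in
  for_elt 43 (SIf (BAnd (isz (NGet 8 x)) (BAnd (BNot (isz (NGet 9 x)))
      (BAnd (bor (BNot (isz (NGet 3 (NGet 5 x)))) (isz (NGet 7 x)))
            (BNot (NLe (NConst k.+1) (NGet 15 (NGet 9 x)))))))
    (seqs [:: SN 12 x (NConst 1); SN 15 (NGet 9 x) (NAdd (NGet 15 (NGet 9 x)) (NConst 1))])
    SSkip).

Definition init_pot := for_elt 43 (SIf (isz (NGet 12 (cell 43)))
  (SR 1 (cell 43) (RGet 0 (NGet 5 (cell 43)))) SSkip).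

Definition same_exp x y := bor (beq x y)
  (BAnd (isz (NGet 3 (NGet 5 x))) (BAnd (beq (NGet 5 x) (NGet 5 y)) (beq (NGet 6 x) (NGet 6 y)))).

Definition prep_cond :=
  BAnd (beq (NGet 11 (cell 42)) (NConst 1))
    (BAnd (beq (NGet 7 (cell 42)) (NGet 7 (cell 51))) (BNot (beq (cell 42) (cell 51)))).

(* With [u] in cell 51, array 13 receives the side of [tail u] in the first base
   minus [u], and array 16 whether the class of [u] meets the second base. *)
Definition prep :=
  let u := cell 51 in let y := cell 42 in let z := cell 44 in
  seqs [:: grow 0 0 (3 * k.+1) prep_cond (NGet 10 y) (NGet 9 y) (NGet 10 u);
    SN 16 (NConst 0) (NConst 0);
    for_elt 44 (SIf (BAnd (beq (NGet 12 z) (NConst 1)) (same_exp u z))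
      (SN 16 (NConst 0) (NConst 1)) SSkip)].

(** The criteria of [forest_base_swap] and [degree_base_swap], read off what [prep] has left for
    [u]. *)
Definition arc_exp (c : bool) :=
  let u := cell 51 in let v := cell 52 in
  if c then BAnd (beq (NGet 11 u) (NConst 1)) (BAnd (isz (NGet 11 v))
      (BAnd (beq (NGet 7 u) (NGet 7 v))
            (BNot (beq (NGet 13 (NGet 10 v)) (NGet 13 (NGet 9 v))))))
  else BAnd (isz (NGet 12 u)) (BAnd (beq (NGet 12 v) (NConst 1))
      (bor (same_exp u v) (BAnd (beq (NGet 9 u) (NGet 9 v)) (isz (cell 16))))).

Definition slack_exp (c : bool) :=
  let u := cell 51 in let v := cell 52 in
  let red x := RSub (RGet 0 (NGet 5 x)) (RGet 1 x) in
  if c then RSub (red v) (red u) else RSub (RGet 1 u) (RGet 1 v).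

Definition tight_exp c := BAnd (arc_exp c)
  (BAnd (RLe (slack_exp c) RZero) (RLe RZero (slack_exp c))).

Definition arc_loop (body : bool -> stm) :=
  for_elt 51 (SSeq prep (for_elt 52 (SSeq (body true) (body false)))).

(* Array 17 stores the distance to the sinks plus one, 0 meaning not reached yet;
   arrays 18 to 21 store the first tight arc found to leave a source. *)
Definition scan c :=
  let u := cell 51 in let v := cell 52 in let t := cell 50 in
  SIf (BAnd (tight_exp c) (BAnd (BNot (isz (NGet 17 v)))
        (BAnd (NLe (NGet 17 v) (NAdd t (NConst 1))) (isz (NGet 17 u)))))
    (SSeq (SN 17 u (NAdd t (NConst 2)))
      (SIf (BAnd (beq (NGet 11 u) (NConst 1)) (BAnd (isz (NGet 12 u)) (isz (cell 18))))
        (seqs [:: SN 18 (NConst 0) (NConst 1); SN 19 (NConst 0) u; SN 20 (NConst 0) v;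
                 SN 21 (NConst 0) (NConst c)])
        SSkip))
    SSkip.

Definition levels := seqs [:: SN 18 (NConst 0) (NConst 0);
  for_elt 43 (SIf (BAnd (isz (NGet 11 (cell 43))) (beq (NGet 12 (cell 43)) (NConst 1)))
    (SN 17 (cell 43) (NConst 1)) (SN 17 (cell 43) (NConst 0)));
  for_elt 50 (arc_loop scan)].

Definition min_slack c :=
  SIf (BAnd (arc_exp c) (BAnd (isz (NGet 17 (cell 51)))
        (BAnd (BNot (isz (NGet 17 (cell 52))))
              (bor (isz (cell 22)) (RLe (slack_exp c) (RGet 2 (NConst 0)))))))
    (SSeq (SN 22 (NConst 0) (NConst 1)) (SR 2 (NConst 0) (slack_exp c)))
    SSkip.

Definition drop_stm := seqs [:: SN 22 (NConst 0) (NConst 0); arc_loop min_slack;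
  SIf (isz (cell 22)) SSkip
    (for_elt 43 (SIf (isz (NGet 17 (cell 43)))
      (SR 1 (cell 43) (RSub (RGet 1 (cell 43)) (RGet 2 (NConst 0)))) SSkip))].

Definition exchange_stm := SIf (isz (cell 21))
  (seqs [:: SN 12 (cell 20) (NConst 0); SN 12 (cell 19) (NConst 1)])
  (seqs [:: SN 11 (cell 19) (NConst 0); SN 11 (cell 20) (NConst 1)]).

Definition step_stm := SSeq levels (SIf (isz (cell 18)) drop_stm exchange_stm).

Definition main_stm := SFor 60 1 0 (3 * k.+1) (SFor 61 3 0 (2 * (3 * k.+1)) step_stm).

Definition output_stm := for_elt 43 (SIf (beq (NGet 11 (cell 43)) (NConst 1))
  (SN 4 (NGet 5 (cell 43)) (NConst 1)) SSkip).

Definition algorithm := seqs [:: tables; init1; init2; init_pot; main_stm; output_stm].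

Lemma algorithm_wf : wf algorithm && nkeep 0 algorithm.
Proof. by []. Qed.

End Program.

(** * Correctness of the tables and of the initial state *)

Section Correctness.
Variables (R : realType) (n m k : nat) (I : fgc_instance R n.+1 m).
Local Notation elt := (elt m k).
Let N := (3 * k.+1 * m)%N.

Definition inputs (s : store R) :=
  [/\ narr s 0 0 = n.+1 /\ narr s 0 1 = m, forall e : 'I_m, narr s 1 e = src I e,
      forall e : 'I_m, narr s 2 e = dst I e,
      forall e : 'I_m, narr s 3 e = (e \in safe I)
    & forall e : 'I_m, rarr s 0 e = cost I e].

Definition tabulated (s : store R) := forall x : elt,
  [/\ narr s 5 x = edge x, narr s 6 x = elt_rev x, narr s 7 x = lay x, narr s 8 x = spare x
    & narr s 9 x = elt_head I x /\ narr s 10 x = elt_tail I x].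

Lemma inputs_ok : inputs (input_store I).
Proof.
split=> //= e; rewrite /nth_ord.
- by rewrite valK.
- by rewrite valK.
- by rewrite valK.
- by rewrite valK.
Qed.

Lemma elt_bound s : inputs s -> loop_bound s 0 0 (3 * k.+1) = N.
Proof. by case=> [[_ e] _ _ _ _]; rewrite /loop_bound e. Qed.

Lemma inputs_agree s s' : inputs s ->
  (forall b i, b \in [:: 0; 1; 2; 3]%N -> narr s' b i = narr s b i) ->
  (forall i, rarr s' 0 i = rarr s 0 i) -> inputs s'.
Proof.
move=> [[h1 h2] h3 h4 h5 h6] hn hr; split; first by rewrite !hn.
- by move=> e; rewrite hn.
- by move=> e; rewrite hn.
- by move=> e; rewrite hn.
- by move=> e; rewrite hr.
Qed.

Lemma inputs_den p s : all (nkeep^~ p) [:: 0; 1; 2; 3]%N -> rkeep 0 p -> inputs s ->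
  inputs (den p s).
Proof.
move=> /allP kp kr h; apply: inputs_agree h _ _ => [b i /kp|i]; first exact: den_nkeep.
exact: den_rkeep.
Qed.

Definition tab_at (s : store R) (x : nat) :=
  [/\ narr s 5 x = edge_of k.+1 x, narr s 6 x = (kind_of x == 1%N),
      narr s 7 x = layer_of k.+1 x, narr s 8 x = (kind_of x == 2)
    & narr s 9 x = narr s (if kind_of x == 1%N then 1 else 2) (edge_of k.+1 x) /\
      narr s 10 x = narr s (if kind_of x == 1%N then 2 else 1) (edge_of k.+1 x)].

Lemma row_ok d e l s : (d < 3)%N -> (l < k.+1)%N -> narr s 30 0 = e -> narr s 31 0 = l ->
  (forall x, (x < ecode k.+1 e l d)%N -> tab_at s x) ->
  forall x, (x < (ecode k.+1 e l d).+1)%N -> tab_at (den (row k d) s) x.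
Proof.
move=> d3 lq he hl IH x.
have ix s' : narr s' 30 0 = e -> narr s' 31 0 = l -> 
  neval (R := R) s' (NAdd (nmul (3 * k.+1) (cell 30)) (NAdd (nmul 3 (cell 31)) (NConst d)))
    = ecode k.+1 e l d.
  by move=> h1 h2; rewrite [LHS]/= !neval_nmul /= h1 h2.
rewrite ltnS leq_eqVlt => lt.
have ee : edge_of k.+1 (ecode k.+1 e l d) = e by rewrite edge_ecode.
have el : layer_of k.+1 (ecode k.+1 e l d) = l by rewrite layer_ecode.
have ed : kind_of (ecode k.+1 e l d) = d by rewrite kind_ecode.
rewrite /row /seqs; cbn [foldr den].
rewrite !ix //.
case/orP: lt => [/eqP->|lt].
  rewrite /tab_at ee el ed /= /upd /= !eqxx he hl.
  by split=> //; case: (d == 1%N).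
have ne : (x == ecode k.+1 e l d) = false by rewrite ltn_eqF.
have [h1 h2 h3 h4 [h5 h6]] := IH x lt.
rewrite /tab_at /= /upd /= ne; split=> //.
by move: h5 h6; case: (kind_of x == 1%N).
Qed.

Lemma tables_ok s : inputs s -> tabulated (den (tables k) s).
Proof.
move=> inp; have [[_ em] hs hd _ _] := inp.
pose P (x : nat) (s' : store R) := forall y, (y < x)%N -> tab_at s' y.
have keep1 x i s' v : P x s' -> P x (setn s' 30 i v).
  by move=> h y /h; rewrite /tab_at; case: (kind_of y == 1%N).
have keep2 x i s' v : P x s' -> P x (setn s' 31 i v).
  by move=> h y /h; rewrite /tab_at; case: (kind_of y == 1%N).
have inner e s1 : narr s1 30 0 = e -> P (ecode k.+1 e 0 0) s1 ->
    P (ecode k.+1 e.+1 0 0) (den (SFor 31 k.+1 0 0 (seqs [:: row k 0; row k 1; row k 2])) s1).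
  move=> he h0.
  have lb : loop_bound s1 k.+1 0 0 = k.+1 by rewrite /loop_bound !mul0n !addn0.
  have -> : ecode k.+1 e.+1 0 0 = ecode k.+1 e k.+1 0 by rewrite /ecode; clear; ring.
  have := @for_rule R (fun l => P (ecode k.+1 e l 0)) 31 k.+1 0 0
    (seqs [:: row k 0; row k 1; row k 2]) s1; rewrite lb; apply.
  - by move=> l s' v; apply: keep2.
  - exact: h0.
  move=> l s' lq hl [fr _] h.
  have he' : narr s' 30 0 = e by rewrite fr.
  have -> : ecode k.+1 e l.+1 0 = (ecode k.+1 e l 2).+1 by rewrite /ecode; clear; lia.
  rewrite (den_cons (row k 0)) (den_cons (row k 1)) (den_cons (row k 2)) den_nil.
  have k30 d (t : store R) : narr (den (row k d) t) 30 0 = narr t 30 0 by rewrite den_nkeep.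
  have k31 d (t : store R) : narr (den (row k d) t) 31 0 = narr t 31 0 by rewrite den_nkeep.
  have r0 := @row_ok 0 e l s' isT lq he' hl h.
  move: (den (row k 0) s') (k30 0%N s') (k31 0%N s') r0 => s2 h30 h31 r0.
  rewrite he' in h30; rewrite hl in h31.
  have e1 : ecode k.+1 e l 1 = (ecode k.+1 e l 0).+1 by rewrite /ecode; clear; lia.
  rewrite -e1 in r0; have r1 := @row_ok 1 e l s2 isT lq h30 h31 r0.
  move: (den (row k 1) s2) (k30 1%N s2) (k31 1%N s2) r1 => s3 h30' h31' r1.
  rewrite h30 in h30'; rewrite h31 in h31'.
  have e2 : ecode k.+1 e l 2 = (ecode k.+1 e l 1).+1 by rewrite /ecode; clear; lia.
  by rewrite -e2 in r1; apply: (@row_ok 2 e l s3 isT lq h30' h31' r1).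
have : P (ecode k.+1 m 0 0) (den (tables k) s).
  have lb : loop_bound s 0 0 1 = m by rewrite /loop_bound em mul0n mul1n.
  have := @for_rule R (fun e => P (ecode k.+1 e 0 0)) 30 0 0 1
    (SFor 31 k.+1 0 0 (seqs [:: row k 0; row k 1; row k 2])) s; rewrite lb; apply.
  - by move=> e s' v; apply: keep1.
  - by move=> y; rewrite /ecode muln0.
  - by move=> e s' _ he _; apply: inner.
move=> h x; have [|h1 h2 h3 h4 [h5 h6]] := h x.
  by rewrite /ecode !muln0 !addn0 ltn_ord.
have [_ hs' hd' _ _] : inputs (den (tables k) s) by apply: inputs_den.
split; rewrite ?h1 ?h2 ?h3 ?h4 // h5 h6 /elt_head /elt_tail /elt_rev.
by case: ifP => _; rewrite -hs' -hd'.
Qed.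

Lemma tabulated_agree s s' : tabulated s ->
  (forall b i, b \in [:: 5; 6; 7; 8; 9; 10]%N -> narr s' b i = narr s b i) -> tabulated s'.
Proof. by move=> h e x; have := h x; rewrite !e. Qed.

Lemma tabulated_den p s : all (nkeep^~ p) [:: 5; 6; 7; 8; 9; 10]%N -> tabulated s ->
  tabulated (den p s).
Proof. by move=> /allP kp h; apply: tabulated_agree h _ => b i /kp; apply: den_nkeep. Qed.

(* Spare elements are never in [avail setT], so the two initial bases are disjoint. *)
Definition spare_over (T : {set 'I_m}) := [set x : elt | spare x && (edge x \in T)].

(** Every layer receives a copy of the same spanning tree. *)
Lemma spare_over_base T : tree (src I) (dst I) T -> base1 I (spare_over T).
Proof.
move=> /andP[/spansP sp cT]; apply/forallP=> l.
pose f (e : 'I_m) : elt := Ordinal (@ecode_lt k.+1 m e l 2 (ltn_ord e) (ltn_ord l) isT).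
have fe e : edge (f e) = e by apply: val_inj; rewrite /= edge_ecode.
have fr e : elt_rev (f e) = false by rewrite /elt_rev /= kind_ecode.
have fs e : spare (f e) by rewrite /spare /= kind_ecode.
have fl e : lay (f e) = l by apply: val_inj; rewrite /= layer_ecode.
have -> : layer (@lay m k) (spare_over T) l = f @: T.
  apply/setP=> x; rewrite !inE; apply/andP/imsetP.
    case=> /andP[sx eT] /eqP lx; exists (edge x) => //; apply: val_inj => /=.
    by rewrite -[LHS](@ecodeK k.+1 x) -lx (eqP sx).
  by case=> e eT ->; rewrite fs fe fl eqxx.
rewrite /tree card_imset ?cT ?andbT; last by move=> e e' /(congr1 (@edge m k)); rewrite !fe.
apply/spansP=> a b; apply: joined_map (sp a b) => e eT.
have -> : src I e = elt_tail I (f e) by rewrite /elt_tail fr fe.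
have -> : dst I e = elt_head I (f e) by rewrite /elt_head fr fe.
by apply: joined1; apply: imset_f.
Qed.

Lemma init1_ok s : inputs s -> tabulated s ->
  (forall e : 'I_m, narr s 14 e = 0%N) -> (forall x : elt, narr s 11 x = 0%N) ->
  exists2 B1, base1 I B1 /\ {in B1, forall x, spare x} &
    forall x : elt, narr (den (init1 k) s) 11 x = (x \in B1).
Proof.
move=> inp tab z14 z11; have [[en em] hs hd _ _] := inp.
set g := grow 0 0 1 btrue (NGet 1 (cell 42)) (NGet 2 (cell 42)) (NConst 0).
have [||||T [gU _ gJ gc gT] _] := @growP R n.+1 m (src I) (dst I) setT ord0 0 0 1 btrue
   (NGet 1 (cell 42)) (NGet 2 (cell 42)) (NConst 0) s.
- by [].
- by rewrite /loop_bound em mul0n mul1n.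
- by [].
- by move=> s' y [ag _] ey; split=> /=; rewrite ?ey ?ag // inE.
set s1 := den g s in gU gT.
have cT : component (src I) (dst I) setT ord0 = setT.
  apply/setP=> v; rewrite !inE; exact: graph_connected.
rewrite cT in gJ gc.
have tT : tree (src I) (dst I) T.
  apply/andP; split; last by rewrite -cardsT -gc eqxx.
  apply/spansP=> a b; apply: joined_trans (gJ b (in_setT _)).
  by rewrite joined_sym; apply: gJ.
exists (spare_over T).
  by split; [apply: spare_over_base|move=> x; rewrite inE => /andP[]].
have inp1 : inputs s1 by apply: inputs_den.
have tab1 : tabulated s1 by apply: tabulated_den.
pose P i (t : store R) := forall x : elt, narr t 11 x = (x < i)%N && (x \in spare_over T).
have : P N (den (init1 k) s).
  rewrite /init1 den_seq -/g -/s1 -(elt_bound inp1); apply: for_rule => //.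
    by move=> x; rewrite den_nkeep // z11.
  rewrite elt_bound // => i t iN ei [fr _] Pi x; pose y : elt := Ordinal iN.
  have [h1 _ _ h4 _] := tab1 y.
  rewrite [den _ _]/= -!eqn_leq ei !fr // h1 gT // h4.
  rewrite -/(nat_of_ord y).
  have xy : (nat_of_ord x == i) = (x == y) by [].
  have lt : (x < i.+1)%N = (x == y) || (x < i)%N by rewrite ltnS leq_eqVlt.
  rewrite lt; case: ifP => [c|c] /=; rewrite ?/upd /=.
    rewrite ?ei xy; case: eqP => [->|_] //=; rewrite inE.
    by move: c; case: (spare y); case: (edge y \in T).
  rewrite Pi; case: eqP => [->|_] //=; rewrite ltnn inE.
  by move: c; case: (spare y); case: (edge y \in T).
by move=> h x; rewrite h ltn_ord.
Qed.

End Correctness.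

Section InitialState.
Variables (R : realType) (n m k : nat) (I : fgc_instance R n.+1 m).
Local Notation elt := (elt m k).
Let N := (3 * k.+1 * m)%N.
Implicit Types (s : store R) (B : {set elt}).

Lemma elt_ltS (x : elt) i (iN : (i < N)%N) :
  (x < i.+1)%N = (x == Ordinal iN :> elt) || (x < i)%N.
Proof. by rewrite ltnS leq_eqVlt. Qed.

Definition start_ok (x : elt) := (x \in avail k I setT) && (elt_head I x != ord0).

(** An element is passed over only if its head is full, and a full head stays full because indegrees
    never decrease. *)
Lemma init2_ok s : inputs I s -> tabulated k I s ->
  (forall x : elt, narr s 12 x = 0%N) -> (forall v : 'I_n.+1, narr s 15 v = 0%N) ->
  exists2 B : {set elt}, [/\ forall x, x \in B -> start_ok x,
      forall v, (#|into (elt_head I) B v| <= k.+1)%N &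
      forall x, start_ok x -> x \in B \/ #|into (elt_head I) B (elt_head I x)| = k.+1]
    & forall x : elt, narr (den (init2 k) s) 12 x = (x \in B).
Proof.
move=> inp tab z12 z15.
pose P i s' := exists B : {set elt}, [/\ forall x, x \in B -> start_ok x && (x < i)%N,
   forall v, (#|into (elt_head I) B v| <= k.+1)%N,
   forall x : elt, (x < i)%N -> start_ok x -> x \in B \/ #|into (elt_head I) B (elt_head I x)| = k.+1,
   forall x : elt, narr s' 12 x = (x \in B)
 & forall v : 'I_n.+1, narr s' 15 v = #|into (elt_head I) B v| ].
have into0 v : #|into (elt_head I) (set0 : {set elt}) v| = 0%N.
  by apply: eq_card0 => x; rewrite !inE.
have : P N (den (init2 k) s).
  rewrite /N -(elt_bound k inp); apply: for_rule => //.
    exists set0; split=> //.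
    - by move=> x; rewrite inE.
    - by move=> v; rewrite into0.
    - by move=> x; rewrite inE z12.
    - by move=> v; rewrite into0 z15.
  rewrite (elt_bound k inp) => i s' iN ei [fr _] [B [hB hc hall h12 h15]].
  pose y : elt := Ordinal iN.
  have [[_ _] _ _ hsafe _] := inp.
  have [t5 t6 t7 t8 [t9 t10]] := tab y.
  set c := BAnd _ _; set p := seqs _.
  have f9 : narr s' 9 i = elt_head I y by rewrite fr.
  have ec : beval s' c = start_ok y && (#|into (elt_head I) B (elt_head I y)| < k.+1)%N.
    have f5 : narr s' 5 i = edge y by rewrite fr.
    have f7 : narr s' 7 i = lay y by rewrite fr.
    have f8 : narr s' 8 i = spare y by rewrite fr.
    have f3 : narr s' 3 (edge y) = (edge y \in safe I) by rewrite fr.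
    rewrite /c [LHS]/= ei f5 f7 f8 f3 f9 h15 !leqn0 /start_ok !inE.
    rewrite negb_and !negbK -ltnNge -!val_eqE /=.
    by case: (spare y) => //=; case: (edge y \in safe I) => //=;
       case: (val (elt_head I y) == 0)%N => //=; rewrite ?andbF //= ?andbT; case: (val (lay y)).
  have yB : y \notin B by apply/negP => /hB /andP[_]; rewrite ltnn.
  rewrite den_if ec; case: ifP => cy; last first.
    exists B; split=> //.
      by move=> x /hB /andP[-> /= lt]; apply: leq_trans lt _.
    move=> x; rewrite (elt_ltS x iN) => /orP[/eqP->|]; last exact: hall.
    move=> sy; right; apply/eqP; rewrite eqn_leq hc; move: cy; rewrite sy /=.
    by rewrite ltnNge => /negbFE.
  case/andP: cy => sy ly.
  have intoU v : #|into (elt_head I) (y |: B) v| = ((elt_head I y == v) + #|into (elt_head I) B v|)%N.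
    have -> : into (elt_head I) (y |: B) v =
        if elt_head I y == v then y |: into (elt_head I) B v else into (elt_head I) B v.
      apply/setP=> x; case: ifP => hy; rewrite !inE; have [->|//] := eqVneq x y;
      by rewrite hy //= (negPf yB).
    by case: ifP => // hy; rewrite cardsU1 inE (negPf yB).
  exists (y |: B); split.
  - move=> x; rewrite !inE => /orP[/eqP->|/hB /andP[-> lt]]; first by rewrite sy /=.
    exact: ltn_trans lt _.
  - by move=> v; rewrite intoU; case: eqP => [<-|_]; [exact: ly|exact: hc].
  - move=> x; rewrite (elt_ltS x iN) => /orP[/eqP->|lt sx]; first by left; rewrite !inE eqxx.
    case: (hall x lt sx) => h; first by left; rewrite !inE h orbT.
    right; apply/eqP; rewrite eqn_leq intoU; apply/andP; split; last by rewrite h leq_addl.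
    by case: eqP => [<-|_]; rewrite ?h // add1n.
  - move=> x; rewrite /p /= /upd /= ei h12 !inE -val_eqE /=.
    by case: eqP.
  - move=> v; rewrite /p /= /upd /= ei intoU f9 !h15 val_eqE eq_sym.
    by case: eqP => [->|//]; rewrite addnC.
case=> B [hB hc hall h12 _]; exists B => //; split=> //.
  by move=> x /hB /andP[].
by move=> x; apply: hall.
Qed.

(** At a vertex that is not full every available entering element was chosen, but [avail_connected]
    for the singleton gives [k.+1] of them. *)
Lemma start_base B F : fgc_feasible I 1 k F ->
  (forall x, x \in B -> start_ok x) -> (forall v, (#|into (elt_head I) B v| <= k.+1)%N) ->
  (forall x, start_ok x -> x \in B \/ #|into (elt_head I) B (elt_head I x)| = k.+1) ->
  base2 I B.
Proof.
move=> feas hB hc hall; apply/degree_baseP; split.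
  move=> v; case: eqVneq => [->|v0].
    apply: eq_card0 => x; rewrite !inE; apply/negbTE/negP => /andP[/hB/andP[_ h]].
    by rewrite (negPf h).
  apply/eqP; rewrite eqn_leq hc /=; apply: contraT; rewrite -ltnNge => lt.
  have vS : ord0 \notin [set v] by rewrite inE eq_sym.
  have := avail_connected feas vS; rewrite ltnNge => /(_ _)/negP[].
    by apply/set0Pn; exists v; rewrite inE.
  rewrite -ltnS; apply: leq_ltn_trans (lt); apply: subset_leq_card; apply/subsetP=> x.
  rewrite !inE => /andP[/and3P[sp eF lx] /andP[_]]; rewrite inE => /eqP hx.
  rewrite hx eqxx andbT.
  have sx : start_ok x by rewrite /start_ok !inE sp lx hx v0.
  by case: (hall x sx) => //; rewrite hx => h; rewrite h ltnn in lt.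
move=> x y xB yB /orP[/eqP//|/and3P[us /eqP e1 /eqP e2]].
have /andP[] := hB x xB; have /andP[] := hB y yB; rewrite !inE -e1 (negPf us) /=.
move=> /andP[sy /eqP ly] _ /andP[sx /eqP lx] _.
by rewrite -(eltK sx) -(eltK sy) e1 e2 lx ly.
Qed.

Record ctx (st : mstate elt R) s : Prop := Ctx {
  ctx_inputs : inputs I s;
  ctx_tab : tabulated k I s;
  ctx_fst : forall x : elt, narr s 11 x = (x \in fstb st);
  ctx_snd : forall x : elt, narr s 12 x = (x \in sndb st);
  ctx_pot : forall x : elt, rarr s 1 x = pot st x }.

Lemma init_pot_ok s B1 B2 : inputs I s -> tabulated k I s ->
  (forall x : elt, narr s 11 x = (x \in B1)) -> (forall x : elt, narr s 12 x = (x \in B2)) ->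
  (forall x : elt, rarr s 1 x = 0) ->
  ctx (MState B1 B2 (fun x => if x \in B2 then 0 else price I x)) (den (init_pot k) s).
Proof.
move=> inp tab h1 h2 z1; split.
- exact: inputs_den.
- exact: tabulated_den.
- by move=> x; rewrite den_nkeep.
- by move=> x; rewrite den_nkeep.
pose P i s' := forall x : elt, rarr s' 1 x = if (x < i)%N && (x \notin B2) then price I x else 0.
have : P N (den (init_pot k) s).
  rewrite /N -(elt_bound k inp); apply: for_rule => //.
  rewrite (elt_bound k inp) => i s' iN ei [fr frr] Pi x.
  pose y : elt := Ordinal iN; have [t5 _ _ _ _] := tab y; have [_ _ _ _ hcost] := inp.
  rewrite (elt_ltS x iN) -/y [den _ _]/= ei fr // (h2 y) leqn0 eqb0.
  have xy : (nat_of_ord x == i) = (x == y) by [].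
  case: ifP => c /=; rewrite ?/upd /= ?xy ?Pi; case: eqP => [->|_] //=.
    by rewrite fr // t5 frr // hcost c.
  by rewrite ltnn c.
by move=> h x /=; rewrite h ltn_ord /=; case: (x \in B2).
Qed.

End InitialState.

(** * Exchange arcs as tests on the store *)

Section Arcs.
Variables (R : realType) (n m k : nat) (I : fgc_instance R n.+1 m).
Local Notation elt := (elt m k).
Let N := (3 * k.+1 * m)%N.
Implicit Types (s : store R) (B : {set elt}) (u v x y : elt) (st : mstate elt R) (c : bool).

Local Notation iarc := (arc (base1 I) (base2 I)).
Local Notation islack := (slack (price I)).
Local Notation itight := (tight (base1 I) (base2 I) (price I)).

Definition ctx_arrays := [:: 0; 1; 2; 3; 5; 6; 7; 8; 9; 10; 11; 12]%N.

Lemma ctx_agree st s s' : ctx I st s ->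
  (forall b i, b \in ctx_arrays -> narr s' b i = narr s b i) ->
  (forall b i, b \in [:: 0; 1]%N -> rarr s' b i = rarr s b i) -> ctx I st s'.
Proof.
move=> [h1 h2 h3 h4 h5] hn hr; split.
- apply: inputs_agree h1 _ _ => [b i|i]; last exact: hr.
  by rewrite !inE => /or4P[]/eqP->; apply: hn.
- apply: tabulated_agree h2 _ => b i.
  by rewrite !inE; do 5![case/orP=> [/eqP->|]; first exact: hn]; move=> /eqP->; apply: hn.
- by move=> x; rewrite hn.
- by move=> x; rewrite hn.
- by move=> x; rewrite hr.
Qed.

Lemma ctx_den st p s : all (nkeep^~ p) ctx_arrays -> all (rkeep^~ p) [:: 0; 1]%N ->
  ctx I st s -> ctx I st (den p s).
Proof.
move=> /allP kn /allP kr h; apply: ctx_agree h _ _ => b i => [/kn|/kr].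
  exact: den_nkeep.
exact: den_rkeep.
Qed.

Lemma ctx_bound st s : ctx I st s -> loop_bound s 0 0 (3 * k.+1) = N.
Proof. by case=> inp _ _ _ _; apply: (elt_bound k inp). Qed.

Lemma same_exp_ok s ex ey x y : inputs I s -> tabulated k I s ->
  neval s ex = x -> neval s ey = y -> beval s (same_exp ex ey) = same_class I x y.
Proof.
move=> inp tab hx hy; have [_ _ _ hs _] := inp.
have [x5 x6 _ _ _] := tab x; have [y5 y6 _ _ _] := tab y.
rewrite /same_exp beval_bor beval_beq hx hy [beval _ (BAnd _ _)]/= !hx !hy -!eqn_leq.
rewrite x5 y5 x6 y6 hs leqn0 eqb0 /same_class -!val_eqE /=.
by congr (_ || _); congr (_ && (_ && _)); case: (elt_rev x); case: (elt_rev y).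
Qed.

Definition prepared st s u :=
  (forall v : 'I_n.+1, narr s 13 v = (v \in component (elt_tail I) (elt_head I)
     (layer (@lay m k) (fstb st) (lay u) :\ u) (elt_tail I u))) /\
  narr s 16 0 = [exists z in sndb st, same_class I u z].

Definition prep_aux := [:: 13; 14; 16; 40; 41; 42; 44]%N.

Lemma prep_agree s : agree prep_aux s (den (prep k) s).
Proof.
apply: agree_den => // b; rewrite !inE !negb_or.
by case/and5P=> h1 h2 h3 h4 /and3P[h5 h6 h7] /=; rewrite h1 h2 h3 h4 h5 h6 h7.
Qed.

Lemma prep_ok st s u : ctx I st s -> narr s 51 0 = u -> prepared st (den (prep k) s) u.
Proof.
move=> cx hu; rewrite /prep; set g := grow _ _ _ _ _ _ _; set z0 := SN 16 _ _.
set lp := for_elt _ _ _.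
rewrite (den_cons g) (den_cons z0) (den_cons lp) den_nil.
have [inp tab h11 h12 _] := cx; have [t5 _ t7 _ [_ t10]] := tab u.
set s1 := den g s; set s2 := den z0 s1.
have ag : agree grow_aux s s1 by apply: grow_agree.
split.
  move=> v; rewrite den_nkeep // [narr s2 13 v]den_nkeep //.
  pose C := layer (@lay m k) (fstb st) (lay u) :\ u.
  have [||||T [gU _ _ _ _] _] := @growP R n.+1 N (elt_tail I) (elt_head I) C (elt_tail I u)
    0 0 (3 * k.+1) prep_cond (NGet 10 (cell 42)) (NGet 9 (cell 42)) (NGet 10 (cell 51)) s.
  - by have [[]] := inp.
  - exact: ctx_bound cx.
  - by move=> s' [a _]; rewrite /= !a // hu t10.
  - move=> s' y [a _] ey; have [_ _ y7 _ [y9 y10]] := tab y.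
    split; [by rewrite /= ey a|by rewrite /= ey a|].
    rewrite [beval _ _]/= ey !a // hu h11 y7 t7 -!eqn_leq !inE -!val_eqE /=.
    by rewrite eqb1; case: (y \in fstb st) => /=; rewrite ?andbF // andbC.
  exact: gU.
have inp2 : inputs I s2 by do 2 apply: inputs_den => //.
have tab2 : tabulated k I s2 by do 2 apply: tabulated_den => //.
have hu2 : narr s2 51 0 = u by rewrite -hu !den_nkeep.
have h12' x : narr s2 12 x = (x \in sndb st) by rewrite -h12 !den_nkeep.
pose P i (t : store R) := narr t 16 0 = [exists z in sndb st, (z < i)%N && same_class I u z].
have : P N (den lp s2).
  rewrite /N -(elt_bound k inp2); apply: for_rule => //.
    rewrite /P /s2 /= /upd /=; apply/esym/eqP; rewrite eqb0.
    by apply/exists_inPn => z _; rewrite ?ltn0.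
  rewrite (elt_bound k inp2) => i t iN ei [fr frr] Pi; pose y : elt := Ordinal iN.
  have inpt : inputs I t.
    apply: inputs_agree inp2 _ _ => [b j|j]; last exact: frr.
    by rewrite !inE => /or4P[]/eqP->; apply: fr.
  have tabt : tabulated k I t.
    apply: tabulated_agree tab2 _ => b j.
    by rewrite !inE; do 5![case/orP=> [/eqP->|]; first exact: fr]; move=> /eqP->; apply: fr.
  have ec : beval t (BAnd (beq (NGet 12 (cell 44)) (NConst 1))
      (same_exp (cell 51) (cell 44))) = (y \in sndb st) && same_class I u y.
    have -> : beval t (BAnd (beq (NGet 12 (cell 44)) (NConst 1))
        (same_exp (cell 51) (cell 44))) =
      beval t (beq (NGet 12 (cell 44)) (NConst 1)) &&
      beval t (same_exp (cell 51) (cell 44)) by [].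
    rewrite beval_beq (same_exp_ok (x := u) (y := y) inpt tabt) //=.
      by rewrite ei fr // (h12' y) eqb1.
    by rewrite fr.
  rewrite den_if ec /P; case: ifP => c.
    rewrite /= /upd /=; apply/esym/eqP; rewrite eqb1; case/andP: c => yS sy.
    by apply/exists_inP; exists y; rewrite // sy leqnn.
  rewrite /= Pi; congr nat_of_bool; apply/exists_inP/exists_inP => -[z zS /andP[lt sz]].
    by exists z; rewrite // sz (ltn_trans lt).
  move: lt; rewrite (elt_ltS z iN) => /orP[/eqP ez|lt]; last by exists z; rewrite // sz lt.
  by rewrite (ez : z = y) in zS sz; move: c; rewrite zS sz.
move=> ->; congr nat_of_bool; apply/exists_inP/exists_inP => -[z zS].
  by case/andP=> _ sz; exists z.
by move=> sz; exists z; rewrite // ltn_ord.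
Qed.

Lemma arc_exp_ok st s c u v : ctx I st s -> prepared st s u ->
  base1 I (fstb st) -> base2 I (sndb st) -> narr s 51 0 = u -> narr s 52 0 = v ->
  beval s (arc_exp c) = iarc st c u v.
Proof.
move=> [inp tab h11 h12 _] [p13 p16] b1 b2 hu hv.
have [u5 _ u7 _ [u9 u10]] := tab u; have [v5 _ v7 _ [v9 v10]] := tab v.
case: c.
  rewrite [LHS]/= hu hv h11 h11 u7 v7 v9 v10 !p13 -!eqn_leq leqn0 eqb1 eqb0 /arc.
  case: (boolP (u \in fstb st)) => //= uB; case: (boolP (v \in fstb st)) => //= vB.
  rewrite /base1 (forest_base_swap b1 uB vB) /crosses -val_eqE /=; congr (_ && _).
  by case: (elt_tail I v \in _); case: (elt_head I v \in _).
have -> : beval s (arc_exp false) =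
  [&& beval s (isz (NGet 12 (cell 51))), beval s (beq (NGet 12 (cell 52)) (NConst 1))
    & beval s (bor (same_exp (cell 51) (cell 52))
        (BAnd (beq (NGet 9 (cell 51)) (NGet 9 (cell 52))) (isz (cell 16))))] by [].
rewrite beval_isz beval_beq beval_bor (same_exp_ok (x := u) (y := v) inp tab) //.
rewrite [beval _ _]/= [neval _ _]/= [neval s (NGet 12 (cell 52))]/=.
rewrite hu hv h12 h12 u9 v9 p16 -eqn_leq leqn0 eqb0 eqb0 /= eqb1 /arc.
case: (boolP (u \in sndb st)) => //= uB; case: (boolP (v \in sndb st)) => //= vB.
rewrite /base2 (degree_base_swap (same_equiv I) (@same_head _ _ _ _ I) b2 vB uB).
by rewrite -val_eqE negb_exists_in.
Qed.

Lemma slack_exp_ok st s c u v : ctx I st s -> narr s 51 0 = u -> narr s 52 0 = v ->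
  reval s (slack_exp c) = islack st c u v.
Proof.
move=> [inp tab _ _ hp] hu hv; have [_ _ _ _ hc] := inp.
have [u5 _ _ _ _] := tab u; have [v5 _ _ _ _] := tab v.
by case: c; rewrite /= hu hv ?u5 ?v5 ?hc ?hp ?hp.
Qed.

Lemma tight_exp_ok st s c u v : ctx I st s -> prepared st s u ->
  base1 I (fstb st) -> base2 I (sndb st) -> narr s 51 0 = u -> narr s 52 0 = v ->
  beval s (tight_exp c) = itight st c u v.
Proof.
move=> cx pr b1 b2 hu hv; rewrite /tight -(arc_exp_ok c cx pr b1 b2 hu hv).
rewrite eq_le andbC -(slack_exp_ok c cx hu hv) andbC.
by [].
Qed.

Definition arc_aux := [:: 13; 14; 16; 40; 41; 42; 44; 51; 52]%N.

Definition done_arcs (i j : nat) : {set bool * elt * elt} :=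
  [set a : bool * elt * elt | (a.1.2 < i)%N || (a.1.2 == i :> nat) && (a.2 < j)%N].

(* [J A] has to hold once the arcs in [A] have been processed. *)
Lemma arc_loop_rule (J : {set bool * elt * elt} -> store R -> Prop) body st s :
  ctx I st s -> base1 I (fstb st) -> base2 I (sndb st) ->
  (forall c, all (nkeep^~ (body c)) (ctx_arrays ++ [:: 13; 16; 51; 52])%N) ->
  (forall c, all (rkeep^~ (body c)) [:: 0; 1]%N) ->
  (forall A s1 s2, agree arc_aux s1 s2 -> J A s1 -> J A s2) ->
  J set0 s ->
  (forall A s' c u v, ctx I st s' -> narr s' 51 0 = u -> narr s' 52 0 = v ->
     beval s' (arc_exp c) = iarc st c u v -> beval s' (tight_exp c) = itight st c u v ->
     reval s' (slack_exp c) = islack st c u v ->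
     (forall b i, nkeep b (arc_loop k body) -> narr s' b i = narr s b i) ->
     J A s' -> J ((c, u, v) |: A) (den (body c) s')) ->
  J setT (den (arc_loop k body) s).
Proof.
move=> cx b1 b2 kn kr Jag J0 Jbody.
pose outer := SSeq (prep k) (for_elt k 52 (SSeq (body true) (body false))).
pose inner := SSeq (body true) (body false).
pose fr s' := forall b i, nkeep b (arc_loop k body) -> narr s' b i = narr s b i.
pose P i (t : store R) := [/\ ctx I st t, fr t & J (done_arcs i 0) t].
have ctx_set a t w : a \notin ctx_arrays -> ctx I st t -> ctx I st (setn t a 0 w).
  move=> na h; apply: ctx_agree h _ _ => // b i bA /=; rewrite /upd.
  by case: eqVneq bA na => [->->|].
have fr_set a t w : ~~ nkeep a (arc_loop k body) -> fr t -> fr (setn t a 0 w).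
  move=> na h b i kb; have ba : b != a by apply: contraNneq na => <-.
  by rewrite [LHS]/= /upd (negPf ba); apply: h.
have J_set a A t w : a \in arc_aux -> J A t -> J A (setn t a 0 w).
  by move=> aA; apply: Jag; apply: agree_setn.
have bk c b t i : b \in (ctx_arrays ++ [:: 13; 16; 51; 52])%N ->
    narr (den (body c) t) b i = narr t b i.
  by move=> bA; apply: den_nkeep; apply: (allP (kn c)).
have bctx c t : ctx I st t -> ctx I st (den (body c) t).
  move=> h; apply: ctx_den h => //; apply/allP=> b bA; apply: (allP (kn c)).
  by rewrite mem_cat bA.
have bprep c t u : prepared st t u -> prepared st (den (body c) t) u.
  by move=> [h1 h2]; split=> [v|]; rewrite bk.
have bfr c t : fr t -> fr (den (body c) t).
  move=> h b i kb; rewrite den_nkeep ?h //; move: kb; rewrite /= => /andP[_ /andP[_ /andP[_]]].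
  by case/andP; case: c.
(* Both kinds of arc are treated for one pair. The bodies leave arrays 13 and 16 alone, so one run
   of [prep] serves all [v]. *)
have step_inner t u v A : ctx I st t -> fr t -> prepared st t u -> narr t 51 0 = u ->
    narr t 52 0 = v -> J A t ->
    let t' := den inner t in [/\ ctx I st t', fr t', prepared st t' u, narr t' 51 0 = u
      & J ((false, u, v) |: ((true, u, v) |: A)) t'].
  move=> c1 f1 p1 hu hv j1; rewrite /inner den_seq; set t1 := den (body true) t.
  have c2 : ctx I st t1 by apply: bctx.
  have f2 : fr t1 by apply: bfr.
  have p2 : prepared st t1 u by apply: bprep.
  have hu2 : narr t1 51 0 = u by rewrite bk.
  have hv2 : narr t1 52 0 = v by rewrite bk.
  have j2 : J ((true, u, v) |: A) t1.
    apply: Jbody => //; [exact: arc_exp_ok|exact: tight_exp_ok|exact: slack_exp_ok].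
  split; [exact: bctx|exact: bfr|exact: bprep|by rewrite bk|].
  apply: Jbody => //; [exact: arc_exp_ok|exact: tight_exp_ok|exact: slack_exp_ok].
have : P N (den (arc_loop k body) s).
  rewrite -(ctx_bound cx); apply: for_rule.
  - move=> i t w [h1 h2 h3]; split; [exact: ctx_set|apply: fr_set => //|exact: J_set].
  - split=> //; suff -> : done_arcs 0 0 = set0 by [].
    by apply/setP=> a; rewrite !inE ltn0 andbF.
  rewrite (ctx_bound cx) => i t iN ei _ [c1 f1 j1]; pose u : elt := Ordinal iN.
  rewrite den_seq; set t1 := den (prep k) t.
  have ap := prep_agree t.
  have c2 : ctx I st t1 by apply: ctx_den.
  have f2 : fr t1.
    move=> b l kb; rewrite den_nkeep ?f1 //.
    by move: kb; rewrite /arc_loop /for_elt [nkeep _ _]/= -/(nkeep b (prep k)) => /andP[_ /andP[]].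
  have p2 : prepared st t1 u by apply: prep_ok.
  have hu2 : narr t1 51 0 = u by rewrite den_nkeep.
  have j2 : J (done_arcs i 0) t1 
    by apply: Jag j1; apply: (agree_trans _ (agree_refl arc_aux t) ap); apply/allP.
  pose P' j (t' : store R) := [/\ ctx I st t', fr t', prepared st t' u, narr t' 51 0 = u
    & J (done_arcs i j) t'].
  have : P' N (den (for_elt k 52 inner) t1).
    rewrite -(ctx_bound c2); apply: for_rule => //.
    - move=> j t' w [h1 h2 h3 h4 h5]; split=> //; [exact: ctx_set|exact: fr_set|exact: J_set].
    rewrite (ctx_bound c2) => j t' jN ej _ [h1 h2 h3 h4 h5]; pose v : elt := Ordinal jN.
    have [g1 g2 g3 g4 g5] := step_inner t' u v _ h1 h2 h3 h4 ej h5.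
    split=> //; move: g5; congr J; apply/setP=> -[[c x] y].
    rewrite !inE /= ltnS [(y <= j)%N]leq_eqVlt !xpair_eqE -!val_eqE /=.
    by case: c; case: (val x == i) => //=; case: (val y == j); rewrite ?orbT ?orbF.
  case=> h1 h2 _ _ h5; split=> //; move: h5; congr J; apply/setP=> -[[c x] y].
  by rewrite !inE /= ltn_ord ltn0 andbF orbF andbT ltnS [(x <= i)%N]leq_eqVlt orbC.
case=> _ _; congr J; apply/setP=> -[[c x] y]; rewrite !inE /=.
by rewrite ltn_ord.
Qed.

End Arcs.

(** * One step of the intersection algorithm and its iteration *)

Section Steps.
Variables (R : realType) (n m k : nat) (I : fgc_instance R n.+1 m).
Local Notation elt := (elt m k).
Let N := (3 * k.+1 * m)%N.
Implicit Types (s : store R) (B : {set elt}) (u v x y : elt) (st : mstate elt R) (c : bool).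

Local Notation iarc := (arc (base1 I) (base2 I)).
Local Notation islack := (slack (price I)).
Local Notation itight := (tight (base1 I) (base2 I) (price I)).
Local Notation ilevel := (level (base1 I) (base2 I) (price I)).
Local Notation icoreach := (coreach (base1 I) (base2 I) (price I)).
Local Notation icrossing := (crossing (base1 I) (base2 I) (price I)).
Local Notation istep := (mstep (base1 I) (base2 I) (price I)).

(** An arc is recorded only when the very first source is marked. At that moment no source lies in
    the preceding level, as [StepExchange] demands. *)
Definition found st s :=
  (narr s 18 0 = 0%N /\ forall x, x \in sources st -> narr s 17 x = 0%N) \/
  (narr s 18 0 = 1%N /\ exists i c u v,
    [/\ narr s 19 0 = u, narr s 20 0 = v, narr s 21 0 = c &
        [/\ [disjoint sources st & ilevel st i], u \in sources st, v \in ilevel st i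
          & itight st c u v]]).

Definition leveled st t s :=
  (forall x, narr s 17 x <= t)%N /\ (forall x, (narr s 17 x != 0%N) = (x \in ilevel st t)).

(** Only heads with a mark of at most [t.+1] are used, so the marks [t.+2] set in this round do not
    propagate and the levels stay exact. *)
Lemma round_ok st t s : ctx I st s -> base1 I (fstb st) -> base2 I (sndb st) ->
  narr s 50 0 = t -> leveled st t.+1 s -> found st s ->
  let s' := den (arc_loop k scan) s in leveled st t.+2 s' /\ found st s'.
Proof.
move=> cx b1 b2 ht [l1 l2] fd.
(* Halfway through a round the old marks are exactly level [t.+1] and the new ones lie in level
   [t.+2]. Completeness is claimed only for the arcs in [A]. *)
pose J (A : {set bool * elt * elt}) (s' : store R) :=
  [/\ forall x, (narr s' 17 x <= t.+2)%N,
      forall x, (0 < narr s' 17 x <= t.+1)%N = (x \in ilevel st t.+1),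
      forall x, narr s' 17 x = t.+2 -> x \in ilevel st t.+2,
      forall c u v, (c, u, v) \in A -> itight st c u v -> v \in ilevel st t.+1 ->
        narr s' 17 u != 0%N
    & found st s'].
have : J setT (den (arc_loop k scan) s).
  apply: (arc_loop_rule cx b1 b2) => //.
  - move=> A s1 s2 [ag _] [h1 h2 h3 h4 h5]; split.
    + by move=> x; rewrite ag.
    + by move=> x; rewrite ag.
    + by move=> x; rewrite ag //; apply: h3.
    + by move=> c u v; rewrite ag //; apply: h4.
    case: h5 => [[f1 f2]|[f1 f2]]; [left|right]; rewrite !ag //; split=> // x /f2.
    by rewrite ag.
  - split=> //.
    + by move=> x; apply: leq_trans (l1 x) _.
    + by move=> x; rewrite l1 andbT lt0n l2.
    + by move=> x e; have := l1 x; rewrite e ltnn.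
    + by move=> c u v; rewrite inE.
  move=> A s' c u v cx' hu hv _ ht' _ fr [h1 h2 h3 h4 h5].
  have h50 : narr s' 50 0 = t by rewrite fr.
  have [_ _ h11 h12 _] := cx'.
  rewrite /scan den_if.
  have -> : beval s' (BAnd (tight_exp c) (BAnd (BNot (isz (NGet 17 (cell 52))))
      (BAnd (NLe (NGet 17 (cell 52)) (NAdd (cell 50) (NConst 1))) (isz (NGet 17 (cell 51))))))
    = [&& itight st c u v, v \in ilevel st t.+1 & narr s' 17 u == 0%N].
    rewrite -ht' -h2; rewrite -[LHS]/(_ && _); congr (_ && _) => /=.
    by rewrite hu hv h50 addn1 !leqn0 lt0n andbA.
  case: ifP => [/and3P[tt vl /eqP u0]|no]; last first.
    split=> // c' u' v'; rewrite in_setU1 => /orP[/eqP[-> -> ->] tt vl|]; last exact: h4.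
    by move: no; rewrite tt vl /= => ->.
  rewrite den_seq; set s1 := den _ s'.
  have e17 x : narr s1 17 x = if x == u then t.+2 else narr s' 17 x.
    by rewrite /s1 /= /upd /= hu h50 addn2.
  have uL : u \notin ilevel st t.+1 by rewrite -h2 u0.
  have uL2 : u \in ilevel st t.+2 by apply: levelS tt.
  have J1 : forall s2, (forall x, narr s2 17 x = narr s1 17 x) -> found st s2 ->
      J ((c, u, v) |: A) s2.
    move=> s2 e fd2; split=> //.
    - by move=> x; rewrite e e17; case: eqP.
    - move=> x; rewrite e e17; case: eqP => [->|_] //=.
      by rewrite (negPf uL) ltnn.
    - by move=> x; rewrite e e17; case: eqP => [->|_] //; apply: h3.
    - move=> c' u' v'; rewrite in_setU1 e e17 => /orP[/eqP[_ -> _]|h]; first by rewrite eqxx.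
      by move=> t' v'L; case: ifP => // _; apply: h4 h t' v'L.
  rewrite den_if.
  have k1 a i : a != 17%N -> narr s1 a i = narr s' a i.
    by move=> ne; apply: den_nkeep.
  clearbody s1.
  have -> : beval s1 (BAnd (beq (NGet 11 (cell 51)) (NConst 1))
       (BAnd (isz (NGet 12 (cell 51))) (isz (cell 18))))
     = (u \in sources st) && (narr s' 18 0 == 0%N).
    rewrite [LHS]/= !k1 // hu h11 h12 -eqn_leq eqb1 !leqn0 eqb0 inE andbA.
    by congr (_ && _); rewrite andbC.
  case: ifP => [/andP[uS /eqP f0]|nf].
    apply: J1 => //; right; split=> //; exists t.+1, c, u, v.
    split; [by rewrite /= /upd /= k1|by rewrite /= /upd /= k1|by []|split=> //].
    case: h5 => [[_ fS]|[f1 _]]; last by rewrite f1 in f0.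
    rewrite disjoint_subset; apply/subsetP=> x xS; rewrite inE -h2.
    by rewrite fS.
  apply: J1 => //; case: h5 => [[f0 fS]|[f1 h]]; [left|right]; last first.
    by rewrite !k1.
  rewrite k1 //; split=> // x xS; rewrite e17; case: eqP => [ex|_]; last exact: fS.
  by move: nf; rewrite -ex xS f0.
case=> h1 h2 h3 h4 h5; split=> //; split=> // x.
have sub := level_sub (base1 I) (base2 I) (price I) st (leqnSn t.+1).
apply/idP/idP => [nz|xL].
  have := h1 x; rewrite leq_eqVlt => /orP[/eqP|lt]; first exact: h3.
  by apply: (subsetP sub); rewrite -h2 lt0n nz.
have [xS|[y [c [yL tt]]]] := levelSP xL; last by apply: h4 tt yL; rewrite inE.
have xL1 : x \in ilevel st t.+1.
  by rewrite /level iterS inE xS.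
by move: xL1; rewrite -h2 lt0n => /andP[].
Qed.

Lemma level1 st : ilevel st 1 = sinks st.
Proof.
apply/setP=> x; rewrite /level /= /expand inE [X in _ || X]inE.
by case: (boolP [exists _ in _, _]); rewrite ?orbF // => /exists_inP[y]; rewrite inE.
Qed.

(** The marks describe level 1 before any round, so [N] rounds end at level [N.+1]; the fixpoint is
    already attained at [N]. *)
Lemma level_card st : ilevel st N.+1 = icoreach st.
Proof.
have e : ilevel st N = icoreach st by rewrite /coreach /fixset card_ord.
by rewrite /level iterS -/(level _ _ _ st N) e; apply: fixsetK; apply: expand_mono.
Qed.

Lemma levels_ok st s : ctx I st s -> base1 I (fstb st) -> base2 I (sndb st) ->
  let s' := den (levels k) s in
  [/\ ctx I st s', forall x, (narr s' 17 x != 0%N) = (x \in icoreach st) & found st s'].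
Proof.
move=> cx b1 b2; rewrite /levels; set z0 := SN 18 _ _; set li := for_elt _ 43 _.
set lr := for_elt _ 50 _.
rewrite (den_cons z0) (den_cons li) (den_cons lr) den_nil.
set s1 := den z0 s; set s2 := den li s1; set s' := den lr s2.
have c1 : ctx I st s1 by apply: ctx_den.
have c2 : ctx I st s2 by apply: ctx_den.
have l2 x : narr s2 17 x = (x \in sinks st).
  have [_ _ h11 h12 _] := c1.
  pose P i (t : store R) := forall x, (x < i)%N -> narr t 17 x = (x \in sinks st).
  suff h : P N s2 by apply: h.
  rewrite /N -(ctx_bound c1); apply: for_rule => //.
  rewrite (ctx_bound c1) => i t iN ei [fr _] Pi y; pose z : elt := Ordinal iN.
  rewrite (elt_ltS y iN) -/z den_if.
  have -> : beval t (BAnd (isz (NGet 11 (cell 43))) (beq (NGet 12 (cell 43)) (NConst 1)))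
      = (z \in sinks st).
    by rewrite [LHS]/= ei !fr // (h11 z) (h12 z) -eqn_leq eqb1 leqn0 eqb0 inE.
  have yz : (nat_of_ord y == i) = (y == z) by [].
  by case: ifP => zS; rewrite /= /upd /= ei yz; case: eqP => [->|_] //= ; rewrite ?zS // => /Pi.
have f2 : found st s2.
  left; split; first by rewrite den_nkeep.
  by move=> x; rewrite inE => /andP[x2 x1]; rewrite l2 inE x1.
pose P t (s3 : store R) := [/\ ctx I st s3, leveled st t.+1 s3 & found st s3].
have : P N s'.
  rewrite /N /s' -(ctx_bound c2); apply: for_rule => //.
  - move=> t s3 w [h1 h2 h3]; split=> //.
    by apply: ctx_agree h1 _ _ => // b i bA /=; rewrite /upd; case: eqVneq bA => [->|].
  - split=> //; split=> x; first by rewrite l2 leq_b1.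
    by rewrite l2 level1 eqb0 negbK.
  move=> t s3 _ et _ [h1 h2 h3]; have [h4 h5] := round_ok h1 b1 b2 et h2 h3.
  by split=> //; apply: ctx_den.
by case=> h1 [_ h2] h3; split=> // x; rewrite h2 level_card.
Qed.

(** Flag 22 distinguishes the cases: if it is still 0, no arc crosses, and the unchanged potential
    corresponds to [StepStuck]. *)
Lemma drop_ok st s : ctx I st s -> base1 I (fstb st) -> base2 I (sndb st) ->
  (forall x, (narr s 17 x != 0%N) = (x \in icoreach st)) ->
  [disjoint sources st & icoreach st] ->
  exists2 st', istep st st' & ctx I st' (den (drop_stm k) s).
Proof.
move=> cx b1 b2 lv dis; rewrite /drop_stm; set z0 := SN 22 _ _; set fin := SIf _ _ _.
rewrite (den_cons z0) (den_cons (arc_loop k min_slack)) (den_cons fin) den_nil.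
set s1 := den z0 s; set s2 := den _ s1.
have c1 : ctx I st s1 by apply: ctx_den.
pose J (A : {set bool * elt * elt}) (s' : store R) :=
  (narr s' 22 0 = 0%N /\ forall c u v, (c, u, v) \in A -> ~~ icrossing st c u v) \/
  (narr s' 22 0 = 1%N /\ exists c u v, [/\ icrossing st c u v, rarr s' 2 0 = islack st c u v
     & forall c' u' v', (c', u', v') \in A -> icrossing st c' u' v' ->
         islack st c u v <= islack st c' u' v']).
have JT : J setT s2.
  apply: (arc_loop_rule c1 b1 b2) => //.
  - by move=> A t t' [ag agr]; rewrite /J !ag // agr.
  - by left; split=> // c u v; rewrite inE.
  move=> A t c u v cx' hu hv ha _ hs fr h.
  rewrite /min_slack den_if.
  have lvt x : narr t 17 x = narr s 17 x by rewrite fr.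
  have -> : beval t (BAnd (arc_exp c) (BAnd (isz (NGet 17 (cell 51)))
        (BAnd (BNot (isz (NGet 17 (cell 52))))
              (bor (isz (cell 22)) (RLe (slack_exp c) (RGet 2 (NConst 0)))))))
     = icrossing st c u v && ((narr t 22 0 == 0%N) || (islack st c u v <= rarr t 2 0)).
    transitivity [&& beval t (arc_exp c), narr t 17 u == 0%N, narr t 17 v != 0%N
      & (narr t 22 0 == 0%N) || (reval t (slack_exp c) <= rarr t 2 0)].
      rewrite beval_and.
      by congr (_ && _); rewrite /= hu hv negb_and !negbK !leqn0.
    rewrite ha hs !lvt /crossing -(lv u) -(lv v) negbK.
    by case: (iarc st c u v); rewrite /= ?andbF ?andbT ?andbA.
  case: ifP => [/andP[cr le]|no].
    right; rewrite den_seq; set t1 := den _ t.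
    have hs1 : reval t1 (slack_exp c) = islack st c u v.
      by rewrite -hs /t1; case: (c).
    split; first by rewrite /= /upd.
    exists c, u, v; split=> //.
    move=> c' u' v'; rewrite in_setU1 => /orP[/eqP[-> -> ->]//|inA cr'].
    case: h => [[_ h]|[h1 [c0 [u0 [v0 [cr0 e0 mn]]]]]].
      by have := h _ _ _ inA; rewrite cr'.
    move: le; rewrite h1 /= e0 => le; apply: le_trans le _; exact: mn.
  case: h => [[h1 h2]|[h1 [c0 [u0 [v0 [cr0 e0 mn]]]]]].
    left; split=> // c' u' v'; rewrite in_setU1 => /orP[/eqP[-> -> ->]|]; last exact: h2.
    by move: no; rewrite h1 eqxx /= andbT => ->.
  right; split=> //; exists c0, u0, v0; split=> // c' u' v'.
  rewrite in_setU1 => /orP[/eqP[-> -> ->] cr|]; last exact: mn.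
  move: no; rewrite cr h1 /= e0 => /negbT; rewrite -ltNge => lt; exact: ltW.
have c2 : ctx I st s2 by apply: ctx_den.
have lv2 x : narr s2 17 x = narr s 17 x by rewrite !den_nkeep.
rewrite /fin den_if beval_isz [neval _ _]/=.
case: JT => [[h1 h2]|[h1 [c [u [v [cr e0 mn]]]]]]; rewrite h1 ?eqxx; last rewrite (_ : (1 == 0)%N = false) //.
  by exists st => //; apply: StepStuck => // c u v; apply: h2; rewrite inE.
exists (potential_drop (base1 I) (base2 I) (price I) st (islack st c u v)).
  by apply: StepDrop => // c' u' v'; apply: mn; rewrite inE.
have c3 := c2; case: c3 => h3 h4 h5 h6 h7.
set lp := for_elt _ _ _; split.
- exact: inputs_den.
- exact: tabulated_den.
- by move=> x; rewrite den_nkeep // h5.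
- by move=> x; rewrite den_nkeep // h6.
pose P i (t : store R) := forall x, rarr t 1 x =
  if (x < i)%N && (x \notin icoreach st) then pot st x - islack st c u v else pot st x.
have : P N (den lp s2).
  rewrite /N -(ctx_bound c2); apply: for_rule => //.
  rewrite (ctx_bound c2) => i t iN ei [fr frr] Pi x; pose y : elt := Ordinal iN.
  rewrite (elt_ltS x iN) -/y den_if beval_isz [neval _ _]/= ei fr // (lv2 y).
  rewrite -[_ == 0%N]negbK lv.
  have xy : (nat_of_ord x == i) = (x == y) by [].
  case: ifP => yQ; rewrite /= ?/upd /= ?ei ?xy ?Pi; case: eqP => [->|_] //=.
    rewrite yQ (frr 2%N) // e0; congr (_ - _).
    by rewrite (Pi y) ltnn.
  by rewrite ltnn yQ.
by move=> h x /=; rewrite h ltn_ord /=; case: (x \in _).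
Qed.

Lemma exchange_ok st s c u v : ctx I st s -> narr s 19 0 = u -> narr s 20 0 = v ->
  narr s 21 0 = c -> ctx I (exchange st c u v) (den exchange_stm s).
Proof.
move=> cx hu hv hc; have [h1 h2 h3 h4 h5] := cx.
split.
- exact: inputs_den.
- exact: tabulated_den.
- move=> x; rewrite /exchange_stm den_if beval_isz [neval _ _]/= hc eqb0.
  case: (c) => /=; last exact: h3.
  by rewrite /upd /= hu hv !val_eqE in_swap; case: (x == v); case: (x == u); rewrite ?h3.
- move=> x; rewrite /exchange_stm den_if beval_isz [neval _ _]/= hc eqb0.
  case: (c) => /=; first exact: h4.
  by rewrite /upd /= hu hv !val_eqE in_swap; case: (x == u); case: (x == v); rewrite ?h4.
- by move=> x; rewrite den_rkeep // h5; case: (c).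
Qed.

Lemma step_ok st s : ctx I st s -> base1 I (fstb st) -> base2 I (sndb st) ->
  exists2 st', istep st st' & ctx I st' (den (step_stm k) s).
Proof.
move=> cx b1 b2; rewrite /step_stm den_seq; have [] := levels_ok cx b1 b2.
move: (den _ s) => s1 c1 lv; rewrite den_if beval_isz [neval _ _]/=.
case=> [[f0 fS]|[f1 [i [c [u [v [hu hv hc [dis uS vL t]]]]]]]].
  rewrite f0 eqxx; apply: drop_ok => //.
  rewrite disjoint_subset; apply/subsetP=> x xS.
  by rewrite inE -lv fS.
rewrite f1 /=; exists (exchange st c u v); last exact: exchange_ok.
exact: StepExchange dis uS vL t.
Qed.

Lemma main_ok st s B : ctx I st s -> split_optimal (base1 I) (base2 I) (price I) st ->
  base1 I B -> base2 I B ->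
  exists st', [/\ ctx I st' (den (main_stm k) s), split_optimal (base1 I) (base2 I) (price I) st'
    & fstb st' = sndb st'].
Proof.
move=> cx op bB1 bB2.
have ex1 : sym_exchange (fun B : {set elt} => base1 I B) by exact: forest_base_exchange.
have ex2 : sym_exchange (fun B : {set elt} => base2 I B).
  by apply: degree_base_exchange; [exact: same_equiv|exact: same_head].
pose pr (st' : mstate elt R) := progress (base1 I) (base2 I) (price I) st'.
pose K := (N.+1 * (2 * N + 3))%N.
(* Until the bases meet, each of the [i] steps has used up a unit of the measure; at [i = K] the
   second alternative is impossible. *)
pose P i (t : store R) := exists st', [/\ ctx I st' t,
  split_optimal (base1 I) (base2 I) (price I) st'
  & fstb st' = sndb st' \/ (pr st' + i < K)%N].
have P0 : P 0%N s.
  exists st; split=> //; right; rewrite addn0 /K /N /pr.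
  have := progress_le (base1 I) (base2 I) (price I) st; by rewrite card_ord.
have Pset a i t w : a \notin ctx_arrays -> P i t -> P i (setn t a 0 w).
  move=> na [st' [h1 h2 h3]]; exists st'; split=> //.
  apply: ctx_agree h1 _ _ => // b j bA; rewrite /= /upd.
  by case: eqVneq bA na => [->->|].
have PS i t : P i t -> P i.+1 (den (step_stm k) t).
  case=> st' [h1 h2 h3]; have [[b1 _] [b2 _]] := h2.
  have [st'' sp c''] := step_ok h1 b1 b2.
  have [e|ne] := eqVneq (fstb st') (sndb st').
    have [e'' o''] := mstep_done e sp.
    by exists st''; split=> //; [apply: o''|left].
  have s0 : sources st' != set0.
    by rewrite (sources0_eq (@bases_card _ _ _ _ I) h2).
  have [o'' lt] := mstep_progress ex1 ex2 (@bases_card _ _ _ _ I) h2 bB1 bB2 s0 sp.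
  exists st''; split=> //; right; case: h3 => [e|h]; first by rewrite e eqxx in ne.
  by rewrite addnS; apply: leq_ltn_trans h; rewrite ltn_add2r.
have [inp _ _ _ _] := cx; have [[_ em] _ _ _ _] := inp.
pose body := SFor 61 3 0 (2 * (3 * k.+1)) (step_stm k).
pose Q i (t : store R) := narr t 0 1 = m /\ P (i * (2 * N + 3))%N t.
have lb : loop_bound s 1 0 (3 * k.+1) = N.+1 by rewrite /loop_bound em mul0n add0n.
have : Q N.+1 (den (main_stm k) s).
  rewrite -lb; apply: for_rule.
  - by move=> i t w [h1 h2]; split=> //; apply: Pset.
  - by split=> //; rewrite mul0n.
  move=> i t _ _ _ [hm h].
  have lb2 : loop_bound t 3 0 (2 * (3 * k.+1)) = (2 * N + 3)%N.
    by rewrite /loop_bound hm mul0n add0n addnC -mulnA.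
  split; first by rewrite den_nkeep.
  pose P' j (t' : store R) := P (i * (2 * N + 3) + j)%N t'.
  suff : P' (2 * N + 3)%N (den body t) by rewrite /P' mulSn addnC.
  rewrite -lb2; apply: for_rule.
  - by move=> j t' w; apply: Pset.
  - by rewrite /P' addn0.
  - by move=> j t' _ _ _ h'; rewrite /P' addnS; apply: PS.
case=> _ [st' [h1 h2 h3]]; exists st'; split=> //; case: h3 => //.
by rewrite /K ltnNge leq_addl.
Qed.

Lemma output_ok st s : ctx I st s -> (forall e : 'I_m, narr s 4 e = 0%N) ->
  output_set m (den (output_stm k) s) = (@edge m k) @: fstb st.
Proof.
move=> cx z4; have [inp tab h11 _ _] := cx.
pose P i (t : store R) := forall e : 'I_m,
  (narr t 4 e != 0%N) = [exists x in fstb st, (x < i)%N && (edge x == e)].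
have : P N (den (output_stm k) s).
  rewrite /N -(ctx_bound cx); apply: for_rule => //.
    move=> e; rewrite z4 eqxx; apply/esym/negbTE/exists_inPn => x _.
    by rewrite ?ltn0.
  rewrite (ctx_bound cx) => i t iN ei [fr _] Pi e; pose y : elt := Ordinal iN.
  have [t5 _ _ _ _] := tab y.
  have split_y : [exists x in fstb st, (x < i.+1)%N && (edge x == e)] =
     (y \in fstb st) && (edge y == e) || [exists x in fstb st, (x < i)%N && (edge x == e)].
    apply/exists_inP/idP.
      case=> x xB /andP[]; rewrite (elt_ltS x iN) => /orP[/eqP ex|lt] xe.
        by rewrite -/y in ex; rewrite -ex xB xe.
      by apply/orP; right; apply/exists_inP; exists x; rewrite // lt.
    case/orP=> [/andP[yB ye]|/exists_inP[x xB /andP[lt xe]]].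
      by exists y; rewrite // ye ltnS leqnn.
    by exists x; rewrite // xe ltnS ltnW.
  rewrite split_y den_if beval_beq [neval _ _]/= [neval _ _]/= ei fr // (h11 y) eqb1.
  case: ifP => yB /=; last exact: Pi.
  rewrite /upd /= ei fr // t5 val_eqE [edge y == e]eq_sym.
  by case: (e == edge y) => //=; apply: Pi.
move=> h; apply/setP=> e; rewrite inE h.
apply/exists_inP/imsetP => [[x xB /andP[_ /eqP <-]]|[x xB ->]]; first by exists x.
by exists x; rewrite // ltn_ord eqxx.
Qed.

(** The feasible set [F] serves twice: it makes the greedy second base complete, and it supplies the
    common base that keeps the main loop from getting stuck. *)
Lemma algorithm_ok F : fgc_feasible I 1 k F ->
  let F' := output_set m (den (algorithm k) (input_store I)) in
  fgc_feasible I 1 k F' /\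
  forall Fopt, fgc_feasible I 1 k Fopt -> total_cost I F' <= k.+1%:R * total_cost I Fopt.
Proof.
move=> feas; rewrite /algorithm.
rewrite (den_cons (tables k)) (den_cons (init1 k)) (den_cons (init2 k)) (den_cons (init_pot k)).
rewrite (den_cons (main_stm k)) (den_cons (output_stm k)) den_nil.
set s0 := input_store I; have i0 : inputs I s0 by apply: inputs_ok.
set s1 := den (tables k) s0.
have i1 : inputs I s1 by apply: inputs_den.
have t1 : tabulated k I s1 by apply: tables_ok.
have [||B1 [b1 sp1] h1] := init1_ok i1 t1.
- by move=> e; rewrite den_nkeep.
- by move=> x; rewrite den_nkeep.
set s2 := den (init1 k) s1 in h1 *.
have i2 : inputs I s2 by apply: inputs_den.
have t2 : tabulated k I s2 by apply: tabulated_den.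
have [||B2 [g1 g2 g3] h2] := init2_ok i2 t2.
- by move=> x; rewrite !den_nkeep.
- by move=> v; rewrite !den_nkeep.
have b2 := start_base feas g1 g2 g3.
set s3 := den (init2 k) s2 in h2 *.
have i3 : inputs I s3 by apply: inputs_den.
have t3 : tabulated k I s3 by apply: tabulated_den.
have h1' x : narr s3 11 x = (x \in B1) by rewrite -h1 den_nkeep.
have z1 x : rarr s3 1 x = 0 by rewrite !den_rkeep.
have cx := init_pot_ok i3 t3 h1' h2 z1.
set s4 := den (init_pot k) s3 in cx *.
have dis : [disjoint B1 & B2].
  rewrite disjoint_subset; apply/subsetP=> x /sp1 sx; rewrite inE.
  by apply/negP => /g1; rewrite /start_ok inE sx.
have op := split_optimal_init (w := price I) (forest_base_exchange (tl := elt_tail I) (hd := elt_head I)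
   (ly := @lay m k)) (degree_base_exchange (r := ord0) (q := k.+1) (same_equiv I)
   (@same_head _ _ _ _ I)) b1 b2 dis (fun x => cost_ge0 I (edge x)).
have [B [bB1 bB2 _]] := common_base_exists feas.
have [st [c5 o5 e5]] := main_ok cx op bB1 bB2.
have [[bf _] [bs _]] := o5.
rewrite -e5 in bs.
rewrite (output_ok c5); last by move=> e; rewrite !den_nkeep.
split; first exact: common_base_feasible.
move=> Fopt /common_base_exists[B' [b1' b2' le]].
apply: le_trans (edge_cost I _) _; apply: le_trans le.
exact: split_optimal_common o5 e5 b1' b2'.
Qed.

End Steps.

Theorem theorem2 (k : nat) (hk : (0 < k)%N) :
  exists (A : cmd) (C d : nat),
    forall (R : realType) (n m : nat) (I : fgc_instance R n m),
      (exists F : {set 'I_m}, fgc_feasible I 1 k F) ->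
      exists (t : nat) (s : store R),
        [/\ exec A (input_store I) t s,
            (t <= C * (n + m).+1 ^ d)%N,
            fgc_feasible I 1 k (output_set m s)
          & forall Fopt : {set 'I_m}, fgc_optimal I 1 k Fopt ->
              total_cost I (output_set m s) <= k.+1%:R * total_cost I Fopt].
Proof.
have /andP[w k0] := algorithm_wf k; have [C [d H]] := compile_exec w k0.
exists (compile (algorithm k)), C, d => R n m I [F feas].
have [t [ex le]] := H R (input_store I).
exists t, (den (algorithm k) (input_store I)).
have le' : (t <= C * (n + m).+1 ^ d)%N by [].
(* The root [ord0] needs a vertex. Without vertices there are no edges either, and all costs are
   0. *)
case: n I feas t ex le le' => [|n] I feas t ex le le'.
  have no (e : 'I_m) : False by case: (src I e).
  split=> //; first by move=> F' _ _ D _ x; case: x.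
  move=> Fopt _; rewrite /total_cost !big1 ?mulr0 // => e _; by case: (no e).
by have [f o] := algorithm_ok feas; split=> // Fopt [fo _]; apply: o.
Qed.
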